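(* Let $\{X(n)\}_{n\ge0}$ be a time-homogeneous real-valued Markov chain, and for each $x$ let $\xi(x)$ be a random variable distributed as the jump of the chain from the state $x$. Assume that $\mathbf E[\xi(x)]=0$ and $\mathbf E[\xi^2(x)]=1$ for all $x$, and that there is a positive random variable $Y$ with finite second moment such that $\mathbf P(|\xi(x)|>y)\le\mathbf P(Y>y)$ for all $x$ and all $y\ge0$. Let $\tau:=\inf\{n\ge1:\ X(n)\le0\}$, let $V(x):=x-\mathbf E_x[X(\tau)]$ for $x>0$, and let $\widehat{\mathbf P}_x$ be the law of the Doob $h$-transform, with $h=V$, of the chain killed at $\tau$. Then, for every fixed $x>0$, $$\lim_{n\to\infty}\widehat{\mathbf P}_x\left(\frac{X(n)}{\sqrt n}\ge v\right)=\sqrt{\frac2\pi}\int_v^\infty u^2e^{-u^2/2}\,du\quad\text{for every }v>0 .$$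
   Context: $\mathbf P_x$ and $\mathbf E_x$ denote probability and expectation for the chain conditioned on $X(0)=x$; $\mathbf P(\xi(x)\in B)=\mathbf P(X(1)-x\in B\mid X(0)=x)$. Under the stated assumptions $V$ is finite, positive and harmonic for the chain killed at leaving $(0,\infty)$: $\mathbf E_x[V(X(1));\tau>1]=V(x)$ for $x>0$. The $h$-transform is given by $$\widehat{\mathbf P}_x(X(n)\in B)=\int_B\frac{V(y)}{V(x)}\,\mathbf P_x(X(n)\in dy,\ \tau>n)$$ for all $x>0$, $n\ge1$ and Borel $B\subset(0,\infty)$. *)

(* Defs.v *)
From HB Require Import structures.
From mathcomp Require Import all_boot all_order all_algebra.
From mathcomp Require Import all_classical all_reals all_analysis.

Set Implicit Arguments.
Unset Strict Implicit.
Unset Printing Implicit Defensive.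

Import Order.TTheory GRing.Theory Num.Theory numFieldNormedType.Exports.

Local Open Scope classical_set_scope.
Local Open Scope ring_scope.
Local Open Scope ereal_scope.

Section MarkovChain.
Context {d : measure_display} {Omega : measurableType d} {R : realType}.

Definition natural_filtration (X : nat -> {mfun Omega >-> R}) (n : nat) :
    set (set Omega) :=
  <<s \bigcup_(k in [set k : nat | (k <= n)%N])
        preimage_set_system setT (X k) measurable >>.

(* A time-homogeneous Markov chain in its canonical form: a single process X
   with a family (Px x) of laws, Px x being the law of the chain conditioned on
   X 0 = x, all sharing the transition kernel K. *)
Record markov_chain (K : R.-pker R ~> R) (Px : R -> probability Omega R)
    (X : nat -> {mfun Omega >-> R}) : Prop := MarkovChain {
  markov_init : forall x, Px x [set w | X 0%N w = x] = 1 ;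
  markov_step : forall x n A B, natural_filtration X n A -> measurable B ->
    Px x (A `&` X n.+1 @^-1` B) = \int[Px x]_(w in A) K (X n w) B }.

(* The infimum of the empty set is +oo. *)
Definition tau (X : nat -> Omega -> R) (w : Omega) : \bar R :=
  ereal_inf [set (n%:R)%:E | n in [set n : nat | (1 <= n)%N /\ (X n w <= 0)%R]].

(* On {tau = +oo} (a null event under the assumptions of the theorem) the value
   is set to 0, so that the expectation of X_tau is E[X_tau; tau < +oo]. *)
Definition X_tau (X : nat -> Omega -> R) (w : Omega) : R :=
  if tau X w is r%:E then X (Num.truncn r) w else 0%R.

(* Kept extended-real-valued: finiteness of the expectation is not built in. *)
Definition V (Px : R -> probability Omega R) (X : nat -> Omega -> R) (x : R) :
    \bar R :=
  x%:E - 'E_(Px x)[X_tau X].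

Definition killed_law (Px : R -> probability Omega R) (X : nat -> Omega -> R)
    (x : R) (n : nat) (A : set R) : \bar R :=
  Px x ([set w | (n%:R)%:E < tau X w] `&` X n @^-1` A).

(* One-dimensional marginals of the h-transform; meant for x > 0, 1 <= n and
   B included in ]0, +oo[. *)
Definition doob_transform (h : R -> \bar R) (Px : R -> probability Omega R)
    (X : nat -> Omega -> R) (x : R) (n : nat) (B : set R) : \bar R :=
  \int[killed_law Px X x n]_(y in B) (h y / h x).

End MarkovChain.

(* Main.v *)
Require Import Defs.
From HB Require Import structures.
From mathcomp Require Import all_boot all_order all_algebra.
From mathcomp Require Import all_classical all_reals all_analysis.
From mathcomp Require Import measurable_realfun ring lra.

Set Implicit Arguments.
Unset Strict Implicit.
Unset Printing Implicit Defensive.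

Import Order.TTheory GRing.Theory Num.Theory numFieldNormedType.Exports.
Local Open Scope classical_set_scope.
Local Open Scope ring_scope.

(** The h-transform weighs the killed chain by V(X n) / V(x), and V(y) - y is a
    mean overshoot: V(y) is y plus the mean of the negative part of the first
    nonpositive value of the chain (V_series). By the Markov property the
    overshoots that V(X n) adds to X n are those which the chain started at x
    has after time n. They are the tail of a convergent series, so that V(X n)
    may be replaced by X n (late_overshoot_cvg0). It remains to find, for
    every v > 0, the limit of E_x[X n; X n >= v sqrt n, tau > n].

    Let Z = exp(- X n ^2 / n). Under the weight X n on {tau > n}, the k-th
    moment of Z is E_x[X n exp(- k X n ^2 / n); tau > n]. The function g(y) =
    y exp(- c y^2) with c = k / n is odd, so the heat flow keeps it zero at 0,
    and it does so in closed form: after m units of time it has become w^3 y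
    exp(- c w^2 y^2) with w = (1 + 2 c m)^(-1/2) (twave). Replacing one jump
    of the chain by one unit of heat time costs o(1 / sqrt n), by a Taylor
    expansion which uses only the two moments that all jumps share and a
    truncation controlled by Y (twave_step, approx_drift). The probabilities
    of {tau > k} sum to O(sqrt n) for k < n, so that these errors vanish in
    the limit; the only other loss is at the exit from the half-line, and
    after a late time m0 it is at most the overshoot still to come. At m0 the
    profile with n - m0 units to go is nearly the linear function (1 +
    2k)^(-3/2) y, and E_x[X m0; tau > m0] is nearly V(x). Hence the k-th
    moment tends to (1 + 2k)^(-3/2) V(x) (gaussian_limit).

    The numbers (1 + 2k)^(-3/2) are the moments of exp(- U^2) for U with the
    density sqrt(2 / pi) u^2 exp(- u^2 / 2) on the half-line (maxwell_moment),
    and on the unit interval moments determine limits of distribution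
    functions at continuity points (cvg_functional_tail).

    The a priori estimates are in survival_bound: the overshoots sum to a
    finite mean, and the expected survival time up to n is O(sqrt n). Both
    come from a truncated parabola as Lyapunov function (cap), whose drift is
    at most - 1/4 on (0, L] and at most 0 above, up to the undershoot below -
    b. The chain therefore spends expected time O(L) in (0, L]. Conversely an
    undershoot below - b from height about j requires a jump larger than b +
    j, so that the total undershoot is at most a sum of P(Y > b + j) against
    the time spent in (0, j + 1]. The finite second moment makes that sum
    small for large b, and the estimate closes on itself (sum_undershoot_le). *)

(** * The killed chain and its harmonic function *)

Section MonotoneClass.
Local Open Scope ereal_scope.
Context {d1 d2 : measure_display} {S : measurableType d1} {T : measurableType d2}
  {R : realType}.
Import HBNNSimple.

(** Both sides are additive in f and continuous along increasing sequences, so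
    an identity between measures extends from indicators to simple functions
    and then to all nonnegative measurable functions. *)
Lemma integral_disintegration (P : {measure set S -> \bar R}) (A : set S)
    (phi : S -> T) (k : S -> {measure set T -> \bar R}) :
  measurable A -> measurable_fun setT phi ->
  (forall B, measurable B -> measurable_fun setT (k ^~ B)) ->
  (forall B, measurable B -> P (A `&` phi @^-1` B) = \int[P]_(w in A) k w B) ->
  forall f : T -> \bar R, measurable_fun setT f -> (forall t, 0 <= f t) ->
  \int[P]_(w in A) f (phi w) = \int[P]_(w in A) \int[k w]_t f t.
Proof.
move=> mA mphi mk Pk f mf f0.
have mphiD B : measurable B -> measurable (phi @^-1` B).
  by move=> mB; rewrite -[X in measurable X]setTI; exact: mphi.
pose g := nnsfun_approx measurableT mf.
have gcvg t : (g n t)%:E @[n --> \oo] --> f t by exact: cvg_nnsfun_approx.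
have gnd t m n : (m <= n)%N -> (g m t)%:E <= (g n t)%:E.
  by move=> mn; rewrite lee_fin; exact/lefP/nd_nnsfun_approx.
have mkg n : measurable_fun setT (fun w => \int[k w]_t (g n t)%:E).
  apply: measurable_fun_integral_kernel => //; first by move=> z; rewrite lee_fin.
  exact/measurable_EFinP.
have simple n :
    \int[P]_(w in A) (g n (phi w))%:E = \int[P]_(w in A) \int[k w]_t (g n t)%:E.
  under eq_integral do rewrite fimfunE -fsumEFin//.
  under [RHS]eq_integral do rewrite integralT_nnsfun sintegralE.
  rewrite ge0_integral_fsum//; last 2 first.
  - move=> r; apply/measurable_EFinP/measurable_funM => //.
    apply: (measurable_funS measurableT) => //.
    rewrite (_ : (fun _ => _) = \1_(phi @^-1` (g n @^-1` [set r])))//.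
    by apply: measurable_indic; apply: mphiD.
  - by move=> r w _; rewrite EFinM nnfun_muleindic_ge0.
  rewrite ge0_integral_fsum//; last 2 first.
  - move=> r; apply: measurable_funeM; apply: (measurable_funS measurableT) => //.
    exact: mk.
  - move=> r w _; have := mulemu_ge0 (fun r => g n @^-1` [set r]).
    by apply; exact: preimage_nnfun0.
  apply: eq_fsbigr => r _.
  have mr : measurable (phi @^-1` (g n @^-1` [set r])) by exact: mphiD.
  rewrite (integralZl_indic mA (fun r => phi @^-1` (g n @^-1` [set r])))//; last first.
    by move=> r0; rewrite preimage_nnfun0// preimage_set0.
  rewrite integral_indic//.
  have [r0|r0] := leP 0%R r.
    rewrite ge0_integralZl//; first by rewrite -Pk// setIC.
    by apply: (measurable_funS measurableT) => //; exact: mk.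
  rewrite preimage_nnfun0// preimage_set0 set0I measure0 mule0.
  by rewrite integral0_eq// => w _; rewrite measure0 mule0.
transitivity (limn (fun n => \int[P]_(w in A) (g n (phi w))%:E)).
  rewrite -monotone_convergence//.
  - by apply: eq_integral => w _; apply/esym/cvg_lim.
  - move=> n; apply/measurable_EFinP; apply: (measurable_funS measurableT) => //.
    exact: measurableT_comp.
  - by move=> n w _; rewrite lee_fin.
  - by move=> w _ m n; exact: gnd.
under eq_fun do rewrite simple.
rewrite -monotone_convergence//.
- apply: eq_integral => w _; rewrite -monotone_convergence//.
  + by apply: eq_integral => t _; apply/cvg_lim.
  + by move=> n; exact/measurable_EFinP.
  + by move=> n t _; rewrite lee_fin.
  + by move=> t _ m n; exact: gnd.
- by move=> n; apply: (measurable_funS measurableT).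
- by move=> n w _; apply: integral_ge0 => t _; rewrite lee_fin.
- move=> w _ m n mn; apply: ge0_le_integral => //.
  + by move=> t _; rewrite lee_fin.
  + exact/measurable_EFinP.
  + exact/measurable_EFinP.
  + by move=> t _; exact: gnd.
Qed.

End MonotoneClass.

Section NegativePart.
Context {R : realType}.

Definition neg (t : R) : R := Num.max (- t)%R 0%R.

Lemma neg_ge0 t : (0 <= neg t)%R. Proof. by rewrite /neg le_max lexx orbT. Qed.

Lemma neg_of_ge0 t : (0 <= t)%R -> neg t = 0%R.
Proof. by move=> t0; rewrite /neg max_r// oppr_le0. Qed.

Lemma neg_of_le0 t : (t <= 0)%R -> neg t = (- t)%R.
Proof. by move=> t0; rewrite /neg max_l// oppr_ge0. Qed.

Lemma measurable_negp : measurable_fun setT neg.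
Proof. by apply: measurable_maxr => //; exact: measurable_funN. Qed.

End NegativePart.

Section KilledChain.
Local Open Scope ereal_scope.
Context {d : measure_display} {Omega : measurableType d} {R : realType}.
Context {K : R.-pker R ~> R} {Px : R -> probability Omega R}
  {X : nat -> {mfun Omega >-> R}}.
Hypothesis X_markov : markov_chain K Px X.

(** Unlike {tau > n}, this event also constrains X 0: it says that the chain
    killed outside the open half-line is still running, whatever the starting
    point. That makes it compatible with the Markov property at every time. *)
Definition alive (n : nat) : set Omega :=
  [set w | forall k, (k <= n)%N -> (0 < X k w)%R].

Lemma aliveS n : alive n.+1 = alive n `&` X n.+1 @^-1` `]0%R, +oo[.
Proof.
apply/seteqP; split => w /=.
  move=> h; split; first by move=> k kn; apply: h; rewrite (leq_trans kn).
  by rewrite /= in_itv/= andbT; exact: h.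
move=> [h]; rewrite /= in_itv/= andbT => h' k.
by rewrite leq_eqVlt => /orP[/eqP->//|]; exact: h.
Qed.

Lemma natural_filtration_alive n : natural_filtration X n (alive n).
Proof.
have E : alive n = ~` \bigcup_k (if (k <= n)%N then X k @^-1` `]-oo, 0%R] else set0).
  apply/seteqP; split => w /=.
    move=> h [k _]; case: ifPn => // kn /=; rewrite in_itv/= => Xk.
    by have := h _ kn; rewrite ltNge Xk.
  move=> h k kn; rewrite ltNge; apply/negP => Xk; apply: h.
  by exists k => //; rewrite kn /= in_itv.
have sa := smallest_sigma_algebra setT
  (\bigcup_(k in [set k | (k <= n)%N]) preimage_set_system setT (X k) measurable).
rewrite E -[X in natural_filtration _ _ X]setTD.
case: sa => s0 sC sU; apply: sC; apply: sU => k.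
case: ifPn => // kn; apply: sub_gen_smallest.
by exists k => //; exists `]-oo, 0%R]%classic; rewrite ?setTI.
Qed.

Lemma measurable_alive n : measurable (alive n).
Proof.
elim: n => [|n IH].
  rewrite (_ : alive 0 = X 0%N @^-1` `]0%R, +oo[).
    by rewrite -[X in measurable X]setTI; exact: measurable_funP.
  apply/seteqP; split => w /=; rewrite in_itv/= andbT; first exact.
  by move=> h k; rewrite leqn0 => /eqP->.
rewrite aliveS; apply: measurableI => //.
by rewrite -[X in measurable X]setTI; exact: measurable_funP.
Qed.

Lemma ge0_integral_markov_step (x : R) n (A : set Omega) (f : R -> \bar R) :
  natural_filtration X n A -> measurable A ->
  measurable_fun setT f -> (forall t, 0 <= f t) ->
  \int[Px x]_(w in A) f (X n.+1 w) = \int[Px x]_(w in A) \int[K (X n w)]_t f t.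
Proof.
move=> FA mA mf f0.
apply: (@integral_disintegration _ _ _ _ _ (Px x) A (X n.+1) (fun w => K (X n w))) => //.
- move=> B mB; apply: (@measurableT_comp _ _ _ _ _ _ (K ^~ B)) => //.
  exact: measurable_kernel.
- by move=> B mB; exact: (markov_step X_markov).
Qed.

(** Cutting a function to the half-line before applying K gives the transition
    operator of the killed chain. *)
Definition positive_part_of (f : R -> \bar R) (t : R) : \bar R :=
  if (0 < t)%R then f t else 0.

Lemma positive_part_of_ge0 f : (forall t, 0 <= f t) ->
  forall t, 0 <= positive_part_of f t.
Proof. by move=> f0 t; rewrite /positive_part_of; case: ifP. Qed.

Lemma measurable_positive_part_of f : measurable_fun setT f ->
  measurable_fun setT (positive_part_of f).
Proof.
move=> mf; apply: measurable_fun_ifT => //.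
exact: measurable_fun_ltr.
Qed.

Lemma measurable_alive_fun n k (f : R -> \bar R) :
  measurable_fun setT f -> measurable_fun (alive n) (fun w => f (X k w)).
Proof.
by move=> mf; apply: (measurable_funS measurableT) => //; exact: measurableT_comp.
Qed.

Lemma ge0_integral_aliveS x n (f : R -> \bar R) :
  measurable_fun setT f -> (forall t, 0 <= f t) ->
  \int[Px x]_(w in alive n) positive_part_of f (X n.+1 w) =
  \int[Px x]_(w in alive n.+1) f (X n.+1 w).
Proof.
move=> mf f0; rewrite aliveS integral_mkcondr; apply: eq_integral => w _.
rewrite patchE /positive_part_of; case: ifPn => h; case: ifPn => //.
  by move/negP; rewrite inE /= in_itv/= h.
by rewrite inE /= in_itv/= andbT (negbTE h).
Qed.

Lemma alive_gt0 n w : alive n w -> (0 < X n w)%R. Proof. exact. Qed.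

(** The mean of the negative part at step k + 1 on survival of k steps, as a
    function of the starting point. It is built from K alone so that it can be
    evaluated at a random state X n. *)
Fixpoint kernel_overshoot (k : nat) : R -> \bar R :=
  if k is j.+1 then fun y => \int[K y]_t positive_part_of (kernel_overshoot j) t
  else fun y => \int[K y]_t (neg t)%:E.

Lemma kernel_overshoot_ge0 k y : 0 <= kernel_overshoot k y.
Proof.
elim: k y => [|k IH] y /=.
  by apply: integral_ge0 => t _; rewrite lee_fin neg_ge0.
by apply: integral_ge0 => t _; exact: positive_part_of_ge0.
Qed.

Lemma measurable_kernel_overshoot k : measurable_fun setT (kernel_overshoot k).
Proof.
elim: k => [|k IH] /=.
  apply: measurable_fun_integral_kernel.
  - exact: measurable_kernel.
  - by move=> t; rewrite lee_fin neg_ge0.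
  - by apply/measurable_EFinP; exact: measurable_negp.
apply: measurable_fun_integral_kernel.
- exact: measurable_kernel.
- by move=> t; apply: positive_part_of_ge0; exact: kernel_overshoot_ge0.
- exact: measurable_positive_part_of.
Qed.

(** The Markov property at time n, unrolled over the next k steps. *)
Lemma integral_kernel_overshoot x n k :
  \int[Px x]_(w in alive n) kernel_overshoot k (X n w) =
  \int[Px x]_(w in alive (n + k)) (neg (X (n + k).+1 w))%:E.
Proof.
elim: k n => [|k IH] n /=.
  rewrite addn0 -(ge0_integral_markov_step x (f := fun t => (neg t)%:E))//.
  - exact: natural_filtration_alive.
  - exact: measurable_alive.
  - by apply/measurable_EFinP; exact: measurable_negp.
  - by move=> t; rewrite lee_fin neg_ge0.
rewrite addnS -addSn -IH -(ge0_integral_markov_step x); first last.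
- by move=> t; apply: positive_part_of_ge0; exact: kernel_overshoot_ge0.
- by apply: measurable_positive_part_of; exact: measurable_kernel_overshoot.
- exact: measurable_alive.
- exact: natural_filtration_alive.
by rewrite ge0_integral_aliveS//; [exact: measurable_kernel_overshoot|exact: kernel_overshoot_ge0].
Qed.

Lemma measurable_start x : measurable [set w | X 0%N w = x].
Proof.
rewrite -[X in measurable X]setTI.
have := measurable_funP (X 0%N) => /(_ setT measurableT [set x]).
by apply; exact: measurable_set1.
Qed.

Lemma start_null x : Px x (~` [set w | X 0%N w = x]) = 0.
Proof.
by rewrite probability_setC ?(markov_init X_markov x) ?subee//; exact: measurable_start.
Qed.

Lemma ge0_integral_start x (A : set Omega) (f : Omega -> \bar R) :
  measurable A -> measurable_fun A f -> (forall w, A w -> 0 <= f w) ->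
  \int[Px x]_(w in A) f w = \int[Px x]_(w in A `&` [set w | X 0%N w = x]) f w.
Proof.
move=> mA mf f0.
rewrite (ge0_negligible_integral _ mA mf f0 (start_null x)) ?setDE ?setCK//.
by apply: measurableC; exact: measurable_start.
Qed.

Lemma alive0_start x : (0 < x)%R ->
  alive 0 `&` [set w | X 0%N w = x] = [set w | X 0%N w = x].
Proof.
move=> x0; apply/setIidPr => w /= Xw k.
by rewrite leqn0 => /eqP ->; rewrite Xw.
Qed.

(** The law Px x gives X 0 the value x. *)
Lemma integral_alive0 x (f : R -> \bar R) : (0 < x)%R ->
  measurable_fun setT f -> (forall t, 0 <= f t) ->
  \int[Px x]_(w in alive 0) f (X 0%N w) = f x.
Proof.
move=> x0 mf f0.
rewrite ge0_integral_start; [|exact: measurable_alive|exact: measurable_alive_fun|by []].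
rewrite alive0_start// (eq_integral (cst (f x))).
  rewrite integral_cst; last exact: measurable_start.
  by rewrite [X in _ * X](markov_init X_markov x) mule1.
by move=> w; rewrite inE /= => ->.
Qed.

Lemma kernel_overshootE k x : (0 < x)%R ->
  kernel_overshoot k x = \int[Px x]_(w in alive k) (neg (X k.+1 w))%:E.
Proof.
move=> x0; rewrite -[LHS](@integral_alive0 x)//; last first.
- exact: kernel_overshoot_ge0.
- exact: measurable_kernel_overshoot.
by rewrite integral_kernel_overshoot add0n.
Qed.

Lemma lt_tauE n w : (n%:R%:E < tau X w) <-> forall k, (1 <= k <= n)%N -> (0 < X k w)%R.
Proof.
split=> h.
  move=> k /andP[k1 kn]; rewrite ltNge; apply/negP => Xk.
  have : tau X w <= k%:R%:E by apply: ereal_inf_lbound; exists k.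
  by move/(lt_le_trans h); rewrite lte_fin ltr_nat ltnNge kn.
apply: (@lt_le_trans _ _ n.+1%:R%:E); first by rewrite lte_fin ltr_nat.
apply: le_ereal_inf_tmp => _ [k [k1 Xk] <-].
rewrite lee_fin ler_nat ltnNge; apply/negP => kn.
by have := h k; rewrite k1 kn => /(_ isT); rewrite ltNge Xk.
Qed.

Lemma aliveE n : alive n = [set w | (n%:R)%:E < tau X w] `&` [set w | (0 < X 0%N w)%R].
Proof.
apply/seteqP; split => w /=.
  by move=> h; split; [apply/lt_tauE => k /andP[_ kn]; exact: h | exact: h].
move=> [/lt_tauE h X0] [//|k] kn; apply: h.
by rewrite kn.
Qed.

Lemma measurable_lt_tau n : measurable [set w | (n%:R)%:E < tau X w].
Proof.
rewrite (_ : mkset _ = \bigcap_(k in [set k | (1 <= k <= n)%N]) X k @^-1` `]0%R, +oo[).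
  apply: bigcap_measurableType => // k _.
  by rewrite -[X in measurable X]setTI; exact: measurable_funP.
apply/seteqP; split => w /=.
  by move/lt_tauE => h k /= /h; rewrite in_itv/= andbT.
by move=> h; apply/lt_tauE => k /h; rewrite /= in_itv/= andbT.
Qed.

Lemma killed_lawE x n :
  killed_law Px X x n = pushforward (mrestr (Px x) (measurable_lt_tau n)) (X n).
Proof. by apply/funext => A; rewrite /killed_law /pushforward /= /mrestr setIC. Qed.

(** The law of the killed chain is cut by {tau > n}, which agrees with
    survival up to the null event that X 0 is not x. *)
Lemma ge0_integral_killed_law x n (B : set R) (f : R -> \bar R) : (0 < x)%R ->
  measurable B -> measurable_fun setT f -> (forall t, B t -> 0 <= f t) ->
  \int[killed_law Px X x n]_(y in B) f y =
  \int[Px x]_(w in alive n `&` X n @^-1` B) f (X n w).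
Proof.
move=> x0 mB mf f0.
have mD := measurable_lt_tau n.
have mXB : measurable (X n @^-1` B).
  by rewrite -[X in measurable X]setTI; exact: measurable_funP.
rewrite killed_lawE  ge0_integral_pushforward//; last 2 first.
- exact: (measurable_funS measurableT).
- by move=> y; rewrite inE; exact: f0.
have mfX : measurable_fun (X n @^-1` B) (f \o X n).
  by apply: (measurable_funS measurableT) => //; exact: measurableT_comp.
rewrite (@ge0_negligible_integral _ _ _ _ _ (~` [set w | (n%:R)%:E < tau X w]))//; last 3 first.
- exact: measurableC.
- by move=> w /=; exact: f0.
- by rewrite /= /mrestr setICl measure0.
rewrite setDE setCK.
transitivity (\int[Px x]_(w in X n @^-1` B `&` [set w | (n%:R)%:E < tau X w]) f (X n w)).
  apply: eq_measure_integral => A mA AD.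
  by rewrite /= /mrestr; congr (Px x _); apply/setIidPl => w /AD[].
have mA1 : measurable (X n @^-1` B `&` [set w | (n%:R)%:E < tau X w]) by exact: measurableI.
have mA2 : measurable (alive n `&` X n @^-1` B).
  by apply: measurableI => //; exact: measurable_alive.
have mf' A : measurable_fun A (f \o X n).
  by apply: (measurable_funS measurableT) => //; exact: measurableT_comp.
rewrite ge0_integral_start; [|exact: mA1|exact: mf'|by move=> w [Bw _]; exact: f0].
rewrite [RHS]ge0_integral_start; [|exact: mA2|exact: mf'|by move=> w [_ Bw]; exact: f0].
congr (integral _ _ _); apply/seteqP; split => w /=; rewrite aliveE /=.
  by move=> [[? ?] e]; split=> //; split => //; split=> //=; rewrite e.
by move=> [[[? ?] ?] ?].
Qed.

(** At most one term of the series is not zero, the one of index tau - 1: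
    before it X k.+1 is positive, and after it k < tau fails. If tau is
    infinite all terms vanish, in accordance with the value 0 of X_tau there.
    *)
Lemma X_tauE w : (X_tau X w)%:E =
  - \sum_(k <oo) ((fun w => (neg (X k.+1 w))%:E) \_ [set w | k%:R%:E < tau X w]) w.
Proof.
have [[m [m1 Xm]]|no] := pselect (exists n, (1 <= n)%N /\ (X n w <= 0)%R); last first.
  have tau_oo : tau X w = +oo.
    rewrite /tau (_ : [set _ | _ in _] = set0) ?ereal_inf0//.
    by apply/seteqP; split => // t [n hn _]; apply: no; exists n.
  rewrite /X_tau tau_oo eseries0 ?oppe0// => k _ _; rewrite patchE; case: ifP => // _.
  rewrite neg_of_ge0// leNgt; apply/negP => Xk; apply: no.
  by exists k.+1; split => //; exact: ltW.
have [k0 [Xk0 min]] : exists k, (X k.+1 w <= 0)%R /\ forall j, (j < k)%N -> (0 < X j.+1 w)%R.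
  have ex : exists k, (X k.+1 w <= 0)%R by exists m.-1; rewrite prednK.
  exists (ex_minn ex); case: ex_minnP => k Xk kmin; split => // j jk.
  by rewrite ltNge; apply/negP => /kmin; rewrite leqNgt jk.
have lt_tau k : (k <= k0)%N -> k%:R%:E < tau X w.
  move=> kk0; apply/lt_tauE => -[//|j] /andP[_ jk]; apply: min.
  exact: leq_trans kk0.
have tauE : tau X w = k0.+1%:R%:E.
  apply/eqP; rewrite eq_le; apply/andP; split.
    by apply: ereal_inf_lbound; exists k0.+1.
  apply: le_ereal_inf_tmp => _ [n [n1 Xn] <-]; rewrite lee_fin ler_nat.
  rewrite ltnNge; apply/negP => nk.
  have := min n.-1; rewrite prednK// => /(_ nk); by rewrite ltNge Xn.
rewrite /X_tau tauE natrK (nneseriesD1 (n := k0))//; last first.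
  by move=> k _; rewrite patchE; case: ifP => // _; rewrite lee_fin neg_ge0.
rewrite eseries0 ?adde0.
  rewrite patchE ifT; last by rewrite inE /=; exact: lt_tau.
  by rewrite neg_of_le0// EFinN oppeK.
move=> k _ /= kk0; rewrite patchE; case: ifPn => //; rewrite inE/=.
rewrite tauE lte_fin ltr_nat ltnS leq_eqVlt (negbTE kk0)/= => kk.
by rewrite neg_of_ge0// ltW// min.
Qed.

(** Written as a series of overshoots, V can be transported along the chain by
    the Markov property. *)
Lemma V_series (x : R) : (0 < x)%R ->
  V Px X x = x%:E + \sum_(k <oo) kernel_overshoot k x.
Proof.
move=> x0; rewrite /V; congr (_ + _).
have mneg k : measurable_fun setT (fun w => (neg (X k.+1 w))%:E).
  apply/measurable_EFinP; apply: measurableT_comp => //; exact: measurable_negp.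
have n0 k w : 0 <= ((fun w => (neg (X k.+1 w))%:E) \_ [set w | k%:R%:E < tau X w]) w.
  by rewrite patchE; case: ifP => // _; rewrite lee_fin neg_ge0.
have mf k : measurable_fun setT ((fun w => (neg (X k.+1 w))%:E) \_ [set w | k%:R%:E < tau X w]).
  apply/(measurable_restrictT _ _).1; first exact: measurable_lt_tau.
  exact: (measurable_funS measurableT).
rewrite unlock; under eq_integral do rewrite X_tauE.
rewrite integral_ge0N; last by move=> w _; apply: nneseries_ge0 => k _ _; exact: n0.
rewrite oppeK integral_nneseries//.
apply: eq_eseriesr => k _; rewrite -integral_mkcond kernel_overshootE//.
have mS := measurable_start x.
have mfA A : measurable A -> measurable_fun A (fun w => (neg (X k.+1 w))%:E).
  by move=> mA; exact: (measurable_funS measurableT).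
have mA := measurable_alive k.
have mD := measurable_lt_tau k.
rewrite ge0_integral_start//; [|by apply: mfA|by move=> w _; rewrite lee_fin neg_ge0].
rewrite [LHS]ge0_integral_start//; [|by apply: mfA|by move=> w _; rewrite lee_fin neg_ge0].
rewrite aliveE; congr (integral _ _ _).
by apply/seteqP; split => w /=; [move=> [h e]; rewrite e|move=> [[h _] e]].
Qed.

(** From y the first jump has law K y, since X 0 = y almost surely. *)
Lemma kernel_one_step (y : R) (B : set R) : measurable B -> K y B = Px y (X 1%N @^-1` B).
Proof.
move=> mB; rewrite -[X in _ = Px y X]setTI (markov_step X_markov)//; last first.
  have [s0 sC _] := smallest_sigma_algebra setT
    (\bigcup_(k in [set k | (k <= 0)%N]) preimage_set_system setT (X k) measurable).
  by rewrite -[X in natural_filtration _ _ X]setD0; exact: sC.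
have mK : measurable_fun setT (fun w => K (X 0%N w) B).
  by apply: (@measurableT_comp _ _ _ _ _ _ (K ^~ B)) => //; exact: measurable_kernel.
rewrite ge0_integral_start//.
rewrite (eq_integral (cst (K y B))).
  rewrite setTI integral_cst; last exact: measurable_start.
  by rewrite [X in _ * X](markov_init X_markov y) mule1.
by move=> w; rewrite inE /= => -[_ ->].
Qed.

Lemma kernel_jump (y : R) (mu : probability R R) :
  (forall B : set R, measurable B -> mu B = Px y [set w | B (X 1%N w - y)%R]) ->
  forall f : R -> \bar R, measurable_fun setT f -> (forall t, 0 <= f t) ->
  \int[K y]_t f t = \int[mu]_s f (y + s)%R.
Proof.
move=> muE f mf f0.
have mshift : measurable_fun setT (fun s : R => (y + s)%R) by exact: measurable_funD.
transitivity (\int[pushforward mu (fun s : R => (y + s)%R)]_t f t).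
  apply: eq_measure_integral => B mB _; rewrite [LHS]kernel_one_step//.
  transitivity (mu ((fun s : R => (y + s)%R) @^-1` B)); last by [].
  rewrite muE.
    by congr (Px y _); apply/seteqP; split => w /=; rewrite subrKC.
  by rewrite -[X in measurable X]setTI; exact: mshift.
by rewrite ge0_integral_pushforward// preimage_setT.
Qed.

End KilledChain.
Arguments alive {d Omega R} X n.
Arguments kernel_overshoot {R} K k _.

(** * Means under a centred law of unit variance *)

Section CenteredLaw.
Local Open Scope ereal_scope.
Context {R : realType} (mu : probability R R).
Hypothesis mu_mean : \int[mu]_s s%:E = 0.
Hypothesis mu_var : \int[mu]_s (s ^+ 2)%:E = 1.

Lemma integrable_sqr : mu.-integrable setT (fun s => (s ^+ 2)%:E).
Proof.
apply/integrableP; split; first by apply/measurable_EFinP; exact: measurable_funX.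
under eq_integral do rewrite gee0_abs ?lee_fin ?sqr_ge0//.
by rewrite mu_var ltry.
Qed.

Lemma integrable_id : mu.-integrable setT (fun s : R => s%:E).
Proof.
apply: (@le_integrable _ _ _ mu setT measurableT _ (fun s => (1 + s ^+ 2)%:E)) => //.
- by apply/measurable_EFinP; exact: measurable_id.
- by move=> s _; rewrite /= lee_fin [leRHS]ger0_norm; [have := sqr_ge0 (`|s| - 1)%R; have := real_normK (num_real s); nra|have := sqr_ge0 s; lra].
- under eq_fun do rewrite EFinD.
  apply: integrableD => //; [exact: finite_measure_integrable_cst|exact: integrable_sqr].
Qed.

(** Under a centred law of variance 1 the quadratic a + b s + c s^2 has mean a
    + c, so a pointwise comparison of functions yields a comparison of means.
    Every drift estimate below is an instance; f is bounded by an integrable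
    function, or else the right-hand side is infinite. *)
Lemma integral_quadratic_le (f g : R -> R) (a b c : R) :
  measurable_fun setT f -> measurable_fun setT g ->
  (forall s, (0 <= f s)%R) -> (forall s, (0 <= g s)%R) ->
  (forall s, (f s <= a + b * s + c * s ^+ 2 + g s)%R) ->
  \int[mu]_s (f s)%:E <= (a + c)%:E + \int[mu]_s (g s)%:E.
Proof.
move=> mf mg f0 g0 fg.
have [goo|gfin] := eqVneq (\int[mu]_s (g s)%:E) +oo.
  by rewrite goo addey// leey.
have ig : mu.-integrable setT (EFin \o g).
  apply/integrableP; split; first exact/measurable_EFinP.
  under eq_integral do rewrite gee0_abs ?lee_fin//.
  by rewrite ltey.
have ibs : mu.-integrable setT (fun s => b%:E * s%:E).
  by apply: integrableZl => //; exact: integrable_id.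
have ics : mu.-integrable setT (fun s => c%:E * (s ^+ 2)%:E).
  by apply: integrableZl => //; exact: integrable_sqr.
have iq : mu.-integrable setT (fun s => a%:E + b%:E * s%:E + c%:E * (s ^+ 2)%:E).
  by apply: integrableD => //; apply: integrableD => //; exact: finite_measure_integrable_cst.
have iqg := integrableD measurableT iq ig.
have if_ : mu.-integrable setT (EFin \o f).
  apply: le_integrable iqg => //; first exact/measurable_EFinP.
  move=> s _; rewrite /= lee_fin !ger0_norm ?fg//.
  exact: le_trans (f0 s) (fg s).
apply: le_trans (le_integral _ if_ iqg _) _ => //.
  by move=> s _; rewrite /= lee_fin.
have ic : mu.-integrable setT (fun=> a%:E) by exact: finite_measure_integrable_cst.
rewrite (integralD measurableT iq ig).
rewrite (integralD measurableT (integrableD measurableT ic ibs) ics).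
rewrite (integralD measurableT ic ibs).
rewrite integralZl//; last exact: integrable_id.
rewrite integralZl//; last exact: integrable_sqr.
rewrite mu_mean mu_var mule0 mule1 integral_cst// [X in _ * X]probability_setT mule1 adde0.
by rewrite EFinD.
Qed.

End CenteredLaw.

Section TailDominance.
Local Open Scope ereal_scope.
Context {R : realType}.

(** Stochastic domination, through the layer-cake formula. *)
Lemma expectation_le_tail d1 d2 (T1 : measurableType d1) (T2 : measurableType d2)
    (P1 : probability T1 R) (P2 : probability T2 R) (Z1 : T1 -> R) (Z2 : T2 -> R) :
  measurable_fun setT Z1 -> measurable_fun setT Z2 ->
  (forall w, (0 <= Z1 w)%R) -> (forall w, (0 <= Z2 w)%R) ->
  (forall s : R, (0 <= s)%R -> P1 [set w | (s < Z1 w)%R] <= P2 [set w | (s < Z2 w)%R]) ->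
  \int[P1]_w (Z1 w)%:E <= \int[P2]_w (Z2 w)%:E.
Proof.
move=> m1 m2 Z10 Z20 Z12.
pose W1 : {mfun T1 >-> R} := HB.pack Z1 (isMeasurableFun.Build _ _ _ _ _ m1).
pose W2 : {mfun T2 >-> R} := HB.pack Z2 (isMeasurableFun.Build _ _ _ _ _ m2).
have := @ge0_expectation_ccdf _ _ _ P1 W1 Z10.
have := @ge0_expectation_ccdf _ _ _ P2 W2 Z20.
rewrite !expectation_def => -> ->.
apply: ge0_le_integral => //.
- exact: (measurable_funS measurableT _ (ccdf_measurable _)).
- exact: (measurable_funS measurableT _ (ccdf_measurable _)).
move=> r; rewrite /= in_itv/= andbT => r0.
have E d3 (T3 : measurableType d3) (P3 : probability T3 R) (W : {RV P3 >-> R}) :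
    ccdf W r = P3 [set w | (r < W w)%R].
  rewrite /ccdf /distribution /pushforward; congr (P3 _).
  by apply/seteqP; split => w /=; rewrite in_itv/= andbT.
by rewrite !E; exact: Z12.
Qed.

Definition sqr_above (B s : R) : R := if (B < `|s|)%R then (s ^+ 2)%R else 0%R.

Lemma sqr_above_ge0 B s : (0 <= sqr_above B s)%R.
Proof. by rewrite /sqr_above; case: ifP => // _; exact: sqr_ge0. Qed.

Lemma measurable_sqr_above B : measurable_fun setT (sqr_above B).
Proof.
apply: measurable_fun_ifT; [|exact: measurable_funX|exact: measurable_cst].
by apply: measurable_fun_ltr => //; exact: normr_measurable.
Qed.

Lemma sqr_above_gt (B s t : R) : (0 <= B)%R -> (0 <= s)%R ->
  (s < sqr_above B t)%R = (Num.max B (Num.sqrt s) < `|t|)%R.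
Proof.
move=> B0 s0; rewrite gt_max /sqr_above; case: ifPn => //= Bt.
  rewrite -[in LHS]real_normK ?num_real// -[in LHS](sqr_sqrtr s0).
  by rewrite ltr_pXn2r// nnegrE ?sqrtr_ge0.
by rewrite ltNge s0.
Qed.

End TailDominance.

(** * The Lyapunov function and the tail of the dominating variable *)

Section Pointwise.
Context {R : realType}.
Implicit Types M B L s z y t u v : R.

Definition clamp M z : R := Num.min (Num.max z 0) M.

(** On [0, M] this is the parabola M z - z^2 / 2, continued by constants on
    both sides. It is concave on the half-line with slope M - clamp M z, and
    its curvature turns the unit variance of a jump into a downward drift. *)
Definition cap M z : R := M * clamp M z - clamp M z ^+ 2 / 2.

Lemma clamp_bounds M z : 0 <= M -> 0 <= clamp M z <= M.
Proof. by move=> M0; rewrite /clamp le_min ge_min lexx M0 le_max lexx !orbT. Qed.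

Lemma cap_ge0 M z : 0 <= M -> 0 <= cap M z.
Proof. by move=> M0; rewrite /cap; have /andP[] := clamp_bounds z M0; nra. Qed.

Lemma cap_le M z : 0 <= M -> 0 <= z -> cap M z <= M * z.
Proof.
move=> M0 z0; rewrite /cap; have /andP[] := clamp_bounds z M0.
have : clamp M z <= z by rewrite /clamp ge_min max_l ?lexx.
by nra.
Qed.

Lemma measurable_cap M B : measurable_fun setT (fun z => cap M (z + B)).
Proof.
have mc : measurable_fun setT (fun z => clamp M (z + B)).
  by apply: measurable_minr => //; apply: measurable_maxr => //; exact: measurable_funD.
apply: measurable_funB; first exact: measurable_funM.
by apply: measurable_funM => //; exact: measurable_funX.
Qed.

Variant clamp_spec M z : R -> Type :=
| ClampLo of z <= 0 & 0 <= M : clamp_spec M z 0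
| ClampMid of 0 <= z & z <= M : clamp_spec M z z
| ClampHi of 0 <= M & M <= z : clamp_spec M z M.

Lemma clampP M z : 0 <= M -> clamp_spec M z (clamp M z).
Proof.
move=> M0; rewrite /clamp; have [z0|z0] := leP z 0.
  by rewrite (min_idPl M0); constructor.
have [zM|zM] := leP z M; first by constructor => //; exact: ltW.
by constructor => //; exact: ltW.
Qed.

Variant neg_spec t : R -> Type :=
| NegPos of 0 <= t : neg_spec t 0
| NegNeg of t <= 0 : neg_spec t (- t).

Lemma negpP t : neg_spec t (neg t).
Proof.
have [t0|t0] := leP 0 t; first by rewrite neg_of_ge0//; constructor.
by rewrite neg_of_le0 ?ltW//; constructor; exact: ltW.
Qed.

(** On the half-line concavity bounds cap by its tangent. Below 0 the tangent
    goes on while cap stays at 0; the term M * neg pays for the difference. *)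
Lemma cap_tangent M z s : 0 <= M -> 0 <= z ->
  cap M (z + s) <= cap M z + (M - clamp M z) * s + M * neg (z + s).
Proof.
move=> M0 z0; rewrite /cap.
case: (clampP z M0) => [z1 _|_ zM|_ zM]; case: (clampP (z + s) M0) => *;
  case: (negpP (z + s)) => *; nra.
Qed.

(** Within distance B of z the function is exactly the parabola, whence the
    gain s^2 / 2. The truncated square gives this gain up for larger jumps. *)
Lemma cap_concave M B z s : 0 <= B -> B <= z -> z <= M - B ->
  cap M (z + s) <= cap M z + (M - z) * s - s ^+ 2 / 2 + sqr_above B s / 2 + M * neg (z + s).
Proof.
move=> B0 Bz zM; have M0 : 0 <= M by lra.
have z0 : 0 <= z by lra.
have zM' : z <= M by lra.
rewrite /cap /sqr_above [X in _ <= M * X - X ^+ 2 / 2 + _ - _ + _ + _](_ : _ = z); last first.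
  by rewrite /clamp max_l// min_l.
have [Bs|] := ltP B `|s|.
  case: (clampP (z + s) M0) => *; case: (negpP (z + s)) => *; nra.
rewrite ler_norml => /andP[Bs sB].
have -> : clamp M (z + s) = z + s by rewrite /clamp max_l ?min_l//; lra.
by rewrite neg_of_ge0; lra.
Qed.

(** Charges the gap between u and v to integer levels. A jump that overshoots
    is thereby split into events of the form: size above j, from a height of
    at most j + 1. *)
Lemma gap_le_count u v N : 0 <= u ->
  Num.min v N%:R - u <=
  \sum_(j < N) ((u <= j%:R + 1)%R && (j%:R < v)%R)%:R.
Proof.
move=> u0; elim: N => [|N IH].
  by rewrite big_ord0 subr_le0 ge_min u0 orbT.
rewrite big_ord_recr /=; move: IH.
rewrite -[N.+1%:R]natr1.
set S := \sum_(j < N) _; have S0 : 0 <= S by rewrite sumr_ge0.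
have [uN|uN] := leP u (N%:R + 1); have [Nv|Nv] := ltP N%:R v => /=;
 have [h1|h1] := leP v N%:R; have [h2|h2] := leP v (N%:R + 1) => /=; rewrite ?addr0; lra.
Qed.

(** Lets a second moment bound the sum of (i + 1) P(Y > i). *)
Lemma weighted_count_le t N :
  \sum_(i < N) (i%:R + 1) * (i%:R < t)%R%:R <= (t + 1) ^+ 2.
Proof.
have [t0|t0] := ltP t 0.
  rewrite big1 ?sqr_ge0// => i _.
  by rewrite ltNge (le_trans (ltW t0))//= mulr0.
have : \sum_(i < N) (i%:R + 1) * (i%:R < t)%R%:R <= (Num.min N%:R (t + 1)) ^+ 2.
  elim: N => [|N IH]; first by rewrite big_ord0 sqr_ge0.
  rewrite big_ord_recr /=; apply: le_trans (lerD IH (lexx _)) _.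
  rewrite -[N.+1%:R]natr1; have N0 : 0 <= N%:R :> R by [].
  have [Nt|Nt] := ltP N%:R t => /=; rewrite ?mulr1 ?mulr0;
   have [h1|h1] := leP N%:R (t + 1); have [h2|h2] := leP (N%:R + 1) (t + 1) => /=; nra.
move/le_trans; apply; rewrite ler_sqr ?nnegrE ?ge_min ?lexx ?orbT// ?le_min ?ler0n/=; lra.
Qed.

End Pointwise.

Lemma cvge_near_lt {R : realType} (u : (\bar R)^nat) (l c : \bar R) :
  u n @[n --> \oo] --> l -> (l < c)%E -> \forall n \near \oo, (u n < c)%E.
Proof. by move=> ul lc; exact: ul (open_ereal_lt' lc). Qed.

Section Tails.
Local Open Scope ereal_scope.
Context {R : realType} {dY : measure_display} {TY : measurableType dY}
  (PY : probability TY R) (Y : {RV PY >-> R}).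
Hypothesis Y_sq : \int[PY]_w (Y w ^+ 2)%:E < +oo.

Definition excess (B : R) : \bar R := \int[PY]_w (sqr_above B (Y w))%:E.

Definition tail (i : nat) : \bar R := PY [set w | (i%:R < Y w)%R].

Lemma measurable_tail (s : R) : measurable [set w | (s < Y w)%R].
Proof.
rewrite (_ : mkset _ = Y @^-1` `]s, +oo[).
  by rewrite -[X in measurable X]setTI; exact: measurable_funP.
by apply/seteqP; split => w; rewrite /= in_itv/= andbT.
Qed.

Lemma integrable_Y_sq : PY.-integrable setT (fun w => (Y w ^+ 2)%:E).
Proof.
apply/integrableP; split; first by apply/measurable_EFinP; exact: measurable_funX.
by under eq_integral do rewrite gee0_abs ?lee_fin ?sqr_ge0//.
Qed.

Lemma excess_cvg0 : excess n%:R @[n --> \oo] --> 0.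
Proof.
rewrite /excess.
rewrite -(@integral0 _ _ _ PY setT).
apply: (@dominated_cvg _ _ _ _ _ measurableT _ _ (fun w => (Y w ^+ 2)%:E)) => //.
- move=> n; apply/measurable_EFinP; apply: measurableT_comp => //.
  exact: measurable_sqr_above.
- move=> w _; apply: cvg_near_cst; near=> n.
  rewrite /= /sqr_above ltNge ifF//; apply/negbTE; rewrite negbK.
  by near: n; exact: nbhs_infty_ger.
- exact: integrable_Y_sq.
- move=> n w _ /=; rewrite lee_fin ger0_norm ?sqr_above_ge0//.
  by rewrite /sqr_above; case: ifP => // _; exact: sqr_ge0.
Unshelve. all: by end_near. Qed.

Definition weighted_tail (i : nat) : \bar R := (i%:R + 1)%:E * tail i.

Lemma weighted_tail_ge0 i : 0 <= weighted_tail i.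
Proof. by rewrite mule_ge0// lee_fin; have := ler0n R i; lra. Qed.

Lemma weighted_tail_summable : \sum_(i <oo) weighted_tail i < +oo.
Proof.
apply: (@le_lt_trans _ _ (\int[PY]_w (2%:E * (Y w ^+ 2)%:E + 2%:E))); last first.
  apply: (@integrable_lty _ _ _ PY setT measurableT).
  apply: integrableD => //; last exact: finite_measure_integrable_cst.
  by apply: integrableZl => //; exact: integrable_Y_sq.
apply: lime_le.
  by apply: is_cvg_nneseries => n _ _; exact: weighted_tail_ge0.
apply: nearW => N; rewrite big_mkord.
have E i : weighted_tail i = \int[PY]_w ((i%:R + 1) * (i%:R < Y w)%R%:R)%:E.
  rewrite /weighted_tail /tail -(setIT (mkset _)) -integral_indic//; last exact: measurable_tail.
  rewrite -ge0_integralZl_EFin; first last.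
  - by have := ler0n R i; lra.
  - by apply/measurable_EFinP; apply: measurable_indic; exact: measurable_tail.
  - by move=> w _; rewrite lee_fin.
  - exact: measurableT.
  by apply: eq_integral => w _; rewrite indicE mem_setE EFinM.
under eq_bigr do rewrite E.
have mterm (i : nat) : measurable_fun setT (fun w => ((i%:R + 1) * (i%:R < Y w)%R%:R)%R : R).
  apply: measurable_funM => //.
  rewrite (_ : (fun _ => _) = \1_[set w | (i%:R < Y w)%R]).
    by apply: measurable_indic; exact: measurable_tail.
  by apply/funext => w; rewrite indicE mem_setE.
have t0 (i : nat) w : (0 <= (i%:R + 1) * (i%:R < Y w)%R%:R :> R)%R.
  by rewrite mulr_ge0//; have := ler0n R i; lra.
rewrite -ge0_integral_sum; first last.
- by move=> i w _; rewrite lee_fin.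
- by move=> i; apply/measurable_EFinP; exact: mterm.
- exact: measurableT.
apply: ge0_le_integral => //.
- by move=> w _; apply: sume_ge0 => i _; rewrite lee_fin.
- by apply: emeasurable_sum => i; apply/measurable_EFinP; exact: mterm.
- apply: emeasurable_funD => //; apply: measurable_funeM.
  by apply/measurable_EFinP; exact: measurable_funX.
- move=> w _; rewrite sumEFin -EFinM -EFinD lee_fin.
  apply: le_trans (weighted_count_le _ _) _.
  by have := sqr_ge0 (Y w - 1)%R; nra.
Qed.

(** The constant 1/2 leaves at least half of the variance of a jump inside the
    window of cap_concave, and 1/16 is what closes the estimate of
    sum_undershoot_le. *)
Lemma exists_shift : exists B : nat,
  excess B%:R <= (1/2)%:E /\
  \sum_(B <= i <oo) weighted_tail i <= (1/16)%:E.
Proof.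
have h1 := nneseries_tail_cvg weighted_tail_summable (fun k _ => weighted_tail_ge0 k).
have h2 := excess_cvg0.
near \oo => B; exists B; split; apply: ltW; near: B.
- by apply: (cvge_near_lt h2); rewrite lte_fin; lra.
- by apply: (cvge_near_lt h1); rewrite lte_fin; lra.
Unshelve. all: by end_near. Qed.

End Tails.

(** * Odd Gaussian profiles and the heat flow *)

Section ExponentialTaylor.
Context {R : realType}.
Implicit Types x : R.

Lemma expR_taylor m x :
  `|expR x - \sum_(i < m) x ^+ i / i`!%:R| <= `|x| ^+ m * expR `|x|.
Proof.
have cx := @is_cvg_series_exp_coeff R x.
have ca := @is_cvg_series_exp_coeff R `|x|.
have bound n : `|series (exp_coeff x) (n + m)%N - \sum_(i < m) x ^+ i / i`!%:R| <=
    `|x| ^+ m * expR `|x|.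
  have -> : series (exp_coeff x) (n + m)%N - \sum_(i < m) x ^+ i / i`!%:R =
      \sum_(0 <= i < n) x ^+ (i + m) / (i + m)`!%:R.
    rewrite /series /= (@big_cat_nat _ _ _ m)//=; last exact: leq_addl.
    rewrite [X in X + _ - _]big_mkord addrAC subrr add0r.
    by rewrite -{1}[m]add0n big_addn addnK.
  apply: le_trans (ler_norm_sum _ _ _) _.
  apply: (@le_trans _ _ (`|x| ^+ m * series (exp_coeff `|x|) n)).
    rewrite /series /= mulr_sumr; apply: ler_sum => i _.
    rewrite /exp_coeff /= normrM normfV normrX exprD [X in X / _]mulrC -mulrA.
    rewrite ler_wpM2l// ?exprn_ge0// ler_wpM2l// ?exprn_ge0//.
    rewrite ger0_norm// lef_pV2 ?posrE ?ltr0n ?fact_gt0// ler_nat.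
    by rewrite leq_fact// leq_addr.
  rewrite ler_wpM2l// ?exprn_ge0//.
  apply: nondecreasing_cvgn_le ca _.
  by apply: nondecreasing_series => i _ _; rewrite /exp_coeff/= divr_ge0// exprn_ge0.
have h : `|series (exp_coeff x) (n + m)%N - \sum_(i < m) x ^+ i / i`!%:R| @[n --> \oo] -->
    `|expR x - \sum_(i < m) x ^+ i / i`!%:R|.
  apply: cvg_norm; apply: cvgB; last exact: cvg_cst.
  by rewrite (cvg_shiftn m (series (exp_coeff x))).
rewrite -(cvg_lim _ h)//; apply: limr_le; first by apply/cvg_ex; eexists; exact: h.
exact: nearW.
Qed.

Lemma expR_taylor2 x : `|expR x - 1 - x| <= x ^+ 2 * expR `|x|.
Proof.
have := expR_taylor 2 x.
rewrite !big_ord_recr big_ord0/= add0r expr0 fact0 divr1 expr1 divr1 opprD addrA.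
by rewrite real_normK// num_real.
Qed.

Lemma expR_taylor3 x : `|expR x - 1 - x - x ^+ 2 / 2| <= `|x| ^+ 3 * expR `|x|.
Proof.
have := expR_taylor 3 x.
by rewrite !big_ord_recr big_ord0/= add0r expr0 fact0 divr1 expr1 divr1 !opprD !addrA.
Qed.

End ExponentialTaylor.

Section GaussianBounds.
Context {R : realType}.
Implicit Types z s u : R.

Definition gdecay : R := expR (1 + 9).

(** By 1 + u <= e^u the left-hand side is at most e^(6u + 1 - u^2), and 6u + 1
    - u^2 is largest at u = 3. *)
Lemma gaussian_decay u : 0 <= u ->
  (1 + u) ^+ 4 * expR (2 * u + 1) * expR (- u ^+ 2) <= gdecay.
Proof.
move=> u0; apply: (@le_trans _ _ (expR u ^+ 4 * expR (2 * u + 1) * expR (- u ^+ 2))).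
  have h : (1 + u) ^+ 4 <= expR u ^+ 4.
    by rewrite ler_pXn2r ?nnegrE ?expR_ge0 ?expR_ge1Dx//; lra.
  by rewrite !ler_wpM2r// expR_ge0.
rewrite -expRM_natl -!expRD ler_expR.
by have := sqr_ge0 (u - 3); nra.
Qed.

Lemma gaussian_decay_le z p : p <= (1 + `|z|) ^+ 4 * expR (2 * `|z| + 1) ->
  p * expR (- z ^+ 2) <= gdecay.
Proof.
move=> h; apply: le_trans (gaussian_decay (normr_ge0 z)).
by rewrite real_normK ?num_real// ler_wpM2r// expR_ge0.
Qed.

Definition gbump z := z * expR (- z ^+ 2).
(** The derivative of gbump. *)
Definition gbump1 z := (1 - 2 * z ^+ 2) * expR (- z ^+ 2).
(** Half of the second derivative of gbump. *)
Definition gbump2 z := (2 * z ^+ 3 - 3 * z) * expR (- z ^+ 2).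

(** For jumps of size at least 1 no cancellation is needed: gbump and its
    derivatives are bounded. *)
Lemma gbump_taylor_large z s : 1 <= `|s| ->
  `|gbump (z + s) - gbump z - gbump1 z * s - gbump2 z * s ^+ 2| <= 12 * gdecay * s ^+ 2.
Proof.
move=> s1.
have e1 u : 0 <= u -> 1 <= expR (2 * u + 1).
  by move=> u0; apply: le_trans (expR_ge1Dx _); lra.
have pw u p : 0 <= u -> p <= (1 + u) ^+ 4 -> p <= (1 + u) ^+ 4 * expR (2 * u + 1).
  move=> u0 /le_trans; apply; rewrite ler_peMr ?e1// exprn_ge0//; lra.
have b0 w : `|gbump w| <= gdecay.
  rewrite /gbump normrM (ger0_norm (expR_ge0 _)); apply: gaussian_decay_le; apply: pw => //.
  have := normr_ge0 w; set u := `|w|; move=> u0.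
  have : 0 <= u ^+ 2 by exact: sqr_ge0.
  have : 0 <= u ^+ 3 by exact: exprn_ge0.
  have : 0 <= u ^+ 4 by exact: exprn_ge0.
  by move=> *; rewrite (_ : (1 + u) ^+ 4 = 1 + 4 * u + 6 * u ^+ 2 + 4 * u ^+ 3 + u ^+ 4); [lra|ring].
have b1 : `|gbump1 z| <= gdecay.
  rewrite /gbump1 normrM (ger0_norm (expR_ge0 _)); apply: gaussian_decay_le; apply: pw => //.
  apply: le_trans (ler_normB _ _) _; rewrite normr1 normrM normrX (@ger0_norm _ 2)//.
  have := normr_ge0 z; set u := `|z|; move=> u0.
  have : 0 <= u ^+ 2 by exact: sqr_ge0.
  have : 0 <= u ^+ 3 by exact: exprn_ge0.
  have : 0 <= u ^+ 4 by exact: exprn_ge0.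
  by move=> *; rewrite (_ : (1 + u) ^+ 4 = 1 + 4 * u + 6 * u ^+ 2 + 4 * u ^+ 3 + u ^+ 4); [lra|ring].
have b2 : `|gbump2 z| <= gdecay.
  rewrite /gbump2 normrM (ger0_norm (expR_ge0 _)); apply: gaussian_decay_le; apply: pw => //.
  apply: le_trans (ler_normB _ _) _; rewrite (normrM 2) (normrM 3) normrX (@ger0_norm _ 2)// (@ger0_norm _ 3)//.
  have := normr_ge0 z; set u := `|z|; move=> u0.
  have : 0 <= u ^+ 2 by exact: sqr_ge0.
  have : 0 <= u ^+ 3 by exact: exprn_ge0.
  have : 0 <= u ^+ 4 by exact: exprn_ge0.
  by move=> *; rewrite (_ : (1 + u) ^+ 4 = 1 + 4 * u + 6 * u ^+ 2 + 4 * u ^+ 3 + u ^+ 4); [lra|ring].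
have g0 : 0 <= gdecay by exact: expR_ge0.
have -> : s ^+ 2 = `|s| ^+ 2 by rewrite real_normK// num_real.
apply: (@le_trans _ _ (gdecay + gdecay + gdecay * `|s| + gdecay * `|s| ^+ 2)).
  apply: le_trans (ler_normB _ _) _; apply: lerD.
    apply: le_trans (ler_normB _ _) _; apply: lerD.
      by apply: le_trans (ler_normB _ _) _; exact: lerD.
    by rewrite normrM ler_wpM2r.
  by rewrite normrM normrX normr_id ler_wpM2r// exprn_ge0.
set t := `|s| in s1 *.
have h1 : t <= t ^+ 2 by rewrite expr2 ler_peMl//; lra.
have h2 : 0 <= gdecay * (t ^+ 2 - t) by apply: mulr_ge0 => //; lra.
have h3 : 0 <= gdecay * (t ^+ 2 - 1) by apply: mulr_ge0 => //; lra.
have h4 : 0 <= gdecay * t ^+ 2 by apply: mulr_ge0 => //; exact: sqr_ge0.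
lra.
Qed.

(** With E = - 2 z s - s^2 the shifted Gaussian is e^(- z^2) e^E. Expanding
    e^E to second order leaves only terms with a factor s^3, and e^(- z^2)
    absorbs the powers of z and e^|E| that come with them. *)
Lemma gbump_taylor_small z s : `|s| <= 1 ->
  `|gbump (z + s) - gbump z - gbump1 z * s - gbump2 z * s ^+ 2| <= 12 * gdecay * `|s| ^+ 3.
Proof.
move=> s1; set E := - (2 * z * s) - s ^+ 2.
set r := expR E - 1 - E - E ^+ 2 / 2.
have eE : expR (- (z + s) ^+ 2) = expR (- z ^+ 2) * (1 + E + E ^+ 2 / 2 + r).
  rewrite (_ : - (z + s) ^+ 2 = - z ^+ 2 + E); last by rewrite /E; ring.
  by rewrite expRD /r; ring.
have -> : gbump (z + s) - gbump z - gbump1 z * s - gbump2 z * s ^+ 2 =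
   (s ^+ 3 * (4 * z ^+ 2 - 1 + 5/2 * z * s + s ^+ 2 / 2) + (z + s) * r) * expR (- z ^+ 2).
  by rewrite /gbump /gbump1 /gbump2 eE /E; field.
rewrite normrM (ger0_norm (expR_ge0 _)).
set u := `|z|; have u0 : 0 <= u := normr_ge0 z.
set t := `|s|; have t0 : 0 <= t := normr_ge0 s.
have zE : z ^+ 2 = u ^+ 2 by rewrite real_normK// num_real.
have sE : s ^+ 2 = t ^+ 2 by rewrite real_normK// num_real.
have Et : `|E| <= t * (2 * u + 1).
  rewrite /E; apply: le_trans (ler_normB _ _) _.
  rewrite normrN (normrM (2 * z)) (normrM 2) normrX (@ger0_norm _ 2)// -/u -/t.
  by have : t ^+ 2 <= t; [rewrite expr2 ler_piMl|move=> ?; lra].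
have Et1 : `|E| <= 2 * u + 1.
  by apply: le_trans Et _; rewrite ler_piMl//; lra.
have hr : `|r| <= t ^+ 3 * (2 * u + 1) ^+ 3 * expR (2 * u + 1).
  apply: le_trans (expR_taylor3 E) _; apply: ler_pM => //; rewrite ?exprn_ge0 ?expR_ge0//.
    by rewrite -exprMn ler_pXn2r// nnegrE// mulr_ge0//; lra.
  by rewrite ler_expR.
have e1 : 1 <= expR (2 * u + 1) by apply: le_trans (expR_ge1Dx _); lra.
have u1 : 0 <= (1 + u) ^+ 4 by rewrite exprn_ge0//; lra.
have q : `|4 * z ^+ 2 - 1 + 5/2 * z * s + s ^+ 2 / 2| <= 4 * ((1 + u) ^+ 4 * expR (2 * u + 1)).
  apply: (@le_trans _ _ (4 * u ^+ 2 + 1 + 5/2 * u * t + t ^+ 2 / 2)).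
    rewrite zE sE; apply: le_trans (ler_normD _ _) _; apply: lerD; last first.
      by rewrite ger0_norm// divr_ge0// sqr_ge0.
    apply: le_trans (ler_normD _ _) _; apply: lerD; last first.
      by rewrite (normrM (_ * z)) (normrM _ z) -/u -/t ger0_norm//; lra.
    apply: le_trans (ler_normB _ _) _; apply: lerD; last by rewrite normr1.
    by rewrite ger0_norm// mulr_ge0// sqr_ge0.
  apply: (@le_trans _ _ (4 * (1 + u) ^+ 4)); last first.
    by rewrite ler_pM2l// ler_peMr.
  have : u * t <= u by rewrite ler_piMr.
  have : t ^+ 2 <= 1 by rewrite expr_le1.
  have : 0 <= u ^+ 2 by exact: sqr_ge0.
  have : 0 <= u ^+ 3 by exact: exprn_ge0.
  have : 0 <= u ^+ 4 by exact: exprn_ge0.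
  by move=> *; rewrite (_ : (1 + u) ^+ 4 = 1 + 4 * u + 6 * u ^+ 2 + 4 * u ^+ 3 + u ^+ 4); [lra|ring].
have q2 : `|(z + s) * r| <= t ^+ 3 * (8 * ((1 + u) ^+ 4 * expR (2 * u + 1))).
  rewrite normrM.
  apply: (@le_trans _ _ ((1 + u) * (t ^+ 3 * (2 * u + 1) ^+ 3 * expR (2 * u + 1)))).
    by apply: ler_pM => //; apply: le_trans (ler_normD z s) _; rewrite addrC lerD2r.
  rewrite (_ : _ * _ = t ^+ 3 * ((1 + u) * (2 * u + 1) ^+ 3 * expR (2 * u + 1))); last by ring.
  rewrite ler_wpM2l ?exprn_ge0// mulrA ler_wpM2r ?expR_ge0//.
  rewrite (_ : 8 * (1 + u) ^+ 4 = (1 + u) * (2 + 2 * u) ^+ 3); last by ring.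
  rewrite ler_wpM2l//; first by lra.
  by rewrite ler_pXn2r// ?nnegrE; lra.
apply: (@le_trans _ _ ((12 * t ^+ 3) * (((1 + u) ^+ 4 * expR (2 * u + 1)) * expR (- z ^+ 2)))).
  rewrite mulrA ler_wpM2r ?expR_ge0//.
  apply: le_trans (ler_normD _ _) _; apply: le_trans (lerD (lexx _) q2) _.
  rewrite normrM normrX -/t.
  have := ler_wpM2l (exprn_ge0 3 t0) q; lra.
rewrite (_ : 12 * gdecay * t ^+ 3 = (12 * t ^+ 3) * gdecay); last by ring.
by rewrite ler_wpM2l ?mulr_ge0 ?exprn_ge0// gaussian_decay_le.
Qed.

(** The remainder is cubic only for jumps below eta, quadratic above: this is
    all that can be integrated when a jump has just two moments. *)
Lemma gbump_taylor z s eta : 0 < eta <= 1 ->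
  `|gbump (z + s) - gbump z - gbump1 z * s - gbump2 z * s ^+ 2| <=
  12 * gdecay * (eta * s ^+ 2 + sqr_above eta s).
Proof.
move=> /andP[e0 e1].
have g0 : 0 <= gdecay by exact: expR_ge0.
have sE : s ^+ 2 = `|s| ^+ 2 by rewrite real_normK// num_real.
have s2 : 0 <= s ^+ 2 := sqr_ge0 s.
have g12 : 0 <= 12 * gdecay by rewrite mulr_ge0.
have [s1|s1] := leP 1 `|s|.
  apply: le_trans (gbump_taylor_large z s1) _; rewrite ler_wpM2l//.
  rewrite /sqr_above; case: ltP => h.
    by rewrite lerDr mulr_ge0// ltW.
  have -> : eta = 1 by lra.
  by rewrite addr0 mul1r.
apply: le_trans (gbump_taylor_small z (ltW s1)) _; rewrite ler_wpM2l//.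
have cube : `|s| ^+ 3 = `|s| * s ^+ 2 by rewrite sE -exprS.
rewrite cube /sqr_above; case: ltP => h.
  have : `|s| * s ^+ 2 <= s ^+ 2 by rewrite ler_piMl// ltW.
  have : 0 <= eta * s ^+ 2 by rewrite mulr_ge0// ltW.
  lra.
by rewrite addr0 ler_wpM2r.
Qed.

End GaussianBounds.

Section HeatStep.
Context {R : realType}.
Implicit Types z s u y theta beta v B : R.

(** The function z (1 + 2 b)^(-3/2) exp(- z^2 / (1 + 2 b)) solves the heat
    equation (time derivative equal to half the second space derivative) with
    initial value gbump. This is its scaling factor at time b. *)
Definition heat_factor beta : R := (Num.sqrt (1 + 2 * beta))^-1.

Lemma heat_factor_gt0 beta : 0 <= beta -> 0 < heat_factor beta.
Proof. by move=> b0; rewrite invr_gt0 sqrtr_gt0; lra. Qed.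

Lemma heat_factor_sqr beta : 0 <= beta -> heat_factor beta ^+ 2 * (1 + 2 * beta) = 1.
Proof.
move=> b0; rewrite /heat_factor exprVn sqr_sqrtr; last lra.
by rewrite mulVf// gt_eqF//; lra.
Qed.

Lemma heat_factor_bounds beta : 0 <= beta <= 1/4 ->
  1 - beta <= heat_factor beta <= 1 - beta + 2 * beta ^+ 2.
Proof.
move=> /andP[b0 b1]; have v0 := heat_factor_gt0 b0; have v2 := heat_factor_sqr b0.
move: (heat_factor beta) v0 v2 => v v0 v2.
have c0 : 0 < 1 + 2 * beta by lra.
have bb : 0 <= beta ^+ 2 by exact: sqr_ge0.
apply/andP; split.
  rewrite -(@ler_pXn2r _ 2)// ?nnegrE; [|lra|lra].
  rewrite -(ler_pM2r c0) v2.
  have : 0 <= beta ^+ 2 * (3 - 2 * beta) by rewrite mulr_ge0//; lra.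
  nra.
rewrite -(@ler_pXn2r _ 2)// ?nnegrE; [|lra|lra].
rewrite -(ler_pM2r c0) v2.
have -> : (1 - beta + 2 * beta ^+ 2) ^+ 2 * (1 + 2 * beta) =
  1 + beta ^+ 2 * (1 + 6 * beta - 4 * beta ^+ 2 + 8 * beta ^+ 3) by ring.
rewrite lerDl mulr_ge0//.
have : 0 <= beta ^+ 3 by exact: exprn_ge0.
have : beta ^+ 2 <= beta by rewrite expr2 ler_piMl//; lra.
lra.
Qed.

(** The maximum of e^(5u - u^2 / 2). *)
Definition gdecay5 : R := expR (25/2).

(** Expansion in time to first order of that solution of the heat equation:
    the time derivative at 0 is half of the second space derivative gbump2. *)
Lemma heat_step z beta v : 0 <= beta <= 1/4 -> v = heat_factor beta ->
  `|v ^+ 3 * z * expR (- z ^+ 2 * v ^+ 2) - gbump z - beta * gbump2 z| <=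
  10 * gdecay5 * beta ^+ 2.
Proof.
move=> bb vE; have /andP[b0 b1] := bb.
have /andP[v1 v2] := heat_factor_bounds bb; have vu := heat_factor_sqr b0.
have v0 := heat_factor_gt0 b0; rewrite -vE in v1 v2 vu v0.
have beta2 : 0 <= beta ^+ 2 by exact: sqr_ge0.
move uE : (v ^+ 2) vu => u vu; move wE0 : (z ^+ 2) => w.
have w0 : 0 <= w by rewrite -wE0 sqr_ge0.
have u0 : 0 <= u by rewrite -uE sqr_ge0.
have u1 : u <= 1 by nra.
have u2 : 1 - 2 * beta <= u by nra.
have u3 : u <= 1 - 2 * beta + 4 * beta ^+ 2 by nra.
have vle1 : v <= 1 by nra.
(* F = w (1 - u), since u (1 + 2 beta) = 1. *)
pose F := 2 * beta * u * w.
have F0 : 0 <= F by rewrite /F !mulr_ge0//.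
have Fw : F <= 2 * beta * w.
  by rewrite /F ler_wpM2r// ler_piMr// mulr_ge0.
have Fw2 : F <= w / 2 by apply: le_trans Fw _; rewrite mulrC ler_wpM2l//; lra.
have eE : expR (- w * u) = expR (- w) * expR F.
  rewrite -expRD; congr expR; rewrite /F.
  have -> : - w + 2 * beta * u * w = - w * (1 - 2 * beta * u) by ring.
  by congr (_ * _); lra.
have -> : v ^+ 3 * z * expR (- w * u) - gbump z - beta * gbump2 z =
   (v * u * expR F - 1 - 2 * beta * w + 3 * beta) * (z * expR (- w)).
  have z3 : z ^+ 3 = z * w by rewrite -wE0 -exprS.
  have v3 : v ^+ 3 = v * u by rewrite -uE -exprS.
  by rewrite eE /gbump /gbump2 wE0 z3 v3; ring.
have e1 : 1 <= expR (w / 2) by apply: le_trans (expR_ge1Dx _); rewrite lerDl divr_ge0.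
have r2 : `|expR F - 1 - F| <= 4 * beta ^+ 2 * w ^+ 2 * expR (w / 2).
  apply: le_trans (expR_taylor2 F) _; apply: ler_pM => //; rewrite ?sqr_ge0 ?expR_ge0//.
    have -> : 4 * beta ^+ 2 * w ^+ 2 = (2 * beta * w) ^+ 2 by ring.
    by rewrite ler_pXn2r// nnegrE// !mulr_ge0.
  by rewrite ler_expR ger0_norm.
have v3 : `|v * u - 1 + 3 * beta| <= 10 * beta ^+ 2.
  have d0 : 0 <= v - (1 - beta) by lra.
  have d1 : v - (1 - beta) <= 2 * beta ^+ 2 by lra.
  have d2 : 0 <= u - (1 - 2 * beta) by lra.
  have d3 : u - (1 - 2 * beta) <= 4 * beta ^+ 2 by lra.
  have -> : v * u - 1 + 3 * beta =
     2 * beta ^+ 2 + (v - (1 - beta)) * u + (1 - beta) * (u - (1 - 2 * beta)) by ring.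
  have h1 : 0 <= (v - (1 - beta)) * u <= 2 * beta ^+ 2.
    rewrite mulr_ge0//=; apply: le_trans _ d1; rewrite ler_piMr//.
  have h2 : 0 <= (1 - beta) * (u - (1 - 2 * beta)) <= 4 * beta ^+ 2.
    have b3 : 0 <= 1 - beta by lra.
    by rewrite mulr_ge0//=; apply: le_trans _ d3; rewrite ler_piMl//; lra.
  case/andP: h1 => ? ?; case/andP: h2 => ? ?.
  by rewrite ger0_norm; lra.
have v4 : `|v * u * u - 1| <= 5 * beta.
  have h1 : v * u * u <= 1 by rewrite !mulr_ile1// ?mulr_ge0// ltW.
  have h2 : 1 - 5 * beta <= v * u * u.
    have a1 : (1 - beta) * (1 - 2 * beta) <= v * u by apply: ler_pM => //; lra.
    have a2 : (1 - beta) * (1 - 2 * beta) * (1 - 2 * beta) <= v * u * u.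
      by apply: ler_pM => //; [apply: mulr_ge0; lra|lra].
    apply: le_trans a2.
    have -> : (1 - beta) * (1 - 2 * beta) * (1 - 2 * beta) =
      1 - 5 * beta + beta ^+ 2 * (8 - 4 * beta) by ring.
    by rewrite lerDl mulr_ge0//; lra.
  by rewrite ler_norml; apply/andP; split; lra.
have total : `|v * u * expR F - 1 - 2 * beta * w + 3 * beta| <=
    10 * beta ^+ 2 * ((1 + w) ^+ 2 * expR (w / 2)).
  have -> : v * u * expR F - 1 - 2 * beta * w + 3 * beta =
    v * u * (expR F - 1 - F) + (v * u - 1 + 3 * beta) + 2 * beta * w * (v * u * u - 1).
    by rewrite /F; ring.
  have vu1 : v * u <= 1 by rewrite mulr_ile1// ltW.
  have vu0 : 0 <= v * u by rewrite mulr_ge0// ltW.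
  apply: (@le_trans _ _ (4 * beta ^+ 2 * w ^+ 2 * expR (w / 2) + 10 * beta ^+ 2 + 10 * beta ^+ 2 * w)).
    apply: le_trans (ler_normD _ _) _; apply: lerD.
      apply: le_trans (ler_normD _ _) _; apply: lerD => //.
      rewrite normrM (ger0_norm vu0); apply: le_trans _ r2.
      by rewrite ler_piMl.
    rewrite normrM ger0_norm; last by rewrite !mulr_ge0//.
    have -> : 10 * beta ^+ 2 * w = 2 * beta * w * (5 * beta) by ring.
    by rewrite ler_wpM2l// !mulr_ge0.
  set e := expR (w / 2) in e1 *.
  have w2 : 0 <= w ^+ 2 by exact: sqr_ge0.
  have h1 : beta ^+ 2 <= beta ^+ 2 * e by rewrite ler_peMr.
  have h2 : beta ^+ 2 * w <= beta ^+ 2 * w * e by rewrite ler_peMr// mulr_ge0.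
  have e0 : 0 <= e by lra.
  have h3 : 0 <= beta ^+ 2 * w ^+ 2 * e by rewrite !mulr_ge0//.
  have h4 : 0 <= beta ^+ 2 * w * e by rewrite !mulr_ge0//.
  have -> : 10 * beta ^+ 2 * ((1 + w) ^+ 2 * e) =
    10 * (beta ^+ 2 * e) + 20 * (beta ^+ 2 * w * e) + 10 * (beta ^+ 2 * w ^+ 2 * e) by ring.
  lra.
rewrite normrM normrM (ger0_norm (expR_ge0 _)).
apply: (@le_trans _ _ (10 * beta ^+ 2 * ((1 + w) ^+ 2 * expR (w / 2)) * (`|z| * expR (- w)))).
  by rewrite ler_wpM2r// mulr_ge0// expR_ge0.
have -> : 10 * gdecay5 * beta ^+ 2 = 10 * beta ^+ 2 * gdecay5 by ring.
rewrite -mulrA ler_wpM2l ?mulr_ge0//.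
have -> : (1 + w) ^+ 2 * expR (w / 2) * (`|z| * expR (- w)) =
   (1 + w) ^+ 2 * `|z| * expR (- (w / 2)).
  have -> : - (w / 2) = w / 2 - w by field.
  by rewrite expRD; ring.
have wE : w = `|z| ^+ 2 by rewrite real_normK ?num_real.
set t := `|z| in wE *; have t0 : 0 <= t := normr_ge0 z.
apply: (@le_trans _ _ (expR t ^+ 5 * expR (- (w / 2)))).
  rewrite ler_wpM2r ?expR_ge0//.
  apply: (@le_trans _ _ ((1 + t) ^+ 5)).
    have -> : (1 + t) ^+ 5 = ((1 + t) ^+ 2) ^+ 2 * (1 + t) by ring.
    apply: ler_pM => //; rewrite ?sqr_ge0//; last lra.
    have w1 : 0 <= 1 + w by lra.
    rewrite ler_pXn2r// ?nnegrE ?sqr_ge0//.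
    rewrite wE (_ : (1 + t) ^+ 2 = 1 + t ^+ 2 + 2 * t); last by ring.
    by rewrite lerDl mulr_ge0.
  rewrite ler_pXn2r ?nnegrE ?expR_ge0 ?expR_ge1Dx//; lra.
rewrite -expRM_natl -expRD ler_expR wE.
by have := sqr_ge0 (t - 5); nra.
Qed.

Definition wave theta y : R := y * expR (- (theta * y) ^+ 2).

Lemma sqr_above_scale theta B s : 0 < theta ->
  sqr_above (theta * B) (theta * s) = theta ^+ 2 * sqr_above B s.
Proof.
move=> t0; rewrite /sqr_above normrM (gtr0_norm t0) ltr_pM2l//.
by case: ifP => _; rewrite ?mulr0// exprMn.
Qed.

Definition wave_const : R := 12 * gdecay + 10 * gdecay5.

Lemma wave_const_ge0 : 0 <= wave_const.
Proof. by rewrite /wave_const addr_ge0// mulr_ge0// expR_ge0. Qed.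

(** The expansions of gbump in space and in time have the same second-order
    coefficient, so that together they leave a multiple of s^2 - 1, which has
    mean zero for every jump law. *)
Lemma wave_step theta B v y s : 0 < theta <= 1/2 -> 0 < B -> theta * B <= 1 ->
  v = heat_factor (theta ^+ 2) ->
  `|wave theta (y + s) - v ^+ 3 * wave (theta * v) y
    - gbump1 (theta * y) * s - theta * gbump2 (theta * y) * (s ^+ 2 - 1)| <=
  wave_const * (theta ^+ 3 + theta ^+ 2 * B * s ^+ 2 + theta * sqr_above B s).
Proof.
move=> /andP[t0 t1] B0 tB vE.
have tn0 : theta != 0 by rewrite gt_eqF.
set z := theta * y.
have w1 : wave theta (y + s) = theta^-1 * gbump (z + theta * s).
  by rewrite /wave /gbump /z -mulrDr; field.
have w2 : v ^+ 3 * wave (theta * v) y = theta^-1 * (v ^+ 3 * z * expR (- z ^+ 2 * v ^+ 2)).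
  rewrite /wave /z (_ : - (theta * v * y) ^+ 2 = - (theta * y) ^+ 2 * v ^+ 2); last by ring.
  by field.
have tb : 0 < theta * B <= 1 by rewrite tB mulr_gt0.
have h1 := gbump_taylor z (theta * s) tb.
have h2 : `|v ^+ 3 * z * expR (- z ^+ 2 * v ^+ 2) - gbump z - theta ^+ 2 * gbump2 z| <=
  10 * gdecay5 * (theta ^+ 2) ^+ 2.
  by apply: heat_step => //; rewrite sqr_ge0/=; nra.
rewrite sqr_above_scale// in h1.
have -> : wave theta (y + s) - v ^+ 3 * wave (theta * v) y
    - gbump1 z * s - theta * gbump2 z * (s ^+ 2 - 1) =
  theta^-1 * ((gbump (z + theta * s) - gbump z - gbump1 z * (theta * s) - gbump2 z * (theta * s) ^+ 2)
   - (v ^+ 3 * z * expR (- z ^+ 2 * v ^+ 2) - gbump z - theta ^+ 2 * gbump2 z)).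
  by rewrite w1 w2; field.
rewrite normrM gtr0_norm ?invr_gt0// ler_pdivrMl//.
apply: le_trans (ler_normB _ _) _.
apply: le_trans (lerD h1 h2) _.
have g1 : 0 <= gdecay :> R by exact: expR_ge0.
have g2 : 0 <= gdecay5 by exact: expR_ge0.
rewrite /wave_const.
rewrite exprMn; move: (sqr_above_ge0 B s) (sqr_ge0 s).
move: (sqr_above B s) (s ^+ 2) => Q S Q0 S0.
have t3 : 0 <= theta ^+ 4 by exact: exprn_ge0 (ltW t0).
have a1 : 0 <= theta ^+ 3 * B * S by rewrite !mulr_ge0// ?exprn_ge0// ltW.
have a2 : 0 <= theta ^+ 2 * Q by rewrite !mulr_ge0// ?exprn_ge0// ltW.
have b1 := mulr_ge0 g1 t3; have b2 := mulr_ge0 g2 a1; have b3 := mulr_ge0 g2 a2.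
have -> : 12 * gdecay * (theta * B * (theta ^+ 2 * S) + theta ^+ 2 * Q) +
   10 * gdecay5 * (theta ^+ 2) ^+ 2 = 12 * (gdecay * (theta ^+ 3 * B * S)) +
   12 * (gdecay * (theta ^+ 2 * Q)) + 10 * (gdecay5 * theta ^+ 4) by ring.
have -> : theta * ((12 * gdecay + 10 * gdecay5) * (theta ^+ 3 + theta ^+ 2 * B * S + theta * Q)) =
  12 * (gdecay * (theta ^+ 3 * B * S)) + 12 * (gdecay * (theta ^+ 2 * Q)) + 12 * (gdecay * theta ^+ 4) +
  10 * (gdecay5 * (theta ^+ 3 * B * S)) + 10 * (gdecay5 * (theta ^+ 2 * Q)) + 10 * (gdecay5 * theta ^+ 4) by ring.
lra.
Qed.

End HeatStep.

Section TestFunction.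
Context {R : realType}.
Implicit Types c y s B : R.

(** The semigroup property of the heat flow on these profiles. *)
Lemma heat_factorM (b c : R) : 0 <= b -> 0 <= c ->
  heat_factor b * heat_factor (c * heat_factor b ^+ 2) = heat_factor (b + c).
Proof.
move=> b0 c0; rewrite /heat_factor -invfM -sqrtrM; last by lra.
congr (Num.sqrt _)^-1; rewrite exprVn sqr_sqrtr; last by lra.
by field; rewrite gt_eqF//; lra.
Qed.

Lemma heat_factor_le1 (b : R) : 0 <= b -> heat_factor b <= 1.
Proof.
move=> b0; rewrite /heat_factor invf_le1 ?sqrtr_gt0; last by lra.
by rewrite -[X in X <= _]sqrtr1 ler_sqrt; lra.
Qed.

Lemma heat_factor0 : heat_factor 0 = 1 :> R.
Proof. by rewrite /heat_factor mulr0 addr0 sqrtr1 invr1. Qed.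

(** The mean of g(y + N) for N normal with mean 0 and variance m, where g(y) =
    y exp(- c y^2): the profile g with m steps still to run. *)
Definition twave c (m : nat) y : R :=
  let w := heat_factor (c * m%:R) in w ^+ 3 * wave (Num.sqrt c * w) y.

Lemma twave_bound c m y : 0 <= c -> `|twave c m y| <= `|y|.
Proof.
move=> c0; have w0 := heat_factor_gt0 (mulr_ge0 c0 (ler0n _ m)).
have w1 := heat_factor_le1 (mulr_ge0 c0 (ler0n _ m)).
rewrite /twave /wave normrM normrX (normrM y).
rewrite -[leRHS]mul1r; apply: ler_pM => //; rewrite ?exprn_ge0 ?mulr_ge0//.
  by rewrite (gtr0_norm w0) exprn_ile1// ltW.
rewrite -[leRHS]mulr1 ler_pM// ger0_norm ?expR_ge0// expR_le1 oppr_le0.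
exact: sqr_ge0.
Qed.

Lemma twave_ge0 c m y : 0 <= c -> 0 <= y -> 0 <= twave c m y.
Proof.
move=> c0 y0; have w0 := heat_factor_gt0 (mulr_ge0 c0 (ler0n _ m)).
rewrite /twave /wave; apply: mulr_ge0; first by rewrite exprn_ge0// ltW.
by rewrite mulr_ge0// expR_ge0.
Qed.

Lemma twave_le0 c m y : 0 <= c -> y <= 0 -> twave c m y <= 0.
Proof.
move=> c0 y0; have w0 := heat_factor_gt0 (mulr_ge0 c0 (ler0n _ m)).
rewrite /twave /wave; apply: mulr_ge0_le0; first by rewrite exprn_ge0// ltW.
by rewrite mulr_le0_ge0// expR_ge0.
Qed.

Lemma measurable_twave c m : measurable_fun setT (twave c m).
Proof.
apply: measurable_funM => //; apply: measurable_funM => //.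
apply: measurableT_comp => //; apply: measurable_funN.
by apply: measurable_funX; exact: measurable_funM.
Qed.

(** Bounds the mean of the right-hand side of twave_step at t = sqrt c when
    the truncated second moment above B is at most e. It is o(t) as first e is
    made small and then t. *)
Definition step_error (t B e : R) : R := wave_const * (t ^+ 3 + t ^+ 2 * B + t * e).

(** One jump s of the chain against one unit of heat time. The coefficients b
    and g depend on y only, and both polynomials that they multiply have mean
    zero. *)
Lemma twave_step c m B y : 0 < c -> 0 < B -> Num.sqrt c <= 1/2 -> Num.sqrt c * B <= 1 ->
  exists b g : R, forall s,
  `|twave c m (y + s) - twave c m.+1 y - b * s - g * (s ^+ 2 - 1)| <=
  wave_const * (Num.sqrt c ^+ 3 + Num.sqrt c ^+ 2 * B * s ^+ 2 + Num.sqrt c * sqr_above B s).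
Proof.
move=> c0 B0 cs cB; set w := heat_factor (c * m%:R).
have cm0 : 0 <= c * m%:R by rewrite mulr_ge0// ltW.
have w0 : 0 < w := heat_factor_gt0 cm0.
have w1 : w <= 1 := heat_factor_le1 cm0.
set t := Num.sqrt c in cs cB *; have t0 : 0 < t by rewrite sqrtr_gt0.
set theta := t * w.
have th0 : 0 < theta by rewrite mulr_gt0.
have tht : theta <= t by rewrite ler_piMr// ltW.
have thB : theta * B <= 1 by apply: le_trans cB; rewrite ler_wpM2r// ltW.
have th2 : 0 < theta <= 1/2 by rewrite th0 (le_trans tht).
have wS : heat_factor (c * m.+1%:R) = w * heat_factor (theta ^+ 2).
  rewrite exprMn sqr_sqrtr ?(ltW c0)// heat_factorM ?(ltW c0)//.
  by congr heat_factor; rewrite -natr1; ring.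
have C0 := @wave_const_ge0 R.
exists (w ^+ 3 * gbump1 (theta * y)), (w ^+ 3 * (theta * gbump2 (theta * y))) => s.
have h := wave_step y s th2 B0 thB erefl.
rewrite /twave wS -/w -/t -/theta [t * (w * _)]mulrA -/theta.
set v := heat_factor _ in h *.
rewrite (_ : _ - _ = w ^+ 3 * (wave theta (y + s) - v ^+ 3 * wave (theta * v) y -
     gbump1 (theta * y) * s - theta * gbump2 (theta * y) * (s ^+ 2 - 1))); last by ring.
rewrite normrM ger0_norm; last by rewrite exprn_ge0// ltW.
apply: le_trans (ler_wpM2l _ h) _; first by rewrite exprn_ge0 ?ltW.
have s2 := sqr_ge0 s; have Q0 := sqr_above_ge0 B s.
have th0' := ltW th0; have B0' := ltW B0; have w0' := ltW w0; have t0' := ltW t0.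
have th3 : 0 <= theta ^+ 3 by exact: exprn_ge0.
have thBs : 0 <= theta ^+ 2 * B * s ^+ 2.
  by apply: mulr_ge0; [apply: mulr_ge0 => //; exact: sqr_ge0|exact: sqr_ge0].
have thQ : 0 <= theta * sqr_above B s by exact: mulr_ge0.
apply: (@le_trans _ _ (wave_const * (theta ^+ 3 + theta ^+ 2 * B * s ^+ 2 + theta * sqr_above B s))).
  by rewrite ler_piMl ?exprn_ile1// mulr_ge0// !addr_ge0.
rewrite ler_wpM2l//; apply: lerD; last by rewrite ler_wpM2r.
apply: lerD; first by rewrite ler_pXn2r// nnegrE.
by rewrite ler_wpM2r// ler_wpM2r// ler_pXn2r// nnegrE.
Qed.

End TestFunction.

Section TestFunctionLimit.
Context {R : realType}.

Lemma cvg_invn (a : R) (m0 : nat) : a / (m0 + m)%:R @[m --> \oo] --> 0.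
Proof.
rewrite -(mulr0 a); apply: cvgM.
  exact: cvg_cst.
have h : (n%:R : R)^-1 @[n --> \oo] --> 0.
  apply/gtr0_cvgV0; last exact: cvgr_idn.
  by near=> n; rewrite ltr0n; near: n; exact: nbhs_infty_gt.
move: h; rewrite -(cvg_shiftn m0) => h.
by under eq_fun do rewrite addnC.
Unshelve. all: by end_near. Qed.

Lemma cvg_ratio (a : R) (m0 : nat) : (0 < m0)%N ->
  a / (m0 + m)%:R * m%:R @[m --> \oo] --> a.
Proof.
move=> m00.
have -> : (fun m : nat => a / (m0 + m)%:R * m%:R) =
    (fun m : nat => a - a / (m0 + m)%:R * m0%:R).
  apply/funext => m; rewrite natrD; field.
  by rewrite -natrD pnatr_eq0 addn_eq0 negb_and -lt0n m00.
rewrite -[X in _ --> X]subr0; apply: cvgB; first exact: cvg_cst.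
rewrite -(mul0r m0%:R); apply: cvgM; [exact: cvg_invn|exact: cvg_cst].
Qed.

Lemma cvg_heat_factor (u : nat -> R) (b : R) : 0 <= b ->
  u n @[n --> \oo] --> b -> heat_factor (u n) @[n --> \oo] --> heat_factor b.
Proof.
move=> b0 ub; apply: cvgV; first by rewrite gt_eqF// sqrtr_gt0; lra.
apply: continuous_cvg; first exact: sqrt_continuous.
by apply: cvgD; [exact: cvg_cst|apply: cvgM => //; exact: cvg_cst].
Qed.

Lemma cvg_sqrt_invn (a : R) (m0 : nat) : Num.sqrt (a / (m0 + m)%:R) @[m --> \oo] --> 0.
Proof.
rewrite -[X in _ --> X]sqrtr0; apply: continuous_cvg; first exact: sqrt_continuous.
exact: cvg_invn.
Qed.

Lemma cvg_exprn (u : nat -> R) (l : R) k : u n @[n --> \oo] --> l ->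
  u n ^+ k @[n --> \oo] --> l ^+ k.
Proof.
move=> ul; elim: k => [|k IH]; first by under eq_fun do rewrite expr0; exact: cvg_cst.
by rewrite exprS; under eq_fun do rewrite exprS; exact: cvgM.
Qed.

(** With c = a / (m0 + m) the heat time c m tends to a, while the Gaussian
    factor flattens out. *)
Lemma cvg_twave (a y : R) (m0 : nat) : 0 <= a -> (0 < m0)%N ->
  twave (a / (m0 + m)%:R) m y @[m --> \oo] --> heat_factor a ^+ 3 * y.
Proof.
move=> a0 m00.
have hw := cvg_heat_factor a0 (cvg_ratio (a := a) m00).
have -> : heat_factor a ^+ 3 * y =
    heat_factor a ^+ 3 * (y * expR (- (0 * heat_factor a * y) ^+ 2)).
  by rewrite !mul0r expr0n oppr0 expR0 mulr1.
rewrite /twave; apply: cvgM; first exact: cvg_exprn.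
rewrite /wave; apply: cvgM; first exact: cvg_cst.
apply: continuous_cvg; first exact: continuous_expR.
apply: cvgN; apply: cvg_exprn; apply: cvgM; last exact: cvg_cst.
by apply: cvgM => //; exact: cvg_sqrt_invn.
Qed.

End TestFunctionLimit.

(** * The method of moments on the unit interval *)

Section MomentMethod.
Context {R : realType}.
Implicit Types (f g : R -> R) (z r s t : R).

Definition bounded01 f :=
  measurable_fun setT f /\ exists C, forall z, 0 <= z <= 1 -> `|f z| <= C.

(** Stands for integration against a finite measure on the unit interval,
    which makes weak convergence a matter of comparing functions. *)
Record positive_functional (J : (R -> R) -> R) : Prop := PositiveFunctional {
  functionalD : forall a f g, bounded01 f -> bounded01 g ->
    J (fun z => a * f z + g z) = a * J f + J g ;
  functional_le : forall f g, bounded01 f -> bounded01 g ->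
    (forall z, 0 <= z <= 1 -> f z <= g z) -> J f <= J g }.

Lemma positive_functional_Rintegral d (T : measurableType d)
    (mu : {measure set T -> \bar R}) (D : set T) (w Z : T -> R) :
  measurable D -> mu.-integrable D (EFin \o w) -> (forall x, D x -> 0 <= w x) ->
  measurable_fun D Z -> (forall x, D x -> 0 <= Z x <= 1) ->
  positive_functional (fun f => \int[mu]_(x in D) (w x * f (Z x))).
Proof.
move=> mD iw w0 mZ Z01.
have mw : measurable_fun D w by apply/measurable_EFinP; exact: measurable_int iw.
have iwf f : bounded01 f -> mu.-integrable D (EFin \o (fun x => w x * f (Z x))).
  move=> [mf [C fC]].
  apply: (@le_integrable _ _ _ mu D mD _ (fun x => C%:E * (w x)%:E)%E).
  - apply/measurable_EFinP; apply: measurable_funM => //.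
    exact: (measurable_comp measurableT _ mf).
  - move=> x Dx; rewrite /= lee_fin !normrM mulrC.
    rewrite (ger0_norm (w0 _ Dx)) ler_wpM2r ?w0//.
    by apply: le_trans (ler_norm _); exact: fC (Z01 _ Dx).
  - by apply: integrableZl.
split.
  move=> a f g bf bg.
  under eq_Rintegral do rewrite mulrDr mulrCA.
  have iaf : mu.-integrable D (EFin \o (fun x => a * (w x * f (Z x)))).
    by apply: (integrableZl mD a (iwf _ bf)).
  rewrite RintegralD//; last exact: iwf.
  by rewrite RintegralZl//; exact: iwf.
move=> f g bf bg fg; apply: le_Rintegral => //; [exact: iwf|exact: iwf|].
by move=> x Dx; rewrite ler_wpM2l ?w0// fg// Z01.
Qed.

Lemma positive_functionalZ c J : 0 <= c -> positive_functional J ->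
  positive_functional (fun f => c * J f).
Proof.
move=> c0 [JD Jle]; split; first by move=> a f g bf bg; rewrite JD//; ring.
by move=> f g bf bg fg; rewrite ler_wpM2l// Jle.
Qed.

Lemma bounded01_exprn k : bounded01 (fun z => z ^+ k).
Proof.
split; first exact: measurable_funX.
exists 1 => z /andP[z0 z1]; rewrite ger0_norm ?exprn_ge0//.
by rewrite exprn_ile1.
Qed.

Lemma bounded01D a f g : bounded01 f -> bounded01 g ->
  bounded01 (fun z => a * f z + g z).
Proof.
move=> [mf [C fC]] [mg [D gD]]; split.
  by apply: measurable_funD => //; exact: measurable_funM.
exists (`|a| * C + D) => z z01; apply: le_trans (ler_normD _ _) _.
by apply: lerD; [rewrite normrM ler_wpM2l// fC|exact: gD].
Qed.

Lemma bounded01_cst c : bounded01 (fun=> c).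
Proof. by split => //; exists `|c|. Qed.

Lemma bounded01_le r : bounded01 (fun z => (z <= r)%R%:R).
Proof.
split.
  rewrite (_ : (fun _ => _) = \1_(`]-oo, r]%classic)); first exact: measurable_indic.
  by apply/funext => z; rewrite indicE mem_setE in_itv.
by exists 1 => z _; case: (z <= r); rewrite ?normr1 ?normr0.
Qed.

Definition partial_poly (c : nat -> R) m z := \sum_(i < m) c i * z ^+ i.

Lemma bounded01_partial_poly c m : bounded01 (partial_poly c m).
Proof.
elim: m => [|m IH].
  rewrite (_ : partial_poly c 0 = fun=> 0); first exact: bounded01_cst.
  by apply/funext => z; rewrite /partial_poly big_ord0.
rewrite (_ : partial_poly c m.+1 = fun z => c m * z ^+ m + partial_poly c m z).
  by apply: bounded01D => //; exact: bounded01_exprn.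
by apply/funext => z; rewrite /partial_poly big_ord_recr/= addrC.
Qed.

Lemma bounded01_horner (p : {poly R}) : bounded01 (fun z => p.[z]).
Proof.
rewrite (_ : (fun _ => _) = partial_poly (fun i => p`_i) (size p)).
  exact: bounded01_partial_poly.
by apply/funext => z; rewrite /partial_poly horner_coef.
Qed.

Lemma functional0 J : positive_functional J -> J (fun=> 0) = 0.
Proof.
move=> pJ; have := functionalD pJ (-1) (bounded01_cst 0) (bounded01_cst 0).
by rewrite /= mulr0 addr0 => ->; ring.
Qed.

Lemma partial_polyS J c m : positive_functional J ->
  J (partial_poly c m.+1) = c m * J (fun z => z ^+ m) + J (partial_poly c m).
Proof.
move=> pJ; rewrite -(functionalD pJ); [|exact: bounded01_exprn|exact: bounded01_partial_poly].
by congr J; apply/funext => z; rewrite /partial_poly big_ord_recr/= addrC.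
Qed.

Lemma bernoulli_lower (x : R) n : 0 <= x <= 1 -> 1 - n%:R * x <= (1 - x) ^+ n.
Proof.
move=> /andP[x0 x1]; elim: n => [|n IH]; first by rewrite mul0r subr0 expr0.
rewrite exprS; apply: (@le_trans _ _ ((1 - x) * (1 - n%:R * x))).
  rewrite -natr1; have : 0 <= n%:R * x * x by rewrite !mulr_ge0.
  lra.
by rewrite ler_wpM2l//; lra.
Qed.

Lemma bernoulli_upper (x : R) n : 0 <= x <= 1 -> (1 - x) ^+ n * (n%:R * x) <= 1.
Proof.
move=> /andP[x0 x1].
have h : 1 + n%:R * x <= (1 + x) ^+ n.
  elim: n => [|n IH]; first by rewrite mul0r addr0 expr0.
  rewrite exprS; apply: (@le_trans _ _ ((1 + x) * (1 + n%:R * x))).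
    rewrite -natr1; have : 0 <= n%:R * x * x by rewrite !mulr_ge0.
    lra.
  by rewrite ler_wpM2l//; lra.
have e0 : 0 <= (1 - x) ^+ n by rewrite exprn_ge0//; lra.
apply: (@le_trans _ _ ((1 - x) ^+ n * (1 + x) ^+ n)).
  by rewrite ler_wpM2l//; lra.
by rewrite -exprMn exprn_ile1//; nra.
Qed.

(** For s < r < t the polynomial (1 - X^m)^N with N close to r^(-m) works: N
    z^m is small for z <= s and large for z >= t, and the two Bernoulli
    inequalities convert this into values close to 1 and to 0. *)
Lemma step_polynomial s t delta : 0 < s -> s < t -> t < 1 -> 0 < delta ->
  exists p : {poly R}, forall z, 0 <= z <= 1 ->
    [/\ 0 <= p.[z] <= 1, (z <= s -> 1 - delta <= p.[z]) & (t <= z -> p.[z] <= delta)].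
Proof.
move=> s0 st t1 d0.
have [r [sr rt]] : exists r, s < r /\ r < t by exists ((s + t) / 2); lra.
have r0 : 0 < r by lra.
have t0 : 0 < t by lra.
have sr0 : 0 <= s / r by rewrite divr_ge0// ltW.
have rt0 : 0 <= r / t by rewrite divr_ge0// ltW.
have hsr : (s / r) ^+ n @[n --> \oo] --> 0.
  by apply: cvg_expr; rewrite ger0_norm// ltr_pdivrMr// mul1r.
have hrt : (r / t) ^+ n @[n --> \oo] --> 0.
  by apply: cvg_expr; rewrite ger0_norm// ltr_pdivrMr// mul1r.
have d2 : 0 < delta / 2 by lra.
have n1 := cvgr_le _ hsr _ d2.
have n2 := cvgr_le _ hrt _ d0.
near \oo => m.
have m1 : (s / r) ^+ m <= delta / 2 by near: m; exact: n1.
have m2 : (r / t) ^+ m <= delta by near: m; exact: n2.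
have rm0 : 0 < r ^+ m by exact: exprn_gt0.
pose N := (Num.truncn (r ^- m)).+1.
have N1 : r ^- m <= N%:R by exact: ltW (truncnS_gt _).
have rm1 : r ^+ m <= 1 by rewrite exprn_ile1//; lra.
have N2 : N%:R <= 2 * r ^- m.
  have h : 1 <= r ^- m by rewrite invf_ge1.
  have := @truncn_le R (r ^- m); rewrite invr_ge0 (ltW rm0) => /= h2.
  by rewrite /N -natr1; lra.
exists ((1 - 'X^m) ^+ N) => z /andP[z0 z1].
rewrite horner_exp hornerD hornerN hornerC hornerXn.
have zm : 0 <= z ^+ m <= 1 by rewrite exprn_ge0// exprn_ile1.
have /andP[zm0 zm1] := zm.
split.
- by rewrite exprn_ge0 ?exprn_ile1//; lra.
- move=> zs; apply: le_trans (bernoulli_lower N zm).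
  have h : N%:R * z ^+ m <= 2 * (s / r) ^+ m.
    apply: (@le_trans _ _ (2 * r ^- m * s ^+ m)).
      by apply: ler_pM => //; apply: lerXn2r; rewrite ?nnegrE//; lra.
    rewrite exprMn exprVn.
    by have -> : 2 * r ^- m * s ^+ m = 2 * (s ^+ m * r ^- m) by ring.
  lra.
- move=> tz; have := bernoulli_upper N zm.
  have tm0 : 0 < t ^+ m by exact: exprn_gt0.
  have h : t ^+ m / r ^+ m <= N%:R * z ^+ m.
    have tz' : t ^+ m <= z ^+ m by apply: lerXn2r; rewrite ?nnegrE//; lra.
    have ri : 0 <= r ^- m by rewrite invr_ge0 ltW.
    by rewrite mulrC; apply: ler_pM => //; exact: ltW.
  set q := (1 - z ^+ m) ^+ N; have q0 : 0 <= q by rewrite exprn_ge0//; lra.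
  move=> hq; apply: le_trans m2.
  have hq2 : q * (t ^+ m / r ^+ m) <= 1 by apply: le_trans hq; rewrite ler_wpM2l.
  rewrite exprMn exprVn ler_pdivlMr//.
  by move: hq2; rewrite mulrA ler_pdivrMr// mul1r.
Unshelve. all: by end_near. Qed.

Lemma cvg_functional_poly (J : nat -> (R -> R) -> R) (L : (R -> R) -> R) (p : {poly R}) :
  (forall n, positive_functional (J n)) -> positive_functional L ->
  (forall k, J n (fun z => z ^+ k) @[n --> \oo] --> L (fun z => z ^+ k)) ->
  J n (fun z => p.[z]) @[n --> \oo] --> L (fun z => p.[z]).
Proof.
move=> pJ pL hm.
have -> : (fun z => p.[z]) = partial_poly (fun i => p`_i) (size p).
  by apply/funext => z; rewrite /partial_poly horner_coef.
elim: (size p) => [|m IH].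
  rewrite (_ : partial_poly _ 0 = fun=> 0).
    by under eq_fun do rewrite functional0//; rewrite functional0//; exact: cvg_cst.
  by apply/funext => z; rewrite /partial_poly big_ord0.
rewrite partial_polyS//; under eq_fun do rewrite partial_polyS//.
by apply: cvgD => //; apply: cvgM => //; exact: cvg_cst.
Qed.

Lemma functional_add_cst J f c : positive_functional J -> bounded01 f ->
  J (fun z => f z + c) = J f + c * J (fun=> 1).
Proof.
move=> pJ bf; rewrite addrC -(functionalD pJ)//; last exact: bounded01_cst.
by congr J; apply/funext => z; rewrite mulr1 addrC.
Qed.

(** Method of moments. Polynomial steps falling between r and t and between s
    and r enclose the indicator, and they differ by no more than the mass that
    the limit puts around r. *)
Lemma cvg_functional_tail (J : nat -> (R -> R) -> R) (L : (R -> R) -> R) r :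
  (forall n, positive_functional (J n)) -> positive_functional L ->
  (forall k, J n (fun z => z ^+ k) @[n --> \oo] --> L (fun z => z ^+ k)) ->
  (forall e, 0 < e -> exists s t, [/\ 0 < s, s < r, r < t, t < 1 &
     L (fun z => (z <= t)%R%:R) - L (fun z => (z <= s)%R%:R) <= e]) ->
  J n (fun z => (z <= r)%R%:R) @[n --> \oo] --> L (fun z => (z <= r)%R%:R).
Proof.
move=> pJ pL hm hc.
have h1 : J n (fun=> 1) @[n --> \oo] --> L (fun=> 1).
  have E : (fun z : R => z ^+ 0) = (fun=> 1) by apply/funext => z; rewrite expr0.
  by have := hm 0%N; rewrite E.
apply/cvgrPdist_le => e e0.
have L10 : 0 <= L (fun=> 1).
  rewrite -(functional0 pL); apply: (functional_le pL); [exact: bounded01_cst|exact: bounded01_cst|by []].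
pose delta := e / (8 * (1 + L (fun=> 1))).
have d0 : 0 < delta by rewrite divr_gt0// mulr_gt0//; lra.
have dL : delta * (1 + L (fun=> 1)) = e / 8.
  by rewrite /delta; field; rewrite gt_eqF//; lra.
have e4 : 0 < e / 4 by lra.
have [s [t [s0 sr rt t1 st]]] := hc _ e4.
have r0 : 0 < r by lra.
have [p1 hp1] := step_polynomial r0 rt t1 d0.
have r1 : r < 1 by lra.
have [p2 hp2] := step_polynomial s0 sr r1 d0.
have bp p := bounded01_horner p; have bl := bounded01_le.
have bc f c : bounded01 f -> bounded01 (fun z => f z + c).
  move=> bf; rewrite (_ : (fun _ => _) = (fun z => 1 * f z + c)).
    by apply: bounded01D => //; exact: bounded01_cst.
  by apply/funext => z; rewrite mul1r.
have key M : positive_functional M -> forall a b p, (a < b) ->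
   (forall z, 0 <= z <= 1 -> [/\ 0 <= p.[z] <= 1, (z <= a -> 1 - delta <= p.[z]) & (b <= z -> p.[z] <= delta)]) ->
   M (fun z => (z <= a)%R%:R) <= M (fun z => p.[z]) + delta * M (fun=> 1) /\
   M (fun z => p.[z]) <= M (fun z => (z <= b)%R%:R) + delta * M (fun=> 1).
  move=> pM a b p ab hp; split; rewrite -functional_add_cst//.
    apply: functional_le => //; first exact: bc.
    move=> z /hp[/andP[p0 p1'] pa _]; have [/pa|] := leP z a => /= ?; lra.
  apply: functional_le => //; first exact: bc.
  move=> z /hp[/andP[p0 p1'] _ pb]; have [|/ltW/pb] := leP z b => /= ?; lra.
have L11 : L (fun=> 1) < L (fun=> 1) + 1 by lra.
have hJ1 := cvgr_le _ h1 _ L11.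
have d8 : 0 < e / 8 by lra.
have c1 := (cvgrPdist_le _ _).1 (cvg_functional_poly (p := p1) pJ pL hm) _ d8.
have c2 := (cvgrPdist_le _ _).1 (cvg_functional_poly (p := p2) pJ pL hm) _ d8.
near=> n.
have q1 : `|L (fun z => p1.[z]) - J n (fun z => p1.[z])| <= e / 8 by near: n; exact: c1.
have q2 : `|L (fun z => p2.[z]) - J n (fun z => p2.[z])| <= e / 8 by near: n; exact: c2.
have q3 : J n (fun=> 1) <= L (fun=> 1) + 1.
  by near: n; exact: hJ1.
have [a1 _] := key _ (pJ n) _ _ _ rt hp1.
have [_ a2] := key _ pL _ _ _ rt hp1.
have [_ a3] := key _ (pJ n) _ _ _ sr hp2.
have [a4 _] := key _ pL _ _ _ sr hp2.
have m1 : L (fun z => (z <= s)%R%:R) <= L (fun z => (z <= r)%R%:R).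
  apply: (functional_le pL) => // z _; have [zs|_] := leP z s => //.
  by rewrite (le_trans zs (ltW sr)).
have m2 : L (fun z => (z <= r)%R%:R) <= L (fun z => (z <= t)%R%:R).
  apply: (functional_le pL) => // z _; have [zr|_] := leP z r => //.
  by rewrite (le_trans zr (ltW rt)).
have q4 : delta * J n (fun=> 1) <= e / 8 by rewrite -dL ler_wpM2l// ?(ltW d0)// addrC.
have q5 : delta * L (fun=> 1) <= e / 8 by rewrite -dL ler_wpM2l// ?(ltW d0)//; lra.
move: q1 q2; rewrite !ler_norml => /andP[? ?] /andP[? ?].
apply/andP; split; lra.
Unshelve. all: by end_near. Qed.

End MomentMethod.

(** * The limit law *)

Section Maxwell.
Context {R : realType}.
Local Notation mu := (@lebesgue_measure R).
Implicit Types h u v : R.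

(** The Gaussian density of standard deviation h without its normalising
    factor. *)
Definition bell h u : R := expR (- (u ^+ 2 / (2 * h ^+ 2))).

Lemma bell_ge0 h u : 0 <= bell h u. Proof. exact: expR_ge0. Qed.

Lemma is_derive_bell h u : h != 0 -> is_derive u 1 (bell h) (- (u / h ^+ 2) * bell h u).
Proof.
move=> h0; rewrite /bell; apply: is_derive_eq.
rewrite /GRing.scale/=; field.
done.
Qed.

Lemma continuous_bell h : continuous (bell h).
Proof.
move=> u; apply: continuous_comp; last exact: continuous_expR.
apply: cvgN; apply: cvgM; last exact: cvg_cst.
exact: exprn_continuous.
Qed.

Lemma measurable_bell h : measurable_fun setT (bell h).
Proof. exact: continuous_measurable_fun (@continuous_bell h). Qed.

Lemma integral_bell h : 0 < h ->
  (\int[mu]_(u in `[0%R, +oo[) (bell h u)%:E = (h * Num.sqrt (2 * pi) / 2)%:E)%E.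
Proof.
move=> h0; have hn0 : h != 0 by rewrite gt_eqF.
have p0 : 0 < pi :> R := pi_gt0 R.
have sq : Num.sqrt (h ^+ 2 * pi *+ 2) = h * Num.sqrt (2 * pi).
  have -> : h ^+ 2 * pi *+ 2 = h ^+ 2 * (2 * pi) by rewrite -mulr_natl; ring.
  by rewrite sqrtrM ?sqr_ge0// sqrtr_sqr gtr0_norm.
have sq0 : 0 < h * Num.sqrt (2 * pi) by rewrite mulr_gt0// sqrtr_gt0 mulr_gt0.
have E : (\int[mu]_u (bell h u)%:E = (h * Num.sqrt (2 * pi))%:E)%E.
  have nE u : normal_pdf 0 h u = (h * Num.sqrt (2 * pi))^-1 * bell h u.
    rewrite normal_pdfE// /normal_peak sq /normal_fun subr0 /bell mulNr.
    by rewrite -[h ^+ 2 *+ 2]mulr_natl.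
  have := @integral_normal_pdf R 0 h.
  under eq_integral do rewrite nE EFinM.
  rewrite ge0_integralZl_EFin//; first last.
  - by rewrite invr_ge0 ltW.
  - by apply/measurable_EFinP; exact: measurable_bell.
  - by move=> u _; rewrite lee_fin bell_ge0.
  move=> H; have := congr1 (fun t => ((h * Num.sqrt (2 * pi))%:E * t)%E) H.
  by rewrite muleA -EFinM mulfV ?gt_eqF// mul1e mule1.
have := @ge0_symfun_integralT R (bell h) (bell_ge0 h) (@continuous_bell h).
rewrite E -set_itvcy => /(_ _) H.
have {}H := H (fun u => congr1 (fun t => expR (- (t / (2 * h ^+ 2)))) (esym (sqrrN u))).
have := congr1 (fun t => ((1/2)%:E * t)%E) H.
rewrite muleA -!EFinM (_ : 1 / 2 * 2 = 1 :> R); last by lra.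
by rewrite mul1e => <-; congr EFin; ring.
Qed.

(** Integration by parts: u * bell h u is the derivative of - h^2 * bell h u.
    *)
Lemma integral_sqr_bell h : 0 < h ->
  (\int[mu]_(u in `[0%R, +oo[) (u ^+ 2 * bell h u)%:E =
   (h ^+ 3 * Num.sqrt (2 * pi) / 2)%:E)%E.
Proof.
move=> h0; have hn0 : h != 0 by rewrite gt_eqF.
have cb := @continuous_bell h.
have parts n : (\int[mu]_(u in `[0%R, n.+1%:R]) (u ^+ 2 * bell h u)%:E =
   (- (h ^+ 2 * (n.+1%:R * bell h n.+1%:R)))%:E +
   (h ^+ 2)%:E * \int[mu]_(u in `[0%R, n.+1%:R]) (bell h u)%:E)%E.
  have n0 : 0 < n.+1%:R :> R by rewrite ltr0n.
  have := @integration_by_parts R id (fun u => - h ^+ 2 * bell h u) (fun=> 1)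
     (fun u => u * bell h u) 0 n.+1%:R n0.
  rewrite (_ : (fun x => (id x * (x * bell h x))%:E) = (fun u => (u ^+ 2 * bell h u)%:E)); last first.
    by apply/funext => u; rewrite mulrA expr2.
  move=> ->.
  - rewrite mul0r subr0; congr (_ + _)%E; first by congr EFin; ring.
    under eq_integral do rewrite mul1r mulNr EFinN EFinM.
    rewrite integral_ge0N; last by move=> u _; rewrite mule_ge0// lee_fin ?sqr_ge0 ?bell_ge0.
    rewrite oppeK ge0_integralZl_EFin// ?sqr_ge0//.
    + by move=> u _; rewrite lee_fin bell_ge0.
    + by apply/measurable_EFinP; apply: (measurable_funS measurableT) => //; exact: measurable_bell.
  - by apply: continuous_subspaceT => u; exact: cst_continuous.
  - split; [by move=> u _; exact: derivable_id|exact: cvg_at_right_filter|exact: cvg_at_left_filter].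
  - by move=> u _; rewrite derive1E derive_id.
  - by apply: continuous_subspaceT => u; apply: cvgM => //; exact: cb.
  - split.
    + move=> t _; have [Dt _] := is_derive_bell t hn0.
      by apply: derivableM.
    + by apply: cvg_at_right_filter; apply: cvgM; [exact: cvg_cst|exact: cb].
    + by apply: cvg_at_left_filter; apply: cvgM; [exact: cvg_cst|exact: cb].
  - move=> u _; rewrite derive1E.
    have Db := is_derive_bell u hn0.
    by rewrite derive_val /GRing.scale/=; field.
have mb : measurable_fun setT (bell h) := measurable_bell h.
have c1 := @ge0_cvgn_integral R mu (bell h) (bell_ge0 h) mb.
have msb : measurable_fun setT (fun u => u ^+ 2 * bell h u).
  by apply: measurable_funM => //; exact: measurable_funX.
have c2 := @ge0_cvgn_integral R mu (fun u => u ^+ 2 * bell h u)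
   (fun u => mulr_ge0 (sqr_ge0 u) (bell_ge0 h u)) msb.
move: c1 c2; rewrite -cvg_shiftS -(cvg_shiftS (fun n => \int[mu]_(x in `[0%R, n%:R]) (x ^+ 2 * bell h x)%:E)%E).
rewrite integral_bell// => c1 c2.
have c3 : (- (h ^+ 2 * (n.+1%:R * bell h n.+1%:R))) @[n --> \oo] --> (0 : R).
  rewrite -oppr0 -[X in - X](mulr0 (h ^+ 2)); apply: cvgN; apply: cvgM; first exact: cvg_cst.
  apply: (@squeeze_cvgr _ _ _ _ (fun=> 0) (fun n => 2 * h ^+ 2 * n.+1%:R^-1)).
  - apply: nearW => n; have n0 : 0 < n.+1%:R :> R by rewrite ltr0n.
    rewrite mulr_ge0 ?bell_ge0//=.
    have h2 : 0 < 2 * h ^+ 2 by rewrite mulr_gt0// exprn_gt0.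
    have q0 : 0 < n.+1%:R ^+ 2 / (2 * h ^+ 2) by rewrite divr_gt0// exprn_gt0.
    have b1 : bell h n.+1%:R <= (n.+1%:R ^+ 2 / (2 * h ^+ 2))^-1.
      rewrite /bell expRN lef_pV2 ?posrE ?expR_gt0//.
      by apply: le_trans (expR_ge1Dx _); rewrite lerDr.
    apply: le_trans (ler_wpM2l (ltW n0) b1) _.
    rewrite le_eqVlt; apply/orP; left; apply/eqP; field.
    by rewrite hn0 gt_eqF.
  - exact: cvg_cst.
  - rewrite -[X in _ --> X](mulr0 (2 * h ^+ 2)); apply: cvgM; first exact: cvg_cst.
    exact: cvg_harmonic.
have c4 : (\int[mu]_(u in `[0%R, n.+1%:R]) (u ^+ 2 * bell h u)%:E)%E @[n --> \oo] -->
    (0%:E + (h ^+ 2)%:E * (h * Num.sqrt (2 * pi) / 2)%:E)%E.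
  under eq_fun do rewrite parts.
  apply: cvgeD => //; first by apply: cvg_EFin => //; exact: nearW.
  by apply: cvgeZl.
rewrite (cvg_unique _ c2 c4)// add0e -EFinM; congr EFin; ring.
Qed.

Definition maxwell u : R := Num.sqrt (2 / pi) * (u ^+ 2 * bell 1 u).

Lemma maxwell_ge0 u : 0 <= maxwell u.
Proof. by rewrite /maxwell mulr_ge0// ?sqrtr_ge0// mulr_ge0 ?sqr_ge0 ?bell_ge0. Qed.

Lemma measurable_maxwell : measurable_fun setT maxwell.
Proof.
apply: measurable_funM => //; apply: measurable_funM; first exact: measurable_funX.
exact: measurable_bell.
Qed.

(** Integration against the law of exp(- U^2), where U has the density
    maxwell. *)
Definition maxwell_functional (f : R -> R) : R :=
  \int[mu]_(u in `[0%R, +oo[) (maxwell u * f (expR (- u ^+ 2))).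

(** A power of exp(- u^2) only changes the width of the bell, so that the
    moment is a ratio of two Gaussian integrals. *)
Lemma maxwell_moment k :
  (\int[mu]_(u in `[0%R, +oo[) (maxwell u * expR (- u ^+ 2) ^+ k)%:E =
  (heat_factor k%:R ^+ 3)%:E)%E.
Proof.
set h := heat_factor k%:R.
have h0 : 0 < h by rewrite heat_factor_gt0.
have h2 : h ^+ 2 * (1 + 2 * k%:R) = 1 by rewrite heat_factor_sqr.
have k0 : 0 < 1 + 2 * k%:R :> R by have := ler0n R k; lra.
have E u : maxwell u * expR (- u ^+ 2) ^+ k = Num.sqrt (2 / pi) * (u ^+ 2 * bell h u).
  rewrite /maxwell /bell -[LHS]mulrA -[X in _ * X = _]mulrA; congr (_ * (_ * _)).
  rewrite -expRM_natl -expRD; congr expR.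
  have -> : h ^+ 2 = (1 + 2 * k%:R)^-1.
    by apply: (mulIf (lt0r_neq0 k0)); rewrite h2 mulVf// gt_eqF.
  by field; rewrite gt_eqF.
under eq_integral do rewrite E EFinM.
have s0 : 0 <= Num.sqrt (2 / pi) :> R by exact: sqrtr_ge0.
rewrite ge0_integralZl_EFin//; first last.
- apply/measurable_EFinP; apply: (measurable_funS measurableT) => //.
  by apply: measurable_funM; [exact: measurable_funX|exact: measurable_bell].
- by move=> u _; rewrite lee_fin mulr_ge0 ?sqr_ge0 ?bell_ge0.
rewrite integral_sqr_bell// -EFinM; congr EFin.
have p0 := pi_gt0 R.
have -> : Num.sqrt (2 / pi) * (h ^+ 3 * Num.sqrt (2 * pi) / 2) =
   h ^+ 3 * (Num.sqrt (2 / pi) * Num.sqrt (2 * pi)) / 2 by field.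
rewrite -sqrtrM; last by rewrite divr_ge0// ltW.
have pn : pi != 0 :> R by rewrite gt_eqF.
have hq (q : R) : q != 0 -> 2 / q * (2 * q) = 2 ^+ 2 by move=> ?; field.
rewrite hq//.
by rewrite sqrtr_sqr ger0_norm//; field.
Qed.

Lemma integrable_maxwell : mu.-integrable `[0%R, +oo[ (EFin \o maxwell).
Proof.
apply/integrableP; split.
  apply/measurable_EFinP; apply: (measurable_funS measurableT) => //.
  exact: measurable_maxwell.
apply: (@le_lt_trans _ _ (\int[mu]_(u in `[0%R, +oo[) (maxwell u * expR (- u ^+ 2) ^+ 0)%:E)%E).
  rewrite le_eqVlt; apply/orP; left; apply/eqP; apply: eq_integral => u _.
  by rewrite /= expr0 mulr1 ger0_norm// maxwell_ge0.
by rewrite maxwell_moment ltry.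
Qed.

Lemma maxwell_positive : positive_functional maxwell_functional.
Proof.
apply: positive_functional_Rintegral => //.
- exact: integrable_maxwell.
- by move=> u _; exact: maxwell_ge0.
- apply: (measurable_funS measurableT) => //.
  apply: measurableT_comp => //; apply: measurable_funN; exact: measurable_funX.
- by move=> u _; rewrite expR_ge0 expR_le1 oppr_le0 sqr_ge0.
Qed.

Lemma maxwell_functional_exprn k :
  maxwell_functional (fun z => z ^+ k) = heat_factor k%:R ^+ 3.
Proof. by rewrite /maxwell_functional /Rintegral maxwell_moment. Qed.

Lemma expR_sqr_le v u : 0 <= v -> 0 <= u -> (expR (- u ^+ 2) <= expR (- v ^+ 2)) = (v <= u).
Proof. by move=> v0 u0; rewrite ler_expR lerN2 ler_pXn2r. Qed.

Lemma maxwell_tail v : 0 < v ->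
  ((Num.sqrt (2 / pi))%:E *
    \int[mu]_(u in `[v, +oo[) (u ^+ 2 * expR (- (u ^+ 2 / 2)))%:E)%E =
  (maxwell_functional (fun z => (z <= expR (- v ^+ 2))%R%:R))%:E.
Proof.
move=> v0; have s0 : 0 <= Num.sqrt (2 / pi) :> R by exact: sqrtr_ge0.
have mm : measurable_fun setT (fun u => u ^+ 2 * bell 1 u).
  by apply: measurable_funM; [exact: measurable_funX|exact: measurable_bell].
transitivity ((Num.sqrt (2 / pi))%:E * \int[mu]_(u in `[v, +oo[) (u ^+ 2 * bell 1 u)%:E)%E.
  by congr (_ * _)%E; apply: eq_integral => u _; rewrite /bell expr1n mulr1.
rewrite -ge0_integralZl_EFin//; first last.
- by apply/measurable_EFinP; exact: (measurable_funS measurableT).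
- by move=> u _; rewrite lee_fin mulr_ge0 ?sqr_ge0 ?bell_ge0.
have E : (\int[mu]_(u in `[v, +oo[) ((Num.sqrt (2 / pi))%:E * (u ^+ 2 * bell 1 u)%:E) =
  \int[mu]_(u in `[0%R, +oo[) (maxwell u * (expR (- u ^+ 2) <= expR (- v ^+ 2))%R%:R)%:E)%E.
  rewrite [LHS]integral_mkcond [RHS]integral_mkcond; apply: eq_integral => u _.
  rewrite !patchE !mem_setE !in_itv/= !andbT.
  have [vu|uv] := leP v u; have [u0|u0] := leP 0 u => //.
  - by rewrite expR_sqr_le ?(ltW v0)// vu mulr1 -EFinM.
  - by have := le_trans (ltW v0) vu; rewrite leNgt u0.
  - by rewrite expR_sqr_le ?(ltW v0)// leNgt uv mulr0.
rewrite E /maxwell_functional /Rintegral fineK//.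
have b := bounded01_le (expR (- v ^+ 2)).
rewrite ge0_fin_numE; last first.
  by apply: integral_ge0 => u _; rewrite lee_fin mulr_ge0 ?maxwell_ge0.
have /integrableP[mx hx] := integrable_maxwell.
apply: le_lt_trans hx; apply: ge0_le_integral => //.
- by move=> u _; rewrite lee_fin mulr_ge0 ?maxwell_ge0.
- apply/measurable_EFinP; apply: (measurable_funS measurableT) => //.
  apply: measurable_funM; first exact: measurable_maxwell.
  apply: (measurableT_comp (proj1 b)).
  apply: measurableT_comp => //; apply: measurable_funN; exact: measurable_funX.
- by apply: measurableT_comp.
- move=> u _; rewrite /= lee_fin ger0_norm ?maxwell_ge0//.
  rewrite ler_piMr ?maxwell_ge0//.
  by case: (expR (- u ^+ 2) <= expR (- v ^+ 2)).
Qed.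

Lemma maxwell_le u : maxwell u <= 2 * Num.sqrt (2 / pi).
Proof.
rewrite mulrC /maxwell ler_wpM2l ?sqrtr_ge0// /bell expr1n mulr1 expRN ler_pdivrMr ?expR_gt0//.
have := expR_ge1Dx (u ^+ 2 / 2); lra.
Qed.

(** The density maxwell is bounded, so short intervals around v have small
    mass. *)
Lemma maxwell_continuity v e : 0 < v -> 0 < e -> exists s t,
  [/\ 0 < s, s < expR (- v ^+ 2), expR (- v ^+ 2) < t, t < 1 &
   maxwell_functional (fun z => (z <= t)%R%:R) -
   maxwell_functional (fun z => (z <= s)%R%:R) <= e].
Proof.
move=> v0 e0; set C := 2 * Num.sqrt (2 / pi) : R.
have C0 : 0 <= C by rewrite /C mulr_ge0// sqrtr_ge0.
pose eta := Num.min (v / 2) (e / (2 * (1 + C))).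
have eta0 : 0 < eta by rewrite lt_min !divr_gt0// mulr_gt0//; lra.
have eta1 : eta <= v / 2 by rewrite ge_min lexx.
have eta2 : C * (2 * eta) <= e.
  have h : eta <= e / (2 * (1 + C)) by rewrite ge_min lexx orbT.
  have h1 : 0 < 2 * (1 + C) by lra.
  move: h; rewrite ler_pdivlMr// => h; nra.
have mono (a b : R) : 0 <= a -> a < b -> expR (- b ^+ 2) < expR (- a ^+ 2).
  move=> a0 ab; rewrite ltr_expR ltrN2 ltr_pXn2r// nnegrE//; lra.
exists (expR (- (v + eta) ^+ 2)), (expR (- (v - eta) ^+ 2)); split.
- exact: expR_gt0.
- by apply: mono; lra.
- by apply: mono; lra.
- by rewrite expR_lt1 oppr_lt0 exprn_gt0//; lra.
have pm := maxwell_positive.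
set t := expR (- (v - eta) ^+ 2); set s := expR (- (v + eta) ^+ 2).
have bt := bounded01_le t; have bs := bounded01_le s.
have -> : maxwell_functional (fun z => (z <= t)%R%:R) - maxwell_functional (fun z => (z <= s)%R%:R) =
   maxwell_functional (fun z => -1 * (z <= s)%R%:R + (z <= t)%R%:R).
  by rewrite (functionalD pm)//; ring.
apply: le_trans eta2.
have bst : bounded01 (fun z => -1 * (z <= s)%R%:R + (z <= t)%R%:R) by exact: bounded01D.
rewrite /maxwell_functional.
set I := `[v - eta, v + eta]%classic.
have mI : measurable I by exact: measurable_itv.
have muI : mu I = (2 * eta)%:E.
  rewrite lebesgue_measure_itv/= lte_fin ifT; last by lra.
  by rewrite -EFinD; congr EFin; ring.
have iI1 : mu.-integrable `[0%R, +oo[ (EFin \o (\1_I : R -> R)).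
  apply/integrableP; split.
    by apply/measurable_EFinP; apply: (measurable_funS measurableT) => //; exact: measurable_indic.
  under eq_integral do rewrite gee0_abs ?lee_fin//.
  rewrite integral_indic//; apply: (@le_lt_trans _ _ (mu I)); last by rewrite muI ltry.
  by apply: le_measure; rewrite ?inE//; first [exact: measurableI|exact: subIsetl].
have m0y : measurable (`[0%R, +oo[%classic : set R) by exact: measurable_itv.
have iI : mu.-integrable `[0%R, +oo[ (EFin \o (fun u => C * \1_I u)).
  rewrite (_ : EFin \o _ = (fun u => C%:E * (EFin \o \1_I) u)%E); last by apply/funext.
  by apply: integrableZl => //.
have iL : mu.-integrable `[0%R, +oo[
   (EFin \o (fun u => maxwell u * (-1 * (expR (- u ^+ 2) <= s)%R%:R + (expR (- u ^+ 2) <= t)%R%:R))).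
  apply: (@le_integrable _ _ _ mu _ _ _ (fun u => 2%:E * (maxwell u)%:E)%E) => //.
  - apply/measurable_EFinP; apply: (measurable_funS measurableT) => //.
    apply: measurable_funM; first exact: measurable_maxwell.
    apply: (measurableT_comp (proj1 bst)).
    apply: measurableT_comp => //; apply: measurable_funN; exact: measurable_funX.
  - move=> u; rewrite /= in_itv/= andbT => u0.
    rewrite lee_fin normrM [`|maxwell u|]ger0_norm ?maxwell_ge0//.
    have m0 : 0 <= maxwell u by exact: maxwell_ge0.
    rewrite [leRHS]ger0_norm; last exact: mulr_ge0.
    rewrite mulrC ler_wpM2r ?maxwell_ge0//.
    case: (_ <= s); case: (_ <= t) => /=; rewrite ler_norml; apply/andP; split; lra.
  - by apply: integrableZl => //; exact: integrable_maxwell.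
apply: (@le_trans _ _ (\int[mu]_(u in `[0%R, +oo[) (C * \1_I u))).
  apply: le_Rintegral => // u; rewrite /= in_itv/= andbT => u0.
  rewrite /t /s !expR_sqr_le//; [|lra|lra].
  have m1 := maxwell_le u; have m0 := maxwell_ge0 u; rewrite -/C in m1.
  rewrite indicE mem_setE in_itv/=.
  have [a1|a1] := leP (v + eta) u; have [a2|a2] := leP (v - eta) u => /=;
   rewrite ?mulr1 ?mulr0 ?mul0r.
  - have -> : -1 + 1 = 0 :> R by ring.
    by rewrite mulr0 mulr_ge0.
  - lra.
  - by rewrite (ltW a1) /= add0r mulr1 mulr1.
  - by rewrite addr0 mulr0.
rewrite RintegralZl// ler_wpM2l// /Rintegral integral_indic//.
have hle : (mu (I `&` `[0%R, +oo[) <= (2 * eta)%:E)%E.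
  by rewrite -muI; apply: le_measure; rewrite ?inE//; first [exact: measurableI|exact: subIsetl].
rewrite -lee_fin fineK// ge0_fin_numE//.
by apply: le_lt_trans hle _; rewrite ltry.
Qed.

End Maxwell.

(** * Overshoots and survival time of the chain *)

Local Open Scope ereal_scope.

Lemma lee_add_step {R : realType} (a b c e s t : \bar R) :
  a + b <= c + e -> c + s <= t -> a + (s + b) <= t + e.
Proof.
move=> abce cst; rewrite addeCA; apply: le_trans (leeD (lexx s) abce) _.
by rewrite addeA (addeC s); exact: leeD.
Qed.

Section DominatedChain.
Context {d : measure_display} {Omega : measurableType d} {R : realType}.
Context {K : R.-pker R ~> R} {Px : R -> probability Omega R}
  {X : nat -> {mfun Omega >-> R}}.
Hypothesis X_markov : markov_chain K Px X.
Context {dY : measure_display} {TY : measurableType dY}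
  {PY : probability TY R} {Y : {RV PY >-> R}}.
Hypothesis Y_sq : \int[PY]_w (Y w ^+ 2)%:E < +oo.
(* nu y is the law of the jump from y. *)
Context {nu : R -> probability R R}.
Hypothesis nu_mean : forall y, \int[nu y]_s s%:E = 0.
Hypothesis nu_var : forall y, \int[nu y]_s (s ^+ 2)%:E = 1.
Hypothesis nu_tail : forall y s : R, (0 <= s)%R ->
  nu y [set t | (s < `|t|)%R] <= PY [set w | (s < Y w)%R].
Hypothesis K_nu : forall y (f : R -> \bar R), measurable_fun setT f ->
  (forall t, 0 <= f t) -> \int[K y]_t f t = \int[nu y]_s f (y + s)%R.
Local Notation alive := (alive X).

Lemma integral_sqr_above_le y B : (0 <= B)%R ->
  \int[nu y]_s (sqr_above B s)%:E <= excess Y B.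
Proof.
move=> B0; apply: expectation_le_tail.
- exact: measurable_sqr_above.
- by apply: measurableT_comp => //; exact: measurable_sqr_above.
- by move=> w; exact: sqr_above_ge0.
- by move=> w; exact: sqr_above_ge0.
move=> s s0; under eq_set do rewrite sqr_above_gt//.
under [in leRHS]eq_set do rewrite sqr_above_gt//.
apply: le_trans (nu_tail _ _) _; first by rewrite le_max B0.
apply: le_measure; rewrite ?inE.
- exact: measurable_tail.
- rewrite (_ : mkset _ = [set w | (Num.max B (Num.sqrt s) < (fun z => `|Y z|) w)%R])//.
  rewrite -[X in measurable X]setTI; apply: measurable_fun_ltr => //.
  by apply: measurableT_comp => //; exact: normr_measurable.
- by move=> w /= h; rewrite (lt_le_trans h)// ler_norm.
Qed.

Lemma measurable_kernel_integral f : measurable_fun setT f -> (forall t, 0 <= f t) ->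
  measurable_fun setT (fun y => \int[K y]_t f t).
Proof.
move=> mf f0; apply: measurable_fun_integral_kernel => //.
exact: measurable_kernel.
Qed.

Lemma alive_step x n (f : R -> \bar R) : measurable_fun setT f -> (forall t, 0 <= f t) ->
  \int[Px x]_(w in alive n) f (X n.+1 w) =
  \int[Px x]_(w in alive n) \int[K (X n w)]_t f t.
Proof.
move=> mf f0; rewrite (ge0_integral_markov_step X_markov)//.
- exact: natural_filtration_alive.
- exact: measurable_alive.
Qed.

Lemma le_integral_alive x n (f g : R -> \bar R) :
  measurable_fun setT f -> (forall t, 0 <= f t) ->
  measurable_fun setT g -> (forall y, (0 < y)%R -> f y <= g y) ->
  \int[Px x]_(w in alive n) f (X n w) <= \int[Px x]_(w in alive n) g (X n w).
Proof.
move=> mf f0 mg fg.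
apply: ge0_le_integral => //.
- exact: measurable_alive.
- exact: measurable_alive_fun.
- exact: measurable_alive_fun.
- by move=> w aw; apply: fg; exact: alive_gt0.
Qed.

Lemma le_integral_aliveS x n (f : R -> \bar R) :
  measurable_fun setT f -> (forall t, 0 <= f t) ->
  \int[Px x]_(w in alive n.+1) f (X n.+1 w) <=
  \int[Px x]_(w in alive n) f (X n.+1 w).
Proof.
move=> mf f0; apply: ge0_subset_integral => //.
- exact: measurable_alive.
- exact: measurable_alive.
- exact: measurable_alive_fun.
- by rewrite aliveS; exact: subIsetl.
Qed.

Definition below (L : R) (n : nat) (x : R) : \bar R :=
  Px x (alive n `&` X n @^-1` `]-oo, L]).

(** The overshoot is counted from level - b because a large b makes it small.
    What lies between - b and 0 costs at most b once, since the chain dies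
    only once (mean_overshoot_le). *)
Definition undershoot (b : R) (n : nat) (x : R) : \bar R :=
  \int[Px x]_(w in alive n) (neg (X n.+1 w + b))%:E.

Section Lyapunov.
Variables (b L M : R).
Hypothesis b0 : (0 <= b)%R.
Hypothesis L0 : (0 <= L)%R.
Hypothesis M_def : M = (L + 2 * b)%R.
Hypothesis excessB : excess Y b <= (1/2)%:E.
Let M0 : (0 <= M)%R. Proof. by rewrite M_def; move: b0 L0 => ? ?; lra. Qed.

Let measurable_neg_shift (y : R) : measurable_fun setT (fun s : R => neg (y + s + b)%R).
Proof.
apply: (measurableT_comp (@measurable_negp R)).
by apply: measurable_funD => //; exact: measurable_funD.
Qed.

(** From y in (0, L] the window of width b around y + b stays inside [0, M],
    as M = L + 2 b. There the parabola gains half of the variance, less half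
    of the truncated square: 1/2 - 1/4. *)
Lemma cap_drift_jump y : (0 < y)%R ->
  \int[nu y]_s (cap M (y + s + b))%:E + (1/4 * (y <= L)%R%:R)%:E <=
  (cap M (y + b))%:E + M%:E * \int[nu y]_s (neg (y + s + b))%:E.
Proof.
move=> y0.
have mcap : measurable_fun setT (fun s : R => cap M (y + s + b)%R).
  by apply: (measurableT_comp (measurable_cap M b)); exact: measurable_funD.
have mneg := measurable_neg_shift y.
have intM : \int[nu y]_s (M * neg (y + s + b))%:E = M%:E * \int[nu y]_s (neg (y + s + b))%:E.
  rewrite -ge0_integralZl_EFin//.
  - by move=> s _; rewrite lee_fin neg_ge0.
  - exact/measurable_EFinP.
have Mneg0 s : (0 <= M * neg (y + s + b))%R by rewrite mulr_ge0 ?neg_ge0.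
have [yL|Ly] := leP y L; last first.
  rewrite mulr0 adde0 -intM -[X in X%:E + _](addr0 (cap M (y + b))).
  apply: (integral_quadratic_le (nu_mean y) (nu_var y) (b := (M - clamp M (y + b))%R)) => //.
  - exact: measurable_funM.
  - by move=> s; exact: cap_ge0.
  - move=> s; rewrite mul0r addr0 (_ : y + s + b = (y + b) + s)%R; last by ring.
    by apply: cap_tangent => //; have := b0; lra.
have h : \int[nu y]_s (cap M (y + s + b))%:E <=
    (cap M (y + b) + (- (1/2)))%:E +
    \int[nu y]_s (1/2 * sqr_above b s + M * neg (y + s + b))%:E.
  apply: (integral_quadratic_le (nu_mean y) (nu_var y) (b := (M - (y + b))%R)) => //.
  - apply: measurable_funD; last exact: measurable_funM.
    by apply: measurable_funM => //; exact: measurable_sqr_above.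
  - by move=> s; exact: cap_ge0.
  - by move=> s; apply: addr_ge0 => //; have := sqr_above_ge0 b s; lra.
  - move=> s; rewrite (_ : y + s + b = (y + b) + s)%R; last by ring.
    have := @cap_concave _ M b (y + b) s b0.
    by rewrite M_def => /(_ ltac:(lra) ltac:(lra)); lra.
apply: le_trans (leeD h (lexx _)) _.
under eq_integral do rewrite EFinD.
rewrite ge0_integralD//; last 4 first.
- by move=> s _; rewrite lee_fin; have := sqr_above_ge0 b s; lra.
- by apply/measurable_EFinP; apply: measurable_funM => //; exact: measurable_sqr_above.
- by move=> s _; rewrite lee_fin.
- by apply/measurable_EFinP; exact: measurable_funM.
rewrite intM.
under eq_integral do rewrite EFinM.
rewrite ge0_integralZl_EFin//; last 2 first.
- by move=> s _; rewrite lee_fin sqr_above_ge0.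
- by apply/measurable_EFinP; exact: measurable_sqr_above.
have : (1/2)%:E * \int[nu y]_s (sqr_above b s)%:E <= (1/4)%:E.
  rewrite (_ : (1/4)%:E = (1/2)%:E * (1/2)%:E); last by rewrite -EFinM; congr EFin; lra.
  apply: lee_wpmul2l; first by rewrite lee_fin; lra.
  exact: le_trans (integral_sqr_above_le y b0) excessB.
move=> e; rewrite [X in X + _ <= _]addeA [leLHS]addeAC; apply: leeD => //.
apply: le_trans (leeD (leeD (lexx _) e) (lexx _)) _.
by rewrite -!EFinD lee_fin (_ : true%:R = 1%R :> R)//; lra.
Qed.

Lemma measurable_indic_le : measurable_fun setT (fun y : R => (1/4 * (y <= L)%R%:R : R)%:E).
Proof.
apply/measurable_EFinP/measurable_funM => //.
rewrite (_ : (fun _ => _) = \1_(`]-oo, L]%classic)).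
  exact: measurable_indic.
by apply/funext => w; rewrite indicE mem_setE in_itv.
Qed.

Lemma belowE n x : (1/4)%:E * below L n x =
  \int[Px x]_(w in alive n) (1/4 * (X n w <= L)%R%:R)%:E.
Proof.
have mX : measurable (X n @^-1` `]-oo, L]).
  by rewrite -[X in measurable X]setTI; exact: measurable_funP.
rewrite /below setIC -integral_indic//; last exact: measurable_alive.
rewrite -ge0_integralZl_EFin//.
- apply: eq_integral => w _; rewrite indicE EFinM.
  by have -> : (w \in X n @^-1` `]-oo, L]) = (X n w <= L)%R
    by apply/idP/idP; rewrite inE /= in_itv.
- exact: measurable_alive.
- by apply/measurable_EFinP; apply: (measurable_funS measurableT) => //; exact: measurable_indic.
Qed.

Lemma cap_drift x n :
  \int[Px x]_(w in alive n.+1) (cap M (X n.+1 w + b))%:E + (1/4)%:E * below L n x <=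
  \int[Px x]_(w in alive n) (cap M (X n w + b))%:E + M%:E * undershoot b n x.
Proof.
have mcap : measurable_fun setT (fun y : R => (cap M (y + b))%:E).
  by apply/measurable_EFinP; exact: measurable_cap.
have cap0 y : 0 <= (cap M (y + b))%:E by rewrite lee_fin cap_ge0.
have mneg : measurable_fun setT (fun y : R => (neg (y + b))%:E).
  apply/measurable_EFinP; have := measurable_neg_shift 0.
  by under eq_fun do rewrite add0r.
have neg0 y : 0 <= (neg (y + b))%:E by rewrite lee_fin neg_ge0.
have mK1 := measurable_kernel_integral mcap cap0.
have mK2 := measurable_kernel_integral mneg neg0.
apply: le_trans (leeD (le_integral_aliveS _ _ mcap cap0) (lexx _)) _.
rewrite (alive_step _ _ mcap cap0) belowE /undershoot (alive_step _ _ mneg neg0).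
rewrite -ge0_integralZl_EFin//; last 3 first.
- exact: measurable_alive.
- by move=> w _; apply: integral_ge0.
- exact: measurable_alive_fun mK2.
rewrite -ge0_integralD; first last.
- exact: measurable_alive_fun measurable_indic_le.
- by move=> w _; rewrite lee_fin mulr_ge0//; lra.
- exact: measurable_alive_fun mK1.
- by move=> w _; apply: integral_ge0.
- exact: measurable_alive.
rewrite -ge0_integralD; first last.
- apply: measurable_funeM; exact: measurable_alive_fun mK2.
- by move=> w _; apply: mule_ge0; [rewrite lee_fin|exact: integral_ge0].
- exact: measurable_alive_fun mcap.
- by move=> w _.
- exact: measurable_alive.
apply: (@le_integral_alive _ _
  (fun y => \int[K y]_t (cap M (t + b))%:E + (1/4 * (y <= L)%R%:R)%:E)
  (fun y => (cap M (y + b))%:E + M%:E * \int[K y]_t (neg (t + b))%:E)).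
- apply: emeasurable_funD => //; exact: measurable_indic_le.
- by move=> y; apply: adde_ge0; [exact: integral_ge0|rewrite lee_fin mulr_ge0//; lra].
- by apply: emeasurable_funD => //; exact: measurable_funeM.
- by move=> y y0; rewrite !K_nu//; exact: cap_drift_jump.
Qed.

(** The drift inequality telescopes: the initial value of the Lyapunov
    function bounds the time spent in (0, L], up to the undershoots. *)
Lemma occupation_le x n : (0 < x)%R ->
  (1/4)%:E * \sum_(k < n) below L k x <=
  M%:E * ((x + b)%:E + \sum_(k < n) undershoot b k x).
Proof.
move=> x0.
have h : \int[Px x]_(w in alive n) (cap M (X n w + b))%:E + (1/4)%:E * \sum_(k < n) below L k x <=
  M%:E * ((x + b)%:E + \sum_(k < n) undershoot b k x).
  have u0 k : 0 <= undershoot b k x.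
    by apply: integral_ge0 => w _; rewrite lee_fin neg_ge0.
  elim: n => [|n IH].
    rewrite !big_ord0 mule0 !adde0.
    rewrite (@integral_alive0 _ _ _ _ _ _ X_markov x (fun y => (cap M (y + b))%:E))//.
    - by rewrite -EFinM lee_fin; apply: cap_le => //; have := b0; lra.
    - by apply/measurable_EFinP; exact: measurable_cap.
    - by move=> t; rewrite lee_fin cap_ge0.
  have bl0 k : 0 <= below L k x by exact: measure_ge0.
  rewrite !big_ord_recr/= ge0_muleDr//; last by apply: sume_ge0.
  rewrite [in leRHS]addeA [leRHS]ge0_muleDr//; last first.
    by rewrite adde_ge0// ?sume_ge0// lee_fin; move: b0 => ?; lra.
  exact: lee_add_step (cap_drift x n) IH.
apply: le_trans h; rewrite leeDr//.
by apply: integral_ge0 => w _; rewrite lee_fin cap_ge0.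
Qed.

End Lyapunov.

Lemma undershoot_le2 b n x : (0 <= b)%R -> undershoot b n x <= 2%:E.
Proof.
move=> b0.
have mneg : measurable_fun setT (fun y : R => (neg (y + b))%:E).
  apply/measurable_EFinP; apply: (measurableT_comp (@measurable_negp R)).
  exact: measurable_funD.
have neg0 y : 0 <= (neg (y + b))%:E by rewrite lee_fin neg_ge0.
rewrite /undershoot (alive_step _ _ mneg neg0).
apply: (@le_trans _ _ (\int[Px x]_(w in alive n) (cst 2%:E (X n w)))).
  apply: (@le_integral_alive x n (fun y => \int[K y]_t (neg (t + b))%:E) (cst 2%:E)) => //.
  - exact: measurable_kernel_integral.
  - by move=> y; exact: integral_ge0.
  - move=> y y0; rewrite /= K_nu//.
    apply: le_trans (integral_quadratic_le (nu_mean y) (nu_var y) (g := cst 0%R) (a := 1%R) (b := 0%R) (c := 1%R) _ _ _ _ _) _ => //.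
    + apply: (measurableT_comp (@measurable_negp R)).
      by apply: measurable_funD => //; exact: measurable_funD.
    + by move=> s; exact: neg_ge0.
    + by move=> s; rewrite /=; case: (negpP (y + s + b)%R) => ?; have := sqr_ge0 (s - 1)%R; have := sqr_ge0 (s + 1)%R; nra.
    + by rewrite integral0 adde0.
rewrite integral_cst; last exact: measurable_alive.
rewrite -[leRHS]mule1; apply: lee_wpmul2l => //.
by apply: probability_le1; exact: measurable_alive.
Qed.

(** The part of a jump s from y that falls below - B is counted by the
    integers j >= y - 1 with B + j < |s|. *)
Lemma undershoot_jump_le (B : nat) y : (0 < y)%R ->
  \int[nu y]_s (neg (y + s + B%:R))%:E <=
  \sum_(j <oo) tail Y (B + j) * ((y <= j%:R + 1)%R%:R)%:E.
Proof.
move=> y0.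
have mt (j : nat) : measurable [set s : R | ((B + j)%:R < `|s|)%R].
  rewrite -[X in measurable X]setTI; apply: measurable_fun_ltr => //.
pose F (j : nat) (s : R) : R := ((y <= j%:R + 1)%R%:R * \1_[set s : R | ((B + j)%:R < `|s|)%R] s)%R.
have F0 j s : (0 <= F j s)%R by rewrite mulr_ge0.
have mF j : measurable_fun setT (F j).
  by apply: measurable_funM => //; exact: measurable_indic.
apply: (@le_trans _ _ (\int[nu y]_s \sum_(j <oo) (F j s)%:E)).
  apply: ge0_le_integral => //.
  - by move=> s _; rewrite lee_fin neg_ge0.
  - apply/measurable_EFinP; apply: (measurableT_comp (@measurable_negp R)).
    by apply: measurable_funD => //; exact: measurable_funD.
  - apply: ge0_emeasurable_sum => //.
    + by move=> k s _ _; rewrite lee_fin.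
    + by move=> k _; exact/measurable_EFinP.
  - move=> s _.
    pose N := (Num.truncn `|s|).+1.
    apply: (@le_trans _ _ (\sum_(0 <= j < N) (F j s)%:E)); last first.
      by apply: nneseries_lim_ge => j _ _; rewrite lee_fin.
    rewrite sumEFin lee_fin big_mkord.
    have := @gap_le_count _ y (`|s| - B%:R)%R N (ltW y0).
    rewrite min_l; last first.
      by have := truncnS_gt `|s|; have := ler0n R B; rewrite -/N; lra.
    have E : (\sum_(j < N) ((y <= j%:R + 1)%R && (j%:R < `|s| - B%:R)%R)%:R = \sum_(i < N) F i s)%R.
      by apply: eq_bigr => j _; rewrite /F indicE mem_setE ltrBrDl -natrD -mulnb natrM.
    rewrite E; have sum0 : (0 <= \sum_(i < N) F i s)%R by rewrite sumr_ge0.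
    by have := ler_norm (- s)%R; rewrite normrN; case: (negpP (y + s + B%:R)%R) => ? ? ?; lra.
rewrite integral_nneseries//; last 2 first.
- by move=> j; exact/measurable_EFinP.
- by move=> j s _; rewrite lee_fin.
apply: lee_nneseries => //.
- by move=> j _ _; apply: integral_ge0 => s _; rewrite lee_fin.
move=> j _; rewrite /F.
under eq_integral do rewrite EFinM.
rewrite ge0_integralZl_EFin; first last.
- by [].
- by apply/measurable_EFinP; exact: measurable_indic.
- by move=> s _; rewrite lee_fin.
- exact: measurableT.
rewrite integral_indic// setIT muleC; apply: lee_wpmul2r => //.
exact: nu_tail.
Qed.

Lemma undershoot_le_series (B : nat) n x :
  undershoot B%:R n x <=
  \sum_(j <oo) tail Y (B + j) * below (j%:R + 1)%R n x.
Proof.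
have mneg : measurable_fun setT (fun y : R => (neg (y + B%:R))%:E).
  apply/measurable_EFinP; apply: (measurableT_comp (@measurable_negp R)).
  exact: measurable_funD.
have neg0 (y : R) : 0 <= (neg (y + B%:R))%:E by rewrite lee_fin neg_ge0.
have mind (j : nat) : measurable_fun setT (fun y : R => ((y <= j%:R + 1)%R%:R : R)%:E).
  apply/measurable_EFinP.
  rewrite (_ : (fun _ => _) = \1_(`]-oo, (j%:R + 1)%R]%classic)).
    exact: measurable_indic.
  by apply/funext => w; rewrite indicE mem_setE in_itv.
have t0 j : 0 <= tail Y j by exact: measure_ge0.
have term0 j (y : R) : 0 <= tail Y (B + j) * ((y <= j%:R + 1)%R%:R : R)%:E.
  by rewrite mule_ge0.
have mterm j : measurable_fun setT (fun y : R => tail Y (B + j) * ((y <= j%:R + 1)%R%:R : R)%:E).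
  exact: measurable_funeM.
rewrite /undershoot (alive_step _ _ mneg neg0).
apply: le_trans.
  apply: (@le_integral_alive x n (fun y => \int[K y]_t (neg (t + B%:R))%:E)
    (fun y => \sum_(j <oo) tail Y (B + j) * ((y <= j%:R + 1)%R%:R : R)%:E)).
  - exact: measurable_kernel_integral.
  - by move=> y; exact: integral_ge0.
  - by apply: ge0_emeasurable_sum => // k y _ _.
  - by move=> y y0; rewrite K_nu//; exact: undershoot_jump_le.
rewrite integral_nneseries; first last.
- by [].
- by move=> j; exact: measurable_alive_fun (mterm j).
- exact: measurable_alive.
apply: lee_nneseries => //.
- by move=> j _ _; exact: integral_ge0.
move=> j _; rewrite ge0_integralZl; first last.
- by [].
- by [].
- exact: measurable_alive_fun (mind j).
- exact: measurable_alive.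
apply: lee_wpmul2l => //.
have mX : measurable (X n @^-1` `]-oo, (j%:R + 1)%R]).
  by rewrite -[X in measurable X]setTI; exact: measurable_funP.
rewrite /below setIC -integral_indic//; last exact: measurable_alive.
apply: ge0_le_integral => //.
- exact: measurable_alive.
- exact: measurable_alive_fun (mind j).
- by apply/measurable_EFinP; apply: (measurable_funS measurableT) => //; exact: measurable_indic.
move=> w _; rewrite indicE lee_fin.
by have -> : (w \in X n @^-1` `]-oo, (j%:R + 1)%R]) = (X n w <= j%:R + 1)%R
    by apply/idP/idP; rewrite inE /= in_itv.
Qed.

(** A self-bounding estimate for the sum b on the left. Level j contributes
    P(Y > B + j) times the time spent in (0, j + 1], which by occupation_le is
    a multiple of (x + B) + b; the weights add up so that b is at most half of
    that. *)
Lemma sum_undershoot_le (B : nat) n (x : R) : (0 < x)%R ->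
  excess Y B%:R <= (1/2)%:E ->
  \sum_(B <= i <oo) weighted_tail Y i <= (1/16)%:E ->
  \sum_(k < n) undershoot B%:R k x <= (x + B%:R)%:E.
Proof.
move=> x0 hB hT.
have u0 k : 0 <= undershoot B%:R k x by apply: integral_ge0 => w _; rewrite lee_fin neg_ge0.
have t0 j : 0 <= tail Y j by exact: measure_ge0.
have b0 L k : 0 <= below L k x by exact: measure_ge0.
set b := \sum_(k < n) _.
(* Finiteness is what allows b to be absorbed in the last step. *)
have bfin : b \is a fin_num.
  rewrite ge0_fin_numE; last exact: sume_ge0.
  apply: lte_sum_pinfty => k _.
  apply: le_lt_trans (undershoot_le2 _ _ _) _; first by [].
  exact: ltry.
have b_ge0 : 0 <= b by exact: sume_ge0.
have Db0 : 0 <= (x + B%:R)%:E + b.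
  by rewrite adde_ge0// lee_fin; have := ler0n R B; lra.
have h : b <= \sum_(j <oo) (8%:E * ((x + B%:R)%:E + b)) * weighted_tail Y (B + j).
  apply: (@le_trans _ _ (\sum_(k < n) \sum_(j <oo) tail Y (B + j) * below (j%:R + 1)%R k x)).
    by apply: lee_sum => k _; exact: undershoot_le_series.
  rewrite -nneseries_sum; last by move=> *; exact: mule_ge0.
  apply: lee_nneseries => //.
    by move=> j _ _; apply: sume_ge0 => k _; exact: mule_ge0.
  move=> j _; rewrite -ge0_sume_distrr//.
  have J0 : (0 <= j%:R + 1 :> R)%R by have := ler0n R j; lra.
  have := @occupation_le B%:R (j%:R + 1)%R (j%:R + 1 + 2 * B%:R)%R (ler0n _ _) J0 erefl hB x n x0.
  rewrite -/b => hocc.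
  have h2 : \sum_(k < n) below (j%:R + 1)%R k x <= 4%:E * ((j%:R + 1 + 2 * B%:R)%:E * ((x + B%:R)%:E + b)).
    have q0 : 0 < (1/4)%:E :> \bar R by rewrite lte_fin; lra.
    rewrite -(lee_pmul2l _ q0)//.
    apply: le_trans hocc _; rewrite !muleA -!EFinM; apply: lee_wpmul2r => //.
    by rewrite lee_fin; lra.
  apply: le_trans (lee_wpmul2l (t0 _) h2) _.
  rewrite /weighted_tail.
  set c := (x + B%:R)%:E + b.
  have -> : tail Y (B + j) * (4%:E * ((j%:R + 1 + 2 * B%:R)%:E * c)) =
      (4 * (j%:R + 1 + 2 * B%:R))%:E * tail Y (B + j) * c.
    by rewrite (muleA 4%:E) -EFinM muleA (muleC (tail Y _)).
  have -> : 8%:E * c * (((B + j)%:R + 1)%:E * tail Y (B + j)) =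
      (8 * ((B + j)%:R + 1))%:E * tail Y (B + j) * c.
    by rewrite -muleA (muleC c) muleA (muleA 8%:E) -EFinM.
  apply: lee_wpmul2r => //; apply: lee_wpmul2r => //.
  by rewrite lee_fin natrD; have := ler0n R B; have := ler0n R j; lra.
have [r br] : exists r, b = r%:E by exists (fine b); rewrite fineK.
move: h; rewrite br -EFinD -EFinM nneseriesZl; last by move=> i _; exact: weighted_tail_ge0.
under eq_eseriesr do rewrite addnC.
rewrite nneseries_addn; last by move=> i; exact: weighted_tail_ge0.
have r0 : (0 <= r)%R by rewrite -lee_fin -br.
move=> h.
have : r%:E <= (8 * (x + B%:R + r))%:E * (1/16)%:E.
  apply: le_trans h _; apply: lee_wpmul2l => //.
  by rewrite lee_fin; have := ler0n R B; lra.
by rewrite -EFinM !lee_fin; lra.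
Qed.

Definition mean_overshoot (n : nat) (x : R) : \bar R :=
  \int[Px x]_(w in alive n) (neg (X n.+1 w))%:E.

Definition mean_alive (n : nat) (x : R) : \bar R :=
  \int[Px x]_(w in alive n) (X n w)%:E.

Lemma measurable_pos_part : measurable_fun setT (fun t : R => (neg (- t))%:E).
Proof.
apply/measurable_EFinP; apply: (measurableT_comp (@measurable_negp R)).
exact: measurable_funN.
Qed.

Lemma measurable_neg_part : measurable_fun setT (fun t : R => (neg t)%:E).
Proof. by apply/measurable_EFinP; exact: measurable_negp. Qed.

(** Centred jumps keep the mean of X; dropping the negative values afterwards
    adds the overshoot. *)
Lemma mean_aliveS n (x : R) : mean_alive n.+1 x = mean_alive n x + mean_overshoot n x.
Proof.
have p0 (t : R) : 0 <= (neg (- t))%:E by rewrite lee_fin neg_ge0.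
have n0 (t : R) : 0 <= (neg t)%:E by rewrite lee_fin neg_ge0.
have mp := measurable_pos_part; have mn := measurable_neg_part.
rewrite /mean_alive /mean_overshoot (alive_step x n mn n0).
transitivity (\int[Px x]_(w in alive n.+1) (neg (- X n.+1 w))%:E).
  apply: eq_integral => w; rewrite inE => /alive_gt0 Xw.
  by rewrite neg_of_le0 ?opprK// oppr_le0 ltW.
rewrite -(@ge0_integral_aliveS _ _ _ _ _ x n (fun t => (neg (- t))%:E))//.
transitivity (\int[Px x]_(w in alive n) (neg (- X n.+1 w))%:E).
  apply: eq_integral => w _; rewrite /positive_part_of; case: ifPn => //.
  by rewrite -leNgt => X0; rewrite neg_of_ge0// oppr_ge0.
rewrite (alive_step x n mp p0).
rewrite -ge0_integralD; first last.
- exact: measurable_alive_fun (measurable_kernel_integral mn n0).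
- by move=> w _; exact: integral_ge0.
- by apply/measurable_EFinP; exact: (measurable_funS measurableT).
- by move=> w aw; rewrite lee_fin ltW//; exact: alive_gt0 aw.
- exact: measurable_alive.
apply: eq_integral => w; rewrite inE => /alive_gt0; move: (X n w) => y y0.
rewrite !K_nu//.
have m1 : measurable_fun setT (fun s : R => neg (y + s)).
  by apply: (measurableT_comp (@measurable_negp R)); exact: measurable_funD.
have m2 : measurable_fun setT (fun s : R => neg (- (y + s))).
  by apply: (measurableT_comp (@measurable_negp R)); apply: measurable_funN; exact: measurable_funD.
have h1 := @integral_quadratic_le _ (nu y) (nu_mean y) (nu_var y) _ _ y 1%R 0%R m2 m1
  (fun s => neg_ge0 _) (fun s => neg_ge0 _).
have h2 := @integral_quadratic_le _ (nu y) (nu_mean y) (nu_var y) _ _ (- y)%R (- 1)%R 0%R m1 m2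
  (fun s => neg_ge0 _) (fun s => neg_ge0 _).
apply/eqP; rewrite eq_le; apply/andP; split.
  move: h1; rewrite addr0; apply => s.
  by case: (negpP (y + s)%R) => ?; case: (negpP (- (y + s))%R) => ?; lra.
rewrite -leeBrDl//; apply: le_trans.
  apply: h2 => s.
  by case: (negpP (y + s)%R) => ?; case: (negpP (- (y + s))%R) => ?; lra.
by rewrite addr0 addeC EFinN.
Qed.

Lemma mean_alive0 (x : R) : (0 < x)%R -> mean_alive 0 x = x%:E.
Proof.
move=> x0; have mp := measurable_pos_part.
transitivity (\int[Px x]_(w in alive 0) (neg (- X 0%N w))%:E).
  apply: eq_integral => w; rewrite inE => /alive_gt0 Xw.
  by rewrite neg_of_le0 ?opprK// oppr_le0 ltW.
rewrite (@integral_alive0 _ _ _ _ _ _ X_markov x (fun t => (neg (- t))%:E))//.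
  by rewrite neg_of_le0 ?opprK// oppr_le0 ltW.
by move=> t; rewrite lee_fin neg_ge0.
Qed.

Lemma mean_overshoot_ge0 n x : 0 <= mean_overshoot n x.
Proof. by apply: integral_ge0 => w _; rewrite lee_fin neg_ge0. Qed.

Lemma mean_aliveE n (x : R) : (0 < x)%R ->
  mean_alive n x = x%:E + \sum_(k < n) mean_overshoot k x.
Proof.
move=> x0; elim: n => [|n IH]; first by rewrite mean_alive0// big_ord0 adde0.
by rewrite mean_aliveS IH big_ord_recr; exact: (esym (addeA _ _ _)).
Qed.

Lemma mean_overshoot_le (b : R) n (x : R) : (0 <= b)%R ->
  mean_overshoot n x <= undershoot b n x + b%:E * Px x (alive n `&` X n.+1 @^-1` `]-oo, 0%R]).
Proof.
move=> b0.
have mX : measurable (X n.+1 @^-1` `]-oo, 0%R]).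
  by rewrite -[X in measurable X]setTI; exact: measurable_funP.
have mI : measurable_fun (alive n) (fun w => (\1_(X n.+1 @^-1` `]-oo, 0%R]) w : R)%:E).
  by apply/measurable_EFinP; apply: (measurable_funS measurableT) => //; exact: measurable_indic.
have mU : measurable_fun (alive n) (fun w => (neg (X n.+1 w + b))%:E).
  apply: (@measurable_alive_fun _ _ _ _ n n.+1 (fun t => (neg (t + b))%:E)).
  apply/measurable_EFinP; apply: (measurableT_comp (@measurable_negp R)).
  exact: measurable_funD.
rewrite setIC -integral_indic//; last exact: measurable_alive.
rewrite -ge0_integralZl_EFin//; last exact: measurable_alive.
rewrite -ge0_integralD; first last.
- exact: measurable_funeM.
- by move=> w _; rewrite mule_ge0.
- exact: mU.
- by move=> w _; rewrite lee_fin neg_ge0.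
- exact: measurable_alive.
apply: ge0_le_integral.
- exact: measurable_alive.
- by move=> w _; rewrite lee_fin neg_ge0.
- exact: measurable_alive_fun measurable_neg_part.
- by apply: emeasurable_funD => //; exact: measurable_funeM.
move=> w _; rewrite indicE -EFinM -EFinD lee_fin.
have -> : (w \in X n.+1 @^-1` `]-oo, 0%R]) = (X n.+1 w <= 0)%R
    by apply/idP/idP; rewrite inE /= in_itv.
case: (negpP (X n.+1 w + b)%R) => ?; case: (negpP (X n.+1 w)) => ?;
  case: (leP (X n.+1 w) 0%R) => ?; rewrite /= ?mulr1n ?mulr0n; lra.
Qed.

Lemma sum_death_le1 n (x : R) : \sum_(k < n) Px x (alive k `&` X k.+1 @^-1` `]-oo, 0%R]) <= 1.
Proof.
have mX k : measurable (X k.+1 @^-1` `]-oo, 0%R]).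
  by rewrite -[X in measurable X]setTI; exact: measurable_funP.
suff h : \sum_(k < n) Px x (alive k `&` X k.+1 @^-1` `]-oo, 0%R]) + Px x (alive n) <= 1.
  by apply: le_trans h; rewrite leeDl.
elim: n => [|n IH].
  by rewrite big_ord0 add0e; apply: probability_le1; exact: measurable_alive.
rewrite big_ord_recr/= -addeA -measureU.
- rewrite (_ : _ `|` _ = alive n)//.
  rewrite aliveS -setIUr; apply/setIidPl => w _ /=; rewrite !in_itv/= andbT.
  by case: (leP (X n.+1 w) 0%R) => h; [left|right].
- by apply: measurableI => //; exact: measurable_alive.
- exact: measurable_alive.
- rewrite aliveS; apply/seteqP; split => // w [[_ +] [_ +]] /=.
  by rewrite /preimage/= !in_itv/= andbT leNgt => /negP.
Qed.

(** Markov inequality for the event that X k exceeds L. *)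
Lemma alive_le_below_mean (L : R) k (x : R) : (0 < L)%R ->
  Px x (alive k) <= below L k x + (L^-1)%:E * mean_alive k x.
Proof.
move=> L0.
have mX : measurable (X k @^-1` `]-oo, L]).
  by rewrite -[X in measurable X]setTI; exact: measurable_funP.
have mI : measurable_fun (alive k) (fun w => (\1_(X k @^-1` `]-oo, L]) w : R)%:E).
  by apply/measurable_EFinP; apply: (measurable_funS measurableT) => //; exact: measurable_indic.
have mXk : measurable_fun (alive k) (fun w => (X k w)%:E).
  by apply/measurable_EFinP; exact: (measurable_funS measurableT).
have Li : (0 <= L^-1)%R by rewrite invr_ge0 ltW.
rewrite /below [X in _ <= Px x X + _]setIC -integral_indic//; last exact: measurable_alive.
rewrite /mean_alive -ge0_integralZl_EFin//; first last.
- by move=> w aw; rewrite lee_fin ltW//; exact: alive_gt0 aw.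
- exact: measurable_alive.
rewrite -ge0_integralD; first last.
- exact: measurable_funeM.
- by move=> w aw; rewrite mule_ge0// lee_fin ltW//; exact: alive_gt0 aw.
- exact: mI.
- by [].
- exact: measurable_alive.
rewrite -[X in X <= _]mul1e -(integral_cst (Px x) (measurable_alive k) 1).
apply: ge0_le_integral => //.
- exact: measurable_alive.
- by apply: emeasurable_funD => //; exact: measurable_funeM.
move=> w aw; rewrite indicE -EFinM -EFinD lee_fin.
have -> : (w \in X k @^-1` `]-oo, L]) = (X k w <= L)%R
    by apply/idP/idP; rewrite inE /= in_itv.
have X0 := alive_gt0 aw; case: (leP (X k w) L) => h /=.
  by rewrite lerDl mulr_ge0// ltW.
by rewrite add0r ler_pdivlMl// mulr1 ltW.
Qed.

(** The time spent in (0, sqrt n] is O(sqrt n) by occupation_le, and the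
    probability of being higher is O(1 / sqrt n) at each time since the means
    are bounded. *)
Lemma survival_bound (x : R) : (0 < x)%R -> exists C : R,
  (0 <= C)%R /\
  (forall n, \sum_(k < n) mean_overshoot k x <= C%:E) /\
  (forall n, \sum_(k < n) Px x (alive k) <= (C * Num.sqrt n%:R)%:E).
Proof.
move=> x0; have [B [hB hT]] := exists_shift Y_sq.
have B0 := ler0n R B.
pose D : R := (x + B%:R)%R.
have hu n := sum_undershoot_le n x0 hB hT.
have ho n : \sum_(k < n) mean_overshoot k x <= (2 * D)%:E.
  apply: (@le_trans _ _ (\sum_(k < n) (undershoot B%:R k x +
     B%:R%:E * Px x (alive k `&` X k.+1 @^-1` `]-oo, 0%R])))).
    by apply: lee_sum => k _; exact: mean_overshoot_le.
  rewrite big_split/= -ge0_sume_distrr//.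
  apply: le_trans (leeD (hu n) (lee_wpmul2l _ (sum_death_le1 n x))) _ => //.
  by rewrite mule1 -EFinD lee_fin /D; lra.
have hm k : mean_alive k x <= (3 * D)%:E.
  rewrite mean_aliveE//; apply: le_trans (leeD (lexx _) (ho k)) _.
  by rewrite -EFinD lee_fin /D; lra.
exists (8 * D * (1 + 2 * B%:R) + 3 * D)%R; split.
  rewrite addr_ge0// ?mulr_ge0// /D; lra.
split.
  move=> n; apply: le_trans (ho n) _; rewrite lee_fin.
  have D0 : (0 <= D)%R by rewrite /D; lra.
  by have := mulr_ge0 D0 B0; lra.
case=> [|n]; first by rewrite big_ord0 sqrtr0 mulr0.
(* This L balances L from the occupation of (0, L] against n / L from above it. *)
set L := Num.sqrt n.+1%:R.
have L1 : (1 <= L)%R by rewrite -sqrtr1 ler_sqrt// ler1n.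
have L0 : (0 < L)%R by lra.
apply: (@le_trans _ _ (\sum_(k < n.+1) (below L k x + (L^-1 * (3 * D))%:E))).
  apply: lee_sum => k _; apply: le_trans (alive_le_below_mean _ _ L0) _.
  rewrite EFinM; apply: leeD => //; apply: lee_wpmul2l => //.
  by rewrite lee_fin invr_ge0 ltW.
rewrite big_split/=.
have hocc := @occupation_le B%:R L (L + 2 * B%:R)%R B0 (ltW L0) erefl hB x n.+1 x0.
have h2 : \sum_(k < n.+1) below L k x <= (8 * D * (1 + 2 * B%:R) * L)%:E.
  have q0 : 0 < (1/4)%:E :> \bar R by rewrite lte_fin; lra.
  rewrite -(lee_pmul2l _ q0)//.
  apply: le_trans hocc _.
  apply: le_trans (lee_wpmul2l _ (leeD (lexx _) (hu _))) _; first by rewrite lee_fin; lra.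
  rewrite -EFinD -!EFinM lee_fin -/D.
  have D0 : (0 <= D)%R by rewrite /D; lra.
  by have := mulr_ge0 D0 (mulr_ge0 B0 (_ : 0 <= L - 1)%R); lra.
apply: le_trans (leeD h2 (lexx _)) _.
rewrite sumEFin -EFinD lee_fin sumr_const card_ord -[X in (_ + X <= _)%R]mulr_natr.
have -> : (L^-1 * (3 * D) * n.+1%:R = 3 * D * L)%R.
  have -> : (n.+1%:R = L ^+ 2)%R by rewrite sqr_sqrtr.
  by field; rewrite gt_eqF.
by lra.
Qed.

(** * Heat flow along the chain *)

Section Drift.
Variables (c B e : R).
Hypotheses (c0 : (0 < c)%R) (B0 : (0 < B)%R).
Hypotheses (cs : (Num.sqrt c <= 1/2)%R) (cB : (Num.sqrt c * B <= 1)%R).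
Hypothesis excessB : excess Y B <= e%:E.
Let E : R := step_error (Num.sqrt c) B e.

Let e0 : (0 <= e)%R.
Proof.
by rewrite -lee_fin; apply: le_trans excessB; apply: integral_ge0 => w _; rewrite lee_fin sqr_above_ge0.
Qed.

Lemma step_error_ge0 : (0 <= E)%R.
Proof.
have t0 : (0 <= Num.sqrt c)%R by exact: sqrtr_ge0.
have B1 := ltW B0.
rewrite /E /step_error; apply: mulr_ge0; first exact: wave_const_ge0.
apply: addr_ge0; last exact: mulr_ge0.
apply: addr_ge0; first exact: exprn_ge0.
by apply: mulr_ge0 => //; exact: exprn_ge0.
Qed.

(** Stated with positive and negative parts, so that only nonnegative
    functions are integrated. *)
Lemma approx_drift (y T0 b g : R) (T : R -> R) : measurable_fun setT T ->
  (forall s, (`|T s - T0 - b * s - g * (s ^+ 2 - 1)| <=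
    wave_const * (Num.sqrt c ^+ 3 + Num.sqrt c ^+ 2 * B * s ^+ 2 + Num.sqrt c * sqr_above B s))%R) ->
  \int[nu y]_s (neg (- T s))%:E <= (T0 + E)%:E + \int[nu y]_s (neg (T s))%:E.
Proof.
move=> mT hT; set t := Num.sqrt c in hT.
have t0 : (0 <= t)%R by exact: sqrtr_ge0.
have w0 := @wave_const_ge0 R.
have wt0 : (0 <= wave_const * t :> R)%R by exact: mulr_ge0.
have mn : measurable_fun setT (fun s => neg (T s)).
  exact: (measurableT_comp (@measurable_negp R)).
have mp : measurable_fun setT (fun s => neg (- T s)).
  by apply: (measurableT_comp (@measurable_negp R)); exact: measurable_funN.
have mq : measurable_fun setT (fun s : R => wave_const * t * sqr_above B s)%R.
  by apply: measurable_funM => //; exact: measurable_sqr_above.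
have h := @integral_quadratic_le _ (nu y) (nu_mean y) (nu_var y)
  (fun s => neg (- T s)) (fun s => neg (T s) + wave_const * t * sqr_above B s)%R
  (T0 - g + wave_const * t ^+ 3)%R b (g + wave_const * (t ^+ 2 * B))%R.
apply: le_trans (h _ _ _ _ _) _ => //.
- exact: measurable_funD.
- by move=> s; exact: neg_ge0.
- by move=> s; rewrite addr_ge0 ?neg_ge0 ?mulr_ge0 ?sqr_above_ge0.
- move=> s; have := hT s; rewrite ler_norml => /andP[_].
  by case: (negpP (T s)) => ?; case: (negpP (- T s)%R) => ?; lra.
under eq_integral do rewrite EFinD.
rewrite ge0_integralD; first last.
- exact/measurable_EFinP.
- by move=> s _; rewrite lee_fin mulr_ge0 ?sqr_above_ge0.
- exact/measurable_EFinP.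
- by move=> s _; rewrite lee_fin neg_ge0.
- exact: measurableT.
under [X in _ + (_ + X) <= _]eq_integral do rewrite EFinM.
rewrite ge0_integralZl_EFin//; first last.
- by apply/measurable_EFinP; exact: measurable_sqr_above.
- by move=> s _; rewrite lee_fin sqr_above_ge0.
have hs : (wave_const * t)%:E * \int[nu y]_s (sqr_above B s)%:E <= (wave_const * t * e)%:E.
  rewrite (EFinM _ e); apply: lee_wpmul2l; first by rewrite lee_fin.
  exact: le_trans (integral_sqr_above_le y (ltW B0)) excessB.
rewrite addeCA addeC; apply: leeD => //.
apply: le_trans (leeD (lexx _) hs) _.
by rewrite -EFinD lee_fin /E /step_error -/t; lra.
Qed.

Let measurable_twave_pos m : measurable_fun setT (fun t : R => (neg (- twave c m t))%:E).
Proof.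
apply/measurable_EFinP; apply: (measurableT_comp (@measurable_negp R)).
by apply: measurable_funN; exact: measurable_twave.
Qed.

Let measurable_twave_neg m : measurable_fun setT (fun t : R => (neg (twave c m t))%:E).
Proof.
apply/measurable_EFinP; apply: (measurableT_comp (@measurable_negp R)).
exact: measurable_twave.
Qed.

Lemma twave_drift m y :
  \int[K y]_t (neg (- twave c m t))%:E <=
    (twave c m.+1 y + E)%:E + \int[K y]_t (neg (twave c m t))%:E /\
  \int[K y]_t (neg (twave c m t))%:E <=
    (- twave c m.+1 y + E)%:E + \int[K y]_t (neg (- twave c m t))%:E.
Proof.
rewrite (@K_nu y (fun t => (neg (- twave c m t))%:E))//; last first.
  by move=> t; rewrite lee_fin neg_ge0.
rewrite (@K_nu y (fun t => (neg (twave c m t))%:E))//; last first.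
  by move=> t; rewrite lee_fin neg_ge0.
have [b [g h]] := twave_step m y c0 B0 cs cB.
have mT : measurable_fun setT (fun s : R => twave c m (y + s)).
  by apply: (measurableT_comp (measurable_twave c m)); exact: measurable_funD.
split; first exact: (approx_drift y mT h).
have h' s : (`|- twave c m (y + s) - - twave c m.+1 y - - b * s - - g * (s ^+ 2 - 1)| <=
    wave_const * (Num.sqrt c ^+ 3 + Num.sqrt c ^+ 2 * B * s ^+ 2 + Num.sqrt c * sqr_above B s))%R.
  rewrite [X in (`|X|)%R](_ : _ = - (twave c m (y + s) - twave c m.+1 y - b * s - g * (s ^+ 2 - 1)))%R; last by ring.
  by rewrite normrN.
have := approx_drift y (measurable_funN mT) h'.
by under [X in X <= _]eq_integral do rewrite opprK.
Qed.

Definition wave_alive (k m : nat) (x : R) : \bar R :=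
  \int[Px x]_(w in alive k) (twave c m (X k w))%:E.

(** The profile is odd, so that this is what the killing jump carries out of
    the half-line. *)
Definition wave_lost (k m : nat) (x : R) : \bar R :=
  \int[Px x]_(w in alive k) (neg (twave c m (X k.+1 w)))%:E.

Lemma wave_aliveE k m x :
  wave_alive k m x = \int[Px x]_(w in alive k) (neg (- twave c m (X k w)))%:E.
Proof.
apply: eq_integral => w; rewrite inE => /alive_gt0 Xw.
have := @twave_ge0 _ c m (X k w) (ltW c0) (ltW Xw).
by move=> h; rewrite neg_of_le0 ?opprK// oppr_le0.
Qed.

Lemma wave_aliveS k m x : wave_alive k.+1 m x =
  \int[Px x]_(w in alive k) (neg (- twave c m (X k.+1 w)))%:E.
Proof.
rewrite wave_aliveE -(@ge0_integral_aliveS _ _ _ _ _ x k (fun t => (neg (- twave c m t))%:E))//; last first.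
  by move=> t; rewrite lee_fin neg_ge0.
apply: eq_integral => w _; rewrite /positive_part_of; case: ifPn => //.
rewrite -leNgt => X0; have := @twave_le0 _ c m (X k.+1 w) (ltW c0) X0.
by move=> h; rewrite neg_of_ge0// oppr_ge0.
Qed.

Lemma wave_lost_ge0 k m x : 0 <= wave_lost k m x.
Proof. by apply: integral_ge0 => w _; rewrite lee_fin neg_ge0. Qed.

Lemma wave_lost_le k m x : wave_lost k m x <= mean_overshoot k x.
Proof.
apply: ge0_le_integral.
- exact: measurable_alive.
- by move=> w _; rewrite lee_fin neg_ge0.
- exact: measurable_alive_fun (measurable_twave_neg m).
- exact: measurable_alive_fun measurable_neg_part.
move=> w _; rewrite lee_fin; move: (X k.+1 w) => y.
have := twave_bound m y (ltW c0); have [y0|y0] := leP 0%R y.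
  by have := twave_ge0 m (ltW c0) y0 => h _; rewrite !neg_of_ge0.
have h := twave_le0 m (ltW c0) (ltW y0).
by rewrite !neg_of_le0 ?(ltW y0)// !ler0_norm// ltW.
Qed.

(** Comparing a jump with a unit of heat time, the value on survival changes
    by the part lost at the exit, up to the step error for each surviving
    path. *)
Lemma wave_alive_step k m x :
  wave_alive k.+1 m x <= wave_alive k m.+1 x + wave_lost k m x + E%:E * Px x (alive k) /\
  wave_alive k m.+1 x + wave_lost k m x <= wave_alive k.+1 m x + E%:E * Px x (alive k).
Proof.
have p0 m' (t : R) : 0 <= (neg (- twave c m' t))%:E by rewrite lee_fin neg_ge0.
have n0 m' (t : R) : 0 <= (neg (twave c m' t))%:E by rewrite lee_fin neg_ge0.
have E0 := step_error_ge0.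
have mKp := measurable_kernel_integral (measurable_twave_pos m) (p0 m).
have mKn := measurable_kernel_integral (measurable_twave_neg m) (n0 m).
have mE : measurable_fun (alive k) (fun=> E%:E) by [].
have EP : E%:E * Px x (alive k) = \int[Px x]_(w in alive k) (cst E%:E (X k w)).
  by rewrite integral_cst//; exact: measurable_alive.
rewrite wave_aliveS wave_aliveE /wave_lost EP.
rewrite (alive_step x k (measurable_twave_pos m) (p0 m)).
rewrite (alive_step x k (measurable_twave_neg m) (n0 m)).
rewrite -ge0_integralD; first last.
- exact: measurable_alive_fun mKn.
- by move=> w _; exact: integral_ge0.
- exact: measurable_alive_fun (measurable_twave_pos _).
- by [].
- exact: measurable_alive.
rewrite -ge0_integralD; first last.
- by [].
- by move=> w _; rewrite lee_fin.
- by apply: emeasurable_funD; [exact: measurable_alive_fun (measurable_twave_pos _)|exact: measurable_alive_fun mKn].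
- by move=> w _; rewrite adde_ge0//; exact: integral_ge0.
- exact: measurable_alive.
rewrite -ge0_integralD; first last.
- by [].
- by move=> w _; rewrite lee_fin.
- exact: measurable_alive_fun mKp.
- by move=> w _; exact: integral_ge0.
- exact: measurable_alive.
split.
- apply: (@le_integral_alive x k (fun y => \int[K y]_t (neg (- twave c m t))%:E)
    (fun y => (neg (- twave c m.+1 y))%:E + \int[K y]_t (neg (twave c m t))%:E + E%:E)) => //.
  + by move=> y; exact: integral_ge0.
  + by apply: emeasurable_funD => //; exact: emeasurable_funD.
  + move=> y y0; have [h _] := twave_drift m y.
    have tw := twave_ge0 m.+1 (ltW c0) (ltW y0).
    rewrite neg_of_le0 ?oppr_le0// opprK addeAC -EFinD.
    exact: h.
- apply: (@le_integral_alive x k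
    (fun y => (neg (- twave c m.+1 y))%:E + \int[K y]_t (neg (twave c m t))%:E)
    (fun y => \int[K y]_t (neg (- twave c m t))%:E + E%:E)) => //.
  + exact: emeasurable_funD.
  + by move=> y; rewrite adde_ge0//; exact: integral_ge0.
  + exact: emeasurable_funD.
  + move=> y y0; have [_ h] := twave_drift m y.
    have tw := twave_ge0 m.+1 (ltW c0) (ltW y0).
    rewrite neg_of_le0 ?oppr_le0// opprK.
    apply: le_trans (leeD (lexx _) h) _.
    by rewrite addeA -EFinD addNKr addeC.
Qed.

(** The steps telescope, and the total error involves only the overshoots and
    the survival time after m0. *)
Lemma wave_alive_bounds m0 j m x :
  wave_alive (m0 + j) m x <= wave_alive m0 (m + j) x +
    (\sum_(k < j) mean_overshoot (m0 + k) x + E%:E * \sum_(k < j) Px x (alive (m0 + k))) /\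
  wave_alive m0 (m + j) x <= wave_alive (m0 + j) m x +
    (\sum_(k < j) mean_overshoot (m0 + k) x + E%:E * \sum_(k < j) Px x (alive (m0 + k))).
Proof.
have o0 k : 0 <= mean_overshoot k x by exact: mean_overshoot_ge0.
have E0 : 0 <= E%:E by rewrite lee_fin step_error_ge0.
elim: j m => [|j IH] m.
  by rewrite !addn0 !big_ord0 mule0 !adde0.
rewrite !addnS -addSn !big_ord_recr/=.
set O := \sum_(k < j) _; set Q := \sum_(k < j) _.
rewrite ge0_muleDr ?sume_ge0//.
have -> : O + mean_overshoot (m0 + j) x + (E%:E * Q + E%:E * Px x (alive (m0 + j))) =
   O + E%:E * Q + (mean_overshoot (m0 + j) x + E%:E * Px x (alive (m0 + j))).
  by rewrite addeACA.
have [s1 s2] := wave_alive_step (m0 + j) m x.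
have [i1 i2] := IH m.+1.
have l1 := wave_lost_le (m0 + j) m x.
have l0 := wave_lost_ge0 (m0 + j) m x.
split.
- apply: le_trans s1 _; rewrite [leRHS]addeA -[leLHS]addeA; apply: leeD => //.
  exact: leeD.
- have h : wave_alive (m0 + j) m.+1 x <=
      wave_alive (m0 + j).+1 m x + (mean_overshoot (m0 + j) x + E%:E * Px x (alive (m0 + j))).
    apply: le_trans; first by apply: (leeDl _ l0).
    by apply: le_trans s2 _; apply: leeD => //; rewrite leeDr.
  apply: le_trans i2 _; apply: le_trans (leeD h (lexx _)) _.
  by rewrite -addeA (addeC (_ + _) (O + _)).
Qed.

End Drift.

Lemma cvg_mean_alive (x : R) : (0 < x)%R ->
  mean_alive n x @[n --> \oo] --> x%:E + \sum_(k <oo) mean_overshoot k x.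
Proof.
move=> x0; under eq_fun do rewrite (mean_aliveE _ x0).
apply: cvgeD; [by rewrite ge0_adde_def ?inE ?lee_fin ?(ltW x0)// nneseries_ge0// => k _ _; exact: mean_overshoot_ge0|exact: cvg_cst|].
under eq_fun do rewrite -(big_mkord xpredT (fun k => mean_overshoot k x)).
by apply: is_cvg_nneseries => k _ _; exact: mean_overshoot_ge0.
Qed.

(** With the time m0 fixed, the profile with m steps to go becomes linear
    while X m0 dominates it. *)
Lemma integral_wave_alive_cvg (a x : R) (m0 : nat) : (0 <= a)%R -> (0 < m0)%N ->
  mean_alive m0 x < +oo ->
  wave_alive (a / (m0 + m)%:R)%R m0 m x @[m --> \oo] --> (heat_factor a ^+ 3)%:E * mean_alive m0 x.
Proof.
move=> a0 m00 mfin.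
have mX : measurable_fun (alive m0) (fun w => (X m0 w)%:E).
  by apply/measurable_EFinP; exact: (measurable_funS measurableT).
rewrite /mean_alive -ge0_integralZl_EFin//; first last.
- by rewrite exprn_ge0// ltW// heat_factor_gt0.
- by move=> w aw; rewrite lee_fin ltW//; exact: alive_gt0 aw.
- exact: measurable_alive.
apply: (@dominated_cvg _ _ _ (Px x) (alive m0) (measurable_alive m0) _ _ (fun w => (X m0 w)%:E)) => //.
- move=> m; apply: (@measurable_alive_fun _ _ _ _ m0 m0 (fun t => (twave (a / (m0 + m)%:R) m t)%:E)).
  by apply/measurable_EFinP; exact: measurable_twave.
- by move=> w _; rewrite -EFinM; apply/fine_cvgP; split; [exact: nearW|exact: cvg_twave].
- apply/integrableP; split=> //.
  rewrite (eq_integral (fun w => (X m0 w)%:E))// => w; rewrite inE => aw.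
  by rewrite gee0_abs// lee_fin ltW//; exact: alive_gt0 aw.
- move=> m w aw; rewrite /= lee_fin.
  have c0 : (0 <= a / (m0 + m)%:R)%R by rewrite divr_ge0.
  by apply: le_trans (twave_bound _ _ c0) _; rewrite gtr0_norm//; exact: alive_gt0 aw.
Qed.

Lemma mean_alive_add (x : R) m0 j :
  mean_alive (m0 + j) x = mean_alive m0 x + \sum_(k < j) mean_overshoot (m0 + k) x.
Proof.
elim: j => [|j IH]; first by rewrite addn0 big_ord0 adde0.
rewrite addnS (mean_aliveS) IH big_ord_recr.
exact: (esym (addeA _ _ _)).
Qed.

Lemma wave_alive_le c k m x : (0 <= c)%R -> wave_alive c k m x <= mean_alive k x.
Proof.
move=> c0; apply: ge0_le_integral.
- exact: measurable_alive.
- by move=> w /alive_gt0 Xw; rewrite lee_fin twave_ge0// ltW.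
- apply: (@measurable_alive_fun _ _ _ _ k k (fun t => (twave c m t)%:E)).
  by apply/measurable_EFinP; exact: measurable_twave.
- by apply/measurable_EFinP; exact: (measurable_funS measurableT).
move=> w /alive_gt0 Xw; rewrite lee_fin.
have := twave_bound m (X k w) c0; rewrite (gtr0_norm Xw).
by apply: le_trans; exact: ler_norm.
Qed.

Lemma wave_alive_ge0 c k m x : (0 <= c)%R -> 0 <= wave_alive c k m x.
Proof.
by move=> c0; apply: integral_ge0 => w /alive_gt0 Xw; rewrite lee_fin twave_ge0// ltW.
Qed.

(** Run the heat flow backwards from time n to a late but fixed time m0. The
    step errors add up to o(1 / sqrt n) times a survival time O(sqrt n), the
    loss at the exit is at most the overshoot after m0, and at m0 the profile
    is nearly heat_factor a ^3 * y. *)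
Lemma gaussian_limit (a x Vx : R) : (0 < a)%R -> (0 < x)%R ->
  x%:E + \sum_(k <oo) mean_overshoot k x = Vx%:E ->
  wave_alive (a / n%:R)%R n 0%N x @[n --> \oo] --> (heat_factor a ^+ 3 * Vx)%:E.
Proof.
move=> a0 x0 VE.
have [C [C0 [_ hP]]] := survival_bound x0.
have hmean := cvg_mean_alive x0; rewrite VE in hmean.
have o0 k : 0 <= mean_overshoot k x by exact: mean_overshoot_ge0.
have mle k : mean_alive k x <= Vx%:E.
  rewrite -VE (mean_aliveE _ x0); apply: leeD => //.
  by rewrite -(big_mkord xpredT (fun k => mean_overshoot k x)); apply: nneseries_lim_ge => *.
have m0' k : 0 <= mean_alive k x.
  by apply: integral_ge0 => w /alive_gt0 Xw; rewrite lee_fin ltW.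
pose M k := fine (mean_alive k x).
have ME k : mean_alive k x = (M k)%:E.
  by rewrite fineK// ge0_fin_numE//; apply: le_lt_trans (mle k) _; exact: ltry.
have MV k : (M k <= Vx)%R by rewrite -lee_fin -ME.
have wfin c k m : (0 <= c)%R -> wave_alive c k m x = (fine (wave_alive c k m x))%:E.
  move=> c0; rewrite fineK// ge0_fin_numE ?wave_alive_ge0//.
  by apply: le_lt_trans (wave_alive_le _ _ _ c0) _; rewrite ME ltry.
have an (n : nat) : (0 <= a / n%:R)%R by rewrite divr_ge0// ltW.
apply/fine_cvgP; split.
  by apply: nearW => n; rewrite wfin.
apply/cvgrPdist_le => delta delta0.
set A := (heat_factor a ^+ 3)%R.
have A01 : (0 <= A <= 1)%R.
  have h0 := heat_factor_gt0 (ltW a0); have h1 := heat_factor_le1 (ltW a0).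
  by rewrite /A exprn_ge0 ?exprn_ile1// ltW.
have /andP[A0 A1] := A01.
have wc0 := @wave_const_ge0 R.
pose G := (C * wave_const * Num.sqrt a)%R.
have G0 : (0 <= G)%R by rewrite /G !mulr_ge0// sqrtr_ge0.
(* The mean that is still missing at m0 is the overshoot after m0. *)
have [m0 [m00 hm0]] : exists m0 : nat, (0 < m0)%N /\ (Vx - M m0 <= delta / 8)%R.
  have d8 : (0 < delta / 8)%R by rewrite divr_gt0.
  have : fine (mean_alive n x) @[n --> \oo] --> Vx by exact: fine_cvg hmean.
  move/cvgrPdist_le => /(_ _ d8) h.
  near \oo => m0; exists m0; split; first by near: m0; exact: nbhs_infty_gt.
  by apply: le_trans (ler_norm _) _; near: m0; exact: h.
(* G is the order of the survival time times sqrt (a / n), so that G * e is the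
   part of the error that does not vanish with n. *)
pose e := (delta / (8 * (1 + G)))%R.
have e0 : (0 < e)%R by rewrite divr_gt0// mulr_gt0//; lra.
have Ge : (G * e <= delta / 8)%R.
  rewrite /e (_ : (G * _ = delta / 8 * (G / (1 + G)))%R); last by field; rewrite gt_eqF//; lra.
  have G1 : (0 < 1 + G)%R by lra.
  have : (G / (1 + G) <= 1)%R by rewrite ler_pdivrMr//; lra.
  by move=> h; rewrite ler_piMr// divr_ge0// ltW.
have [B [B0 hB]] : exists B : nat, (0 < B)%N /\ excess Y B%:R <= e%:E.
  have h := cvge_near_lt (excess_cvg0 Y_sq) (_ : 0 < e%:E).
  near \oo => B; exists B; split; first by near: B; exact: nbhs_infty_gt.
  by apply: ltW; near: B; apply: h; rewrite lte_fin.
have B0' : (0 < B%:R :> R)%R by rewrite ltr0n.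
have hs := cvg_sqrt_invn a 0.
have hg : fine (wave_alive (a / (m0 + m)%:R)%R m0 m x) @[m --> \oo] --> (A * M m0)%R.
  apply: fine_cvg; rewrite EFinM -ME; apply: integral_wave_alive_cvg => //; first exact: ltW.
  by rewrite ME ltry.
have hS : (G * (Num.sqrt (a / (0 + n)%:R) ^+ 2 + Num.sqrt (a / (0 + n)%:R) * B%:R))%R
    @[n --> \oo] --> (G * (0 ^+ 2 + 0 * B%:R))%R.
  apply: cvgM; first exact: cvg_cst.
  by apply: cvgD; [exact: cvg_exprn|apply: cvgM => //; exact: cvg_cst].
rewrite expr0n mul0r addr0 mulr0 in hS.
have d8 : (0 < delta / 8)%R by rewrite divr_gt0.
have [N1 _ hN1] : \forall m \near \oo,
    (`|A * M m0 - fine (wave_alive (a / (m0 + m)%:R)%R m0 m x)| <= delta / 8)%R.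
  exact: (cvgrPdist_le _ _).1 hg _ d8.
have nt12 : \forall n \near \oo, (Num.sqrt (a / (0 + n)%:R) <= 1/2)%R.
  have h12 : (0 < 1/2 :> R)%R by lra.
  exact: (cvgr_le _ hs).
have ntB : \forall n \near \oo, (Num.sqrt (a / (0 + n)%:R) <= 1 / B%:R)%R.
  by apply: (cvgr_le _ hs); rewrite divr_gt0.
have ntS := cvgr_le _ hS _ d8.
near=> n.
have n1 : (0 < n)%N by near: n; exact: nbhs_infty_gt.
have nm0 : (m0 + N1 <= n)%N by near: n; exact: nbhs_infty_ge.
set t := Num.sqrt (a / n%:R).
have t12 : (t <= 1/2)%R by rewrite /t; near: n; exact: nt12.
have tB : (t * B%:R <= 1)%R by rewrite -ler_pdivlMr// /t; near: n; exact: ntB.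
have tS : (G * (t ^+ 2 + t * B%:R) <= delta / 8)%R by rewrite /t; near: n; exact: ntS.
have c0 : (0 < a / n%:R)%R by rewrite divr_gt0// ltr0n.
pose m := (n - m0)%N.
have nE : (m0 + m = n)%N by rewrite /m subnKC// (leq_trans _ nm0)// leq_addr.
have Nm : (N1 <= m)%N by rewrite /m leq_subRL// (leq_trans _ nm0)// leq_addr.
have := hN1 m Nm; rewrite /= nE => hg1.
have [b1 b2] := wave_alive_bounds c0 B0' t12 tB hB m0 m 0 x.
rewrite nE add0n in b1 b2.
have t0 : (0 <= t)%R by exact: sqrtr_ge0.
have E0 : (0 <= step_error t B%:R e)%R.
  exact: (@step_error_ge0 (a / n%:R)%R B%:R e B0' hB).
have err : \sum_(k < m) mean_overshoot (m0 + k) x +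
   (step_error t B%:R e)%:E * \sum_(k < m) Px x (alive (m0 + k)) <=
   (Vx - M m0 + step_error t B%:R e * (C * Num.sqrt n%:R))%:E.
  rewrite EFinD; apply: leeD.
    rewrite EFinB -ME leeBrDl//; last by rewrite ME.
    by rewrite -mean_alive_add.
  rewrite (EFinM (step_error _ _ _)); apply: lee_wpmul2l; first by rewrite lee_fin.
  apply: le_trans (hP n); rewrite -nE big_split_ord/=.
  by rewrite leeDr// sume_ge0.
have errE : (step_error t B%:R e * (C * Num.sqrt n%:R) <= delta / 4)%R.
  have tn : (t * Num.sqrt n%:R = Num.sqrt a)%R.
    rewrite /t -sqrtrM; last exact: ltW.
    by congr Num.sqrt; field; rewrite pnatr_eq0 -lt0n.
  have -> : (step_error t B%:R e * (C * Num.sqrt n%:R) =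
      G * (t ^+ 2 + t * B%:R) + G * e)%R.
    rewrite /step_error /G -tn; ring.
  lra.
have b1' := le_trans b1 (leeD (lexx _) err).
have b2' := le_trans b2 (leeD (lexx _) err).
move: b1' b2'; rewrite (wfin (a / n%:R)%R n 0%N)// (wfin (a / n%:R)%R m0 m)// -!EFinD !lee_fin.
move: (fine _) (fine _) hg1 => g h; rewrite !ler_norml => /andP[g1 g2] h1 h2.
have V0 : (0 <= Vx - M m0)%R by have := MV m0; lra.
have AV : (A * (Vx - M m0) <= Vx - M m0)%R by rewrite ler_piMl.
have AV0 : (0 <= A * (Vx - M m0))%R by rewrite mulr_ge0.
rewrite /=; apply/andP; split; lra.
Unshelve. all: by end_near. Qed.

(** * Limits for the killed chain and for its transform *)

Lemma mean_alive_fin n (x : R) : (0 < x)%R -> mean_alive n x < +oo.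
Proof.
move=> x0; rewrite (mean_aliveE n x0).
have [C [_ [hC _]]] := survival_bound x0.
by rewrite lte_add_pinfty ?ltry//; apply: le_lt_trans (hC n) _; rewrite ltry.
Qed.

Lemma integrable_alive n (x : R) : (0 < x)%R ->
  (Px x).-integrable (alive n) (fun w => (X n w)%:E).
Proof.
move=> x0; apply/integrableP; split.
  by apply/measurable_EFinP; exact: (measurable_funS measurableT).
apply: le_lt_trans (mean_alive_fin n x0); rewrite le_eqVlt; apply/orP; left; apply/eqP.
apply: eq_integral => w; rewrite inE => /alive_gt0 Xw.
by rewrite gee0_abs// lee_fin ltW.
Qed.

(** The law of exp(- X n ^2 / n) under the weight X n on survival. *)
Definition meander_functional (x : R) (n : nat) (f : R -> R) : R :=
  (\int[Px x]_(w in alive n)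
    (X n w * f (expR (- (X n w ^+ 2 / n%:R)))))%R.

Lemma meander_positive (x : R) n : (0 < x)%R ->
  positive_functional (meander_functional x n).
Proof.
move=> x0.
apply: (@positive_functional_Rintegral _ _ _ _ _ (fun w => X n w)
  (fun w => expR (- (X n w ^+ 2 / n%:R))%R)).
- exact: measurable_alive.
- exact: integrable_alive.
- by move=> w /alive_gt0 Xw; exact: ltW.
- apply: (measurable_funS measurableT) => //.
  apply: measurableT_comp => //; apply: measurable_funN.
  by apply: measurable_funM => //; exact: measurable_funX.
- by move=> w _; rewrite expR_ge0 expR_le1 oppr_le0 mulr_ge0 ?sqr_ge0.
Qed.

(** The powers of exp(- X n ^2 / n) are the profiles of gaussian_limit with no
    step left to run; the power 0 is the mean itself. *)
Lemma meander_moment (x Vx : R) k : (0 < x)%R ->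
  x%:E + \sum_(k <oo) mean_overshoot k x = Vx%:E ->
  (meander_functional x n (fun z => z ^+ k) @[n --> \oo] -->
   Vx * maxwell_functional (fun z => z ^+ k : R))%R.
Proof.
move=> x0 VE; rewrite maxwell_functional_exprn mulrC.
apply: fine_cvg; case: k => [|k].
  have := cvg_mean_alive x0; rewrite VE heat_factor0 expr1n mul1r.
  apply: cvg_trans; apply: near_eq_cvg; near=> n.
  by apply: eq_integral => w _; rewrite expr0 mulr1.
have := gaussian_limit (ltr0Sn R k) x0 VE.
apply: cvg_trans; apply: near_eq_cvg; near=> n.
apply: eq_integral => w _; congr EFin.
rewrite /twave/= mulr0 heat_factor0 expr1n mul1r mulr1 /wave; congr (_ * _)%R.
rewrite -expRM_natl; congr expR.
rewrite exprMn sqr_sqrtr ?divr_ge0// mulrN; congr (- _)%R.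
by rewrite -mulrA [(n%:R^-1 * _)%R]mulrC.
Unshelve. all: by end_near.
Qed.

Lemma meander_tail (x v Vx : R) : (0 < x)%R -> (0 < v)%R -> (0 < Vx)%R ->
  x%:E + \sum_(k <oo) mean_overshoot k x = Vx%:E ->
  \int[Px x]_(w in alive n `&` X n @^-1` [set y | (v <= y / Num.sqrt n%:R)%R]) (X n w)%:E
    @[n --> \oo] -->
  (Vx * maxwell_functional (fun z => (z <= expR (- v ^+ 2))%R%:R))%:E.
Proof.
move=> x0 v0 Vx0 VE.
have cont e : (0 < e)%R -> exists s t : R, [/\ 0 < s, s < expR (- v ^+ 2), expR (- v ^+ 2) < t, t < 1 &
   Vx * maxwell_functional (fun z => (z <= t)%R%:R) -
   Vx * maxwell_functional (fun z => (z <= s)%R%:R) <= e]%R.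
  move=> e0; have [s [t [? ? ? ? h]]] := maxwell_continuity v0 (divr_gt0 e0 Vx0).
  by exists s, t; split => //; rewrite -mulrBr mulrC -ler_pdivlMr.
have lim := cvg_functional_tail (fun n => meander_positive n x0)
  (positive_functionalZ (ltW Vx0) (@maxwell_positive R))
  (fun k => @meander_moment x Vx k x0 VE) cont.
have : (meander_functional x n (fun z => (z <= expR (- v ^+ 2))%R%:R))%:E @[n --> \oo] -->
    (Vx * maxwell_functional (fun z => (z <= expR (- v ^+ 2))%R%:R))%:E.
  by apply: cvg_EFin; [exact: nearW|exact: lim].
apply: cvg_trans; apply: near_eq_cvg; near=> n.
have n0 : (0 < n)%N by near: n; exact: nbhs_infty_gt.
have sn : (0 < Num.sqrt n%:R :> R)%R by rewrite sqrtr_gt0 ltr0n.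
have mA := measurable_alive n.
have mB : measurable (X n @^-1` [set y | (v <= y / Num.sqrt n%:R)%R]).
  rewrite (_ : mkset _ = `[v * Num.sqrt n%:R, +oo[%classic)%R; last first.
    by apply/seteqP; split => y; rewrite /= in_itv/= andbT ler_pdivlMr.
  by rewrite -[X in measurable X]setTI; exact: measurable_funP.
have E w : alive n w -> (X n w * (expR (- (X n w ^+ 2 / n%:R)) <= expR (- v ^+ 2))%R%:R)%:E =
    ((fun w => (X n w)%:E) \_ (X n @^-1` [set y | (v <= y / Num.sqrt n%:R)%R])) w.
  move=> /alive_gt0 Xw.
  have -> : (X n w ^+ 2 / n%:R = (X n w / Num.sqrt n%:R) ^+ 2)%R.
    by rewrite expr_div_n sqr_sqrtr.
  rewrite expR_sqr_le ?(ltW v0)//; last by rewrite divr_ge0 ?sqrtr_ge0 ?ltW.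
  rewrite patchE (_ : (w \in _) = (v <= X n w / Num.sqrt n%:R)%R).
    by case: (v <= _)%R; rewrite ?mulr1 ?mulr0.
  by apply/idP/idP; rewrite inE.
rewrite integral_mkcondr /= /meander_functional /Rintegral fineK; last first.
  rewrite ge0_fin_numE.
    apply: le_lt_trans (mean_alive_fin n x0); apply: ge0_le_integral => //.
    - by move=> w /alive_gt0 Xw; rewrite lee_fin mulr_ge0// ltW.
    - apply/measurable_EFinP; apply: (measurable_funS measurableT) => //.
      apply: measurable_funM => //; apply: (measurableT_comp (proj1 (bounded01_le _))).
      apply: measurableT_comp => //; apply: measurable_funN.
      by apply: measurable_funM => //; exact: measurable_funX.
    - by apply/measurable_EFinP; exact: (measurable_funS measurableT).
    - move=> w /alive_gt0 Xw; rewrite lee_fin ler_piMr ?(ltW Xw)//.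
      by case: (expR _ <= _)%R.
  by apply: integral_ge0 => w /alive_gt0 Xw; rewrite lee_fin mulr_ge0// ltW.
by apply: eq_integral => w; rewrite inE => Aw; rewrite E.
Unshelve. all: by end_near.
Qed.

Lemma sum_mean_overshoot_fin (x : R) : (0 < x)%R -> \sum_(k <oo) mean_overshoot k x < +oo.
Proof.
move=> x0; have [C [_ [hC _]]] := survival_bound x0.
apply: (@le_lt_trans _ _ C%:E); last exact: ltry.
apply: lime_le; first by apply: is_cvg_nneseries => k _ _; exact: mean_overshoot_ge0.
by near=> n; rewrite big_mkord; exact: hC.
Unshelve. all: by end_near.
Qed.

(** By the Markov property these are the overshoots after time n of the chain
    started at x, the tail of a convergent series. *)
Lemma late_overshoot_cvg0 (x : R) (B : nat -> set R) : (0 < x)%R ->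
  (forall n, measurable (B n)) ->
  \int[Px x]_(w in alive n `&` X n @^-1` B n) \sum_(k <oo) kernel_overshoot K k (X n w)
    @[n --> \oo] --> 0.
Proof.
move=> x0 mB.
have mo k n D : measurable D -> measurable_fun D (fun w => kernel_overshoot K k (X n w)).
  move=> mD; apply: (measurable_funS measurableT) => //.
  by apply: measurableT_comp => //; exact: measurable_kernel_overshoot.
have mX n : measurable (X n @^-1` B n).
  by rewrite -[X in measurable X]setTI; exact: measurable_funP.
have mAX n : measurable (alive n `&` X n @^-1` B n).
  by apply: measurableI => //; exact: measurable_alive.
apply: (@squeeze_cvge _ _ _ _ (fun=> 0) _ (fun n => \sum_(n <= k <oo) mean_overshoot k x)); first last.
- by apply: nneseries_tail_cvg; [exact: sum_mean_overshoot_fin|move=> k _; exact: mean_overshoot_ge0].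
- exact: cvg_cst.
near=> n; apply/andP; split.
  by apply: integral_ge0 => w _; apply: nneseries_ge0 => k _ _; exact: kernel_overshoot_ge0.
rewrite -nneseries_addn; last by move=> k; exact: mean_overshoot_ge0.
rewrite integral_nneseries//; [|by move=> k; exact: mo|by move=> k w _; exact: kernel_overshoot_ge0].
apply: lee_nneseries => k _.
  by move=> _; apply: integral_ge0 => w _; exact: kernel_overshoot_ge0.
rewrite addnC /mean_overshoot -(integral_kernel_overshoot X_markov).
apply: ge0_subset_integral => //; [exact: measurable_alive|apply: mo; exact: measurable_alive|by move=> w _; exact: kernel_overshoot_ge0].
Unshelve. all: by end_near.
Qed.

Lemma doob_limit (x v : R) : (0 < x)%R -> (0 < v)%R ->
  doob_transform (V Px X) Px X x n [set y | (v <= y / Num.sqrt n%:R)%R]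
    @[n --> \oo] -->
  (maxwell_functional (fun z => (z <= expR (- v ^+ 2))%R%:R))%:E.
Proof.
move=> x0 v0; set S := \sum_(k <oo) mean_overshoot k x.
have S0 : 0 <= S by apply: nneseries_ge0 => k _ _; exact: mean_overshoot_ge0.
have Sfin : S \is a fin_num by rewrite ge0_fin_numE// sum_mean_overshoot_fin.
have [Vx [Vx0 VE]] : exists Vx : R, (0 < Vx)%R /\ x%:E + S = Vx%:E.
  exists (x + fine S)%R; split; first by rewrite ltr_pwDl// fine_ge0.
  by rewrite EFinD fineK.
have VxE : V Px X x = Vx%:E.
  rewrite (V_series X_markov)// -VE; congr (_ + _); apply: eq_eseriesr => k _.
  exact: (kernel_overshootE X_markov).
set L := maxwell_functional _.
pose B n : set R := [set y | (v <= y / Num.sqrt n%:R)%R].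
have mB n : measurable (B n).
  rewrite (_ : B n = (fun y => y / Num.sqrt n%:R)%R @^-1` `[v, +oo[); last first.
    by apply/seteqP; split => y; rewrite /= in_itv/= andbT.
  by rewrite -[X in measurable X]setTI; apply: measurable_funM.
(* For n = 0 the division by sqrt 0 gives 0, so that B 0 is empty. *)
have B_gt0 n y : B n y -> (0 < y)%R.
  rewrite /B/=; case: n => [|n]; first by rewrite sqrtr0 invr0 mulr0 leNgt v0.
  by rewrite ler_pdivlMr ?sqrtr_gt0// => /(lt_le_trans _); apply; rewrite mulr_gt0 ?sqrtr_gt0.
pose T y := \sum_(k <oo) kernel_overshoot K k y.
have T0 y : 0 <= T y by apply: nneseries_ge0 => k _ _; exact: kernel_overshoot_ge0.
have mT : measurable_fun setT T.
  apply: ge0_emeasurable_sum => [k y _ _|k _]; first exact: kernel_overshoot_ge0.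
  exact: measurable_kernel_overshoot.
have E n : doob_transform (V Px X) Px X x n (B n) =
   (Vx^-1)%:E * (\int[Px x]_(w in alive n `&` X n @^-1` B n) (X n w)%:E +
   \int[Px x]_(w in alive n `&` X n @^-1` B n) T (X n w)).
  rewrite /doob_transform VxE.
  transitivity (\int[killed_law Px X x n]_(y in B n) ((Vx^-1)%:E * (y%:E + T y))).
    rewrite (killed_lawE x n); apply: eq_integral => [A mA|y]; first exact: measurable_funP.
    rewrite inE => /B_gt0 y0.
    by rewrite (V_series X_markov)// inver gt_eqF// muleC.
  have mAX : measurable (alive n `&` X n @^-1` B n).
    apply: measurableI; first exact: measurable_alive.
    by rewrite -[X in measurable X]setTI; exact: measurable_funP.
  have Vi : 0 <= (Vx^-1)%:E by rewrite lee_fin invr_ge0 ltW.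
  rewrite (ge0_integral_killed_law X_markov)//; first last.
  - move=> y /B_gt0 y0; rewrite mule_ge0// adde_ge0// lee_fin ltW//.
  - apply: measurable_funeM; apply: emeasurable_funD => //.
  have mXn : measurable_fun (alive n `&` X n @^-1` B n) (fun w => (X n w)%:E).
    by apply/measurable_EFinP; exact: (measurable_funS measurableT).
  have mTn : measurable_fun (alive n `&` X n @^-1` B n) (fun w => T (X n w)).
    by apply: (measurable_funS measurableT) => //; exact: measurableT_comp.
  have X0 w : (alive n `&` X n @^-1` B n) w -> 0 <= (X n w)%:E.
    by move=> [/alive_gt0 Xw _]; rewrite lee_fin ltW.
  rewrite ge0_integralZl//.
  - by rewrite ge0_integralD.
  - exact: emeasurable_funD.
  - by move=> w Aw; rewrite adde_ge0// X0.
under eq_fun do rewrite E.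
rewrite (_ : L%:E = (Vx^-1)%:E * ((Vx * L)%:E + 0)); last first.
  by rewrite adde0 -EFinM mulKf// gt_eqF.
apply: cvgeZl => //; apply: cvgeD; first by rewrite fin_num_adde_defl.
  exact: (meander_tail x0 v0 Vx0 VE).
exact: late_overshoot_cvg0.
Qed.

End DominatedChain.

Theorem theorem8p9 (R : realType)
  (d : measure_display) (Omega : measurableType d)
  (K : R.-pker R ~> R) (Px : R -> probability Omega R)
  (X : nat -> {mfun Omega >-> R}) (X_markov : markov_chain K Px X)
  (dxi : measure_display) (Txi : R -> measurableType dxi)
  (Pxi : forall x : R, probability (Txi x) R)
  (xi : forall x : R, {RV (Pxi x) >-> R})
  (xi_jump : forall (x : R) (B : set R), measurable B ->
     Pxi x (xi x @^-1` B) = Px x [set w | B (X 1%N w - x)%R])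
  (xi_mean : forall x : R, 'E_(Pxi x)[xi x] = 0)
  (xi_var : forall x : R, 'E_(Pxi x)[fun w => (xi x w ^+ 2)%R] = 1)
  (dY : measure_display) (TY : measurableType dY) (PY : probability TY R)
  (Y : {RV PY >-> R})
  (Y_pos : {ae PY, forall w, (0 < Y w)%R})
  (Y_sq : 'E_PY[fun w => (Y w ^+ 2)%R] < +oo)
  (xi_dom : forall x y : R, (0 <= y)%R ->
     Pxi x [set w | (y < `|xi x w|)%R] <= PY [set w | (y < Y w)%R])
  (x : R) (x_pos : (0 < x)%R) (v : R) (v_pos : (0 < v)%R) :
  (fun n : nat =>
     doob_transform (V Px X) Px X x n [set y : R | (v <= y / Num.sqrt n%:R)%R])
    @ \oo -->
  (Num.sqrt (2 / pi))%R%:E *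
    \int[lebesgue_measure]_(u in `[v, +oo[) (u ^+ 2 * expR (- (u ^+ 2 / 2)))%R%:E.
Proof.
rewrite unlock in Y_sq.
pose nu y : probability R R := distribution (Pxi y) (xi y).
have nu_sqr y : \int[nu y]_s (s ^+ 2)%:E = 1.
  rewrite ge0_integral_distribution.
  - by rewrite -(xi_var y) unlock.
  - by apply/measurable_EFinP; exact: measurable_funX.
  - by move=> s; rewrite lee_fin sqr_ge0.
have nu_mean y : \int[nu y]_s s%:E = 0.
  rewrite integral_distribution.
  - by rewrite -(xi_mean y) unlock.
  - exact/measurable_EFinP.
  (* The variance makes xi integrable: |s| <= 1 + s^2. *)
  apply: (@le_integrable _ _ _ _ _ _ _ (fun w => 1 + (xi y w ^+ 2)%:E)) => //.
  - exact/measurable_EFinP.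
  - move=> w _ /=; have s0 : (0 <= 1 + xi y w ^+ 2)%R by rewrite addr_ge0 ?sqr_ge0.
    rewrite lee_fin [leRHS]ger0_norm//.
    rewrite ler_norml; apply/andP; split; nra.
  - apply: integrableD => //; first exact: finite_measure_integrable_cst.
    apply/integrableP; split; first by apply/measurable_EFinP; exact: measurable_funX.
    under eq_integral do rewrite gee0_abs ?lee_fin ?sqr_ge0//.
    by have := xi_var y; rewrite unlock => ->; rewrite ltry.
have nu_tail y s : (0 <= s)%R -> nu y [set t | (s < `|t|)%R] <= PY [set w | (s < Y w)%R].
  exact: xi_dom.
have K_nu y (f : R -> \bar R) : measurable_fun setT f -> (forall t, 0 <= f t) ->
    \int[K y]_t f t = \int[nu y]_s f (y + s)%R.
  by apply: (kernel_jump X_markov) => B mB; exact: xi_jump.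
rewrite maxwell_tail//.
exact: (doob_limit X_markov Y_sq nu_mean nu_sqr nu_tail K_nu).
Qed.
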